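(* Consider the $N$-class latest-only strict-priority queue described in the context, with state process $q(t)$, state probability row vector $\mathbf p(t)$, generator $\mathbf Q(t)$, and the state-conditioned first-moment row vectors $\mathbf a_i(t),\mathbf y(t),\mathbf z_i(t)$. Then for each class $i\in\{1,\dots,N\}$ these vectors satisfy the following closed system of linear time-periodic ODEs: (i) $\dot{\mathbf a}_i(t)=\mathbf p(t)+\mathbf a_i(t)\mathbf Q(t)+\bigl(\mathbf y(t)-\mathbf a_i(t)\bigr)\mathbf M^{(i)}(t)$; (ii) $\dot{\mathbf y}(t)=\mathbf p(t)\odot\boldsymbol\delta_{J\neq0}+\mathbf y(t)\mathbf Q(t)+\bigl(\mathbf z^{\mathrm{next}}(t)-\mathbf y(t)\bigr)\mathbf M^{(\mathrm{comp})}(t)$, where $\mathbf z^{\mathrm{next}}(t)=\sum_{k=1}^N\mathbf z_k(t)\odot\boldsymbol\delta_{\mathrm{next}=k}$; (iii) $\dot{\mathbf z}_i(t)=\mathbf p(t)\odot\boldsymbol\delta_{B_i=1}+\mathbf z_i(t)\mathbf Q(t)-\lambda_i(t)\bigl(\mathbf z_i(t)\odot\boldsymbol\delta_{B_i=1}\bigr)-\mathbf z_i(t)\mathbf M^{(\mathrm{next}=i)}(t)$. Furthermore, the mean AoI and mean peak AoI of class $i$ are recovered as $\bar\Delta_i(t)=\mathbf a_i(t)\mathbf 1$ and $\hat\Delta_i(t)=\dfrac{\mathbf a_i(t)\mathbf 1_{J=i}}{\mathbf p(t)\mathbf 1_{J=i}}$ (the latter at every $t$ at which $\hat\Delta_i(t)$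 is defined).
   Context: Model. Fix $N\ge1$ and a period $T>0$. For $i\in\{1,\dots,N\}$, $\lambda_i,\mu_i:[0,\infty)\to[0,\infty)$ are $T$-periodic piecewise continuous functions ($\mu_i$ may vanish on link-outage intervals). Status updates of class $i$ are generated (and arrive) according to independent Poisson processes with rates $\lambda_i(t)$. A single server serves the classes under strict non-preemptive priority (class 1 highest); a class-$i$ packet in service completes at rate $\mu_i(t)$ (exponential service with time-varying rate). Each class has a size-one waiting buffer with latest-only replacement: a new class-$k$ arrival finding a waiting class-$k$ packet replaces it; a packet leaves the buffer when it enters service and is then not preempted. State space: $\mathcal Q=\{(0,0,\dots,0)\}\cup\bigl(\{1,\dots,N\}\times\{0,1\}^N\bigr)$; a state $s=(J(s),B_1(s),\dots,B_N(s))$ records the class in service $J(s)$ ($0$ = idle) and buffer occupancies $B_i(s)\in\{0,1\}$. Let $\mathrm{next}(s)=\min\{i:B_i(s)=1\}$ if this set is nonempty, else $0$. For $J(s)\neq0$, $\mathrm{dest}(s)$ is the state right after a completion: server class $\mathrm{next}(s)$, buffer $B_{\mathrm{next}(s)}$ cleared, other buffers unchanged (the idle state if $\mathrm{next}(s)=0$). A class-$k$ arrival moves the idle state to $(k,0,\dots,0)$, moves a busy state with $B_k=0$ to the same state with $B_k=1$, and leaves a busy state with $B_k=1$ unchanged (replacement). States are indexed by $\sigma(\text{idle})=1$, $\sigma(s)=2+2^N(J(s)-1)+\sum_{i=1}^N2^{i-1}B_i(s)$ for $J(s)\ne0$. $q(t)$ is the state process, $\mathbf p(t)$ the row vector with $p_{\sigma(s)}(t)=\Pr\{q(t)=s\}$,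 satisfying $\dot{\mathbf p}=\mathbf p\mathbf Q$, where for $a\ne b$: $Q_{\sigma(a),\sigma(b)}(t)=\lambda_k(t)$ if $b$ is obtained from $a$ by a (state-changing) class-$k$ arrival, $=\mu_{J(a)}(t)$ if $J(a)\ne0$ and $b=\mathrm{dest}(a)$, and $0$ otherwise; diagonal entries make rows sum to zero. Ages. With $r^{(i)}_n,C^{(i)}_n$ the generation and completion times of the $n$-th delivered class-$i$ update, the AoI is $\Delta_i(t)=t-\max\{r_n^{(i)}:C_n^{(i)}\le t\}$; $\bar\Delta_i(t)=\mathbb E[\Delta_i(t)]$; with $\mathcal E_i(t,t+h)$ the event of a class-$i$ completion in $(t,t+h)$ and $\Delta_i^-(t)$ the left limit of $\Delta_i$ at $t$, $\hat\Delta_i(t)=\lim_{h\to0^+}\mathbb E[\Delta_i^-(t)\mid\mathcal E_i(t,t+h)]$, defined when $\Pr\{\mathcal E_i(t,t+h)\}>0$ for all $h>0$. $Y(t)$ is the age (time since generation) of the packet in service ($0$ if idle) and $Z_i(t)$ the time the packet in the class-$i$ buffer has been waiting since its generation ($0$ if empty). Row vectors in $\mathbb R^{1\times|\mathcal Q|}$: $a_{i,\sigma(s)}(t)=\mathbb E[\Delta_i(t)1\{q(t)=s\}]$, $y_{\sigma(s)}(t)=\mathbb E[Y(t)1\{q(t)=s\}]$, $z_{i,\sigma(s)}(t)=\mathbb E[Z_i(t)1\{q(t)=s\}]$. Matrices: $\mathbf M^{(\mathrm{comp})},\mathbf M^{(i)},\mathbf M^{(\mathrm{next}=i)}$ are $|\mathcal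 Q|\times|\mathcal Q|$ with all entries zero except, for $J(s)\ne0$, the entries at $(\sigma(s),\sigma(\mathrm{dest}(s)))$, which equal respectively $\mu_{J(s)}(t)$, $\mu_i(t)1\{J(s)=i\}$, and $\mu_{J(s)}(t)1\{\mathrm{next}(s)=i\}$. For a state predicate $\mathcal C$, $\boldsymbol\delta_{\mathcal C}$ is the row vector with $[\boldsymbol\delta_{\mathcal C}]_{\sigma(s)}=1\{\mathcal C(s)\}$; $\mathbf 1_{J=i}=\boldsymbol\delta_{J=i}^\top$; $\mathbf 1$ is the all-ones column vector; $\odot$ is the entrywise product.
   Formalization: The ODEs are asserted at t>0 where all rates are continuous (derivatives can fail to exist at rate jumps); the peak AoI formula is for t>0 with p(t)1_{J=i}>0 (else 0/0); the initial configuration is independent of the Poisson drivers, consistently ordered, with integrable ages. *)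

(* Defs.v *)
From HB Require Import structures.
From mathcomp Require Import all_boot all_order all_algebra.
From mathcomp Require Import all_classical all_reals all_analysis.
Set Implicit Arguments. Unset Strict Implicit. Unset Printing Implicit Defensive.
Import Order.TTheory GRing.Theory Num.Theory.
Import numFieldNormedType.Exports.
Local Open Scope classical_set_scope.
Local Open Scope ring_scope.

(* State space.  Classes are indexed by 'I_N (class 0 = highest        *)
(* priority, i.e. paper class i corresponds to ordinal i-1).           *)
(* None = idle state (0,...,0);  Some (j, b) = class j in service,     *)
(* buffer occupancies b.                                               *)
Definition st (N : nat) := option ('I_N * {ffun 'I_N -> bool})%type.

Definition Jst {N} (s : st N) : option 'I_N :=
  if s is Some (j, _) then Some j else None.
Definition Bst {N} (s : st N) (i : 'I_N) : bool :=
  if s is Some (_, b) then b i else false.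

(* next(s) = the smallest class with a full buffer (None = 0). *)
Definition nextc {N} (s : st N) : option 'I_N :=
  ohead [seq i <- enum 'I_N | Bst s i].

(* dest(s): state right after a completion. *)
Definition dest {N} (s : st N) : st N :=
  match s with
  | None => None
  | Some (_, b) =>
      match nextc s with
      | None => None
      | Some m => Some (m, [ffun i => b i && (i != m)])
      end
  end.

Definition arr {N} (k : 'I_N) (s : st N) : st N :=
  match s with
  | None => Some (k, [ffun => false])
  | Some (j, b) => Some (j, [ffun i => b i || (i == k)])
  end.

(* the index sigma(s) (0-based: paper's sigma minus 1) *)
Definition sigma {N} (s : st N) : nat :=
  match s with
  | None => 0
  | Some (j, b) => 1 + 2 ^ N * j + \sum_(i < N) 2 ^ i * b i
  end%N.

Definition nQ (N : nat) : nat := (1 + N * 2 ^ N)%N.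

Section Vectors.
Variables (R : realType) (N : nat).

(* row vector whose sigma(s)-th entry is g s *)
Definition rv_of (g : st N -> R) : 'rV[R]_(nQ N) :=
  \row_x \sum_(s : st N) (if sigma s == x :> nat then g s else 0).

(* matrix whose (sigma(a), sigma(b)) entry is f a b *)
Definition mx_of (f : st N -> st N -> R) : 'M[R]_(nQ N) :=
  \matrix_(x, y) \sum_(a : st N) \sum_(b : st N)
     (if (sigma a == x :> nat) && (sigma b == y :> nat) then f a b else 0).

Definition hadamard (u v : 'rV[R]_(nQ N)) : 'rV[R]_(nQ N) :=
  \row_x (u 0 x * v 0 x).

Definition delta (C : pred (st N)) : 'rV[R]_(nQ N) :=
  rv_of (fun s => if C s then 1 else 0).

Definition ones : 'cV[R]_(nQ N) := const_mx 1.

Variables (lam mu : 'I_N -> R -> R).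

Definition qoff (t : R) (a b : st N) : R :=
  \sum_(k < N) (if (a != b) && (arr k a == b) then lam k t else 0)
  + (match Jst a with
     | Some j => if (a != b) && (dest a == b) then mu j t else 0
     | None => 0 end).

Definition Qgen (t : R) : 'M[R]_(nQ N) :=
  mx_of (fun a b => if a == b then - \sum_(c : st N | c != a) qoff t a c
                    else qoff t a b).

Definition Mcomp (t : R) : 'M[R]_(nQ N) :=
  mx_of (fun a b => match Jst a with
                    | Some j => if b == dest a then mu j t else 0
                    | None => 0 end).

Definition Mcls (i : 'I_N) (t : R) : 'M[R]_(nQ N) :=
  mx_of (fun a b => match Jst a with
                    | Some j => if b == dest a then mu i t * (j == i)%:R else 0
                    | None => 0 end).

Definition Mnext (i : 'I_N) (t : R) : 'M[R]_(nQ N) :=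
  mx_of (fun a b => match Jst a with
                    | Some j => if b == dest a then mu j t * (nextc a == Some i)%:R
                                else 0
                    | None => 0 end).
End Vectors.

Definition piecewise_continuous {R : realType} (f : R -> R) : Prop :=
  (forall b : R, finite_set [set x | 0 < x <= b /\ ~ {for x, continuous f}]) /\
  (forall x : R, 0 <= x -> cvg (f @ x^'+)) /\
  (forall x : R, 0 < x -> cvg (f @ x^'-)).

Definition periodic_on_nonneg {R : realType} (T : R) (f : R -> R) : Prop :=
  forall t, 0 <= t -> f (t + T) = f t.

Definition poissonp {R : realType} (m : R) (n : nat) : R :=
  expR (- m) * m ^+ n / (n`!)%:R.

Definition intensity {R : realType} (f : R -> R) (s t : R) : R :=
  fine (\int[lebesgue_measure]_(u in `[s, t]) (f u)%:E)%E.

Definition counting_path {R : realType} (f : R -> nat) : Prop :=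
  f 0 = 0%N /\
  (forall s t, 0 <= s -> s <= t -> (f s <= f t)%N) /\
  (forall t, 0 <= t -> exists2 e : R, 0 < e & forall u, t <= u < t + e -> f u = f t).

Definition jumps {R : realType} (f : R -> nat) (t : R) : Prop :=
  exists2 e : R, 0 < e & forall u, t - e < u < t -> (f u < f t)%N.

Section Model.
Variables (R : realType) (N : nat).
Variables (d : measure_display) (Omega : measurableType d).

(* index of the 2N driving Poisson processes: inl k = class-k arrivals,
   inr j = class-j service clock (rate mu_j) *)
Definition pidx := ('I_N + 'I_N)%type.

Variables (lam mu : 'I_N -> R -> R) (A S : 'I_N -> Omega -> R -> nat).
Variables (q : Omega -> R -> st N) (G : Omega -> R -> R)
          (W L : 'I_N -> Omega -> R -> R).

Definition cnt (k : pidx) : Omega -> R -> nat :=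
  match k with inl i => A i | inr j => S j end.
Definition rate (k : pidx) : R -> R :=
  match k with inl i => lam i | inr j => mu j end.

Definition init_ev (s0 : st N) (cG : R) (cW cL : 'I_N -> R) : set Omega :=
  [set w | q w 0 = s0 /\ G w 0 <= cG /\ (forall k, W k w 0 <= cW k)
           /\ (forall k, L k w 0 <= cL k)].

(* a list of increment events: (process, s, t, n) means N_k(t) - N_k(s) = n *)
Definition incr_ev (l : seq (pidx * R * R * nat)) : set Omega :=
  [set w | all (fun e : pidx * R * R * nat =>
             (cnt e.1.1.1 w e.1.2 - cnt e.1.1.1 w e.1.1.2 == e.2)%N) l].

Definition admissible (l : seq (pidx * R * R * nat)) : Prop :=
  (forall e, e \in l -> 0 <= e.1.1.2 <= e.1.2) /\
  (forall j1 j2, (j1 < size l)%N -> (j2 < size l)%N -> j1 <> j2 ->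
     forall e1 e2, e1 = nth e1 l j1 -> e2 = nth e2 l j2 ->
     e1.1.1.1 = e2.1.1.1 -> e1.1.2 <= e2.1.1.2 \/ e2.1.2 <= e1.1.1.2).

(* The driving processes are mutually independent (time-varying) Poisson
   processes with rates lam_k, mu_j, independent of the initial data. *)
Definition poisson_law (P : probability Omega R) : Prop :=
  forall s0 cG cW cL (l : seq (pidx * R * R * nat)), admissible l ->
    P (init_ev s0 cG cW cL `&` incr_ev l) =
    (P (init_ev s0 cG cW cL) *
     (\prod_(e <- l) poissonp (intensity (rate e.1.1.1) e.1.1.2 e.1.2) e.2)%:E)%E.

(* configuration: state, generation time of packet in service, generation
   times of buffered packets, generation time of latest delivered packet *)
Definition cfg := (st N * R * {ffun 'I_N -> R} * {ffun 'I_N -> R})%type.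

Definition config (w : Omega) (t : R) : cfg :=
  (q w t, G w t, [ffun k => W k w t], [ffun k => L k w t]).

Definition arr_step (k : 'I_N) (t : R) (c : cfg) : cfg :=
  let: (s, g, wb, l) := c in
  match s with
  | None => (arr k s, t, wb, l)
  | Some _ => (arr k s, g, [ffun i => if i == k then t else wb i], l)
  end.

Definition srv_step (j : 'I_N) (c : cfg) : cfg :=
  let: (s, g, wb, l) := c in
  if Jst s == Some j then
    let l' := [ffun i => if i == j then Num.max (l i) g else l i] in
    match nextc s with
    | None => (dest s, g, wb, l')
    | Some m => (dest s, wb m, wb, l')
    end
  else c.

Definition events (w : Omega) (t : R) : seq pidx :=
  [seq inl k | k <- enum 'I_N & `[< jumps (A k w) t >]] ++
  [seq inr j | j <- enum 'I_N & `[< jumps (S j w) t >]].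

(* all events occurring at time t, processed in a fixed order (ties have
   probability zero) *)
Definition step_all (w : Omega) (t : R) (c : cfg) : cfg :=
  foldl (fun c e => match e with inl k => arr_step k t c
                            | inr j => srv_step j c end) c (events w t).

Definition dynamics (w : Omega) : Prop :=
  (forall k, counting_path (A k w) /\ counting_path (S k w)) /\
  (forall t, 0 <= t -> exists2 e : R, 0 < e &
        forall u, t <= u < t + e -> config w u = config w t) /\
  (forall t, 0 < t -> exists c : cfg, exists2 e : R, 0 < e &
        (forall u, t - e < u < t -> config w u = c) /\
        config w t = step_all w t c).

(* consistency of the initial configuration: generation times are in the
   past and ordered as in any reachable state *)
Definition init_consistent (w : Omega) : Prop :=
  G w 0 <= 0 /\ (forall k, W k w 0 <= 0 /\ L k w 0 <= 0) /\
  (forall k, Jst (q w 0) = Some k -> L k w 0 <= G w 0) /\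
  (forall k, Bst (q w 0) k -> L k w 0 <= W k w 0 /\
             (Jst (q w 0) = Some k -> G w 0 <= W k w 0)).

Definition AoI (i : 'I_N) (w : Omega) (t : R) : R := t - L i w t.
Definition Yage (w : Omega) (t : R) : R :=
  if q w t is Some _ then t - G w t else 0.
Definition Zage (k : 'I_N) (w : Omega) (t : R) : R :=
  if Bst (q w t) k then t - W k w t else 0.
Definition AoI_left (i : 'I_N) (w : Omega) (t : R) : R :=
  lim (AoI i w @ t^'-).

Definition Ecomp (i : 'I_N) (t h : R) : set Omega :=
  [set w | exists s, t < s < t + h /\ jumps (S i w) s /\
     exists2 e : R, 0 < e & forall u, s - e < u < s -> Jst (q w u) = Some i].

Variable (P : probability Omega R).

Definition pvec (t : R) : 'rV[R]_(nQ N) :=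
  rv_of (fun s => fine (P [set w | q w t = s])).
Definition avec (i : 'I_N) (t : R) : 'rV[R]_(nQ N) :=
  rv_of (fun s => fine (\int[P]_(w in [set w | q w t = s]) (AoI i w t)%:E)%E).
Definition yvec (t : R) : 'rV[R]_(nQ N) :=
  rv_of (fun s => fine (\int[P]_(w in [set w | q w t = s]) (Yage w t)%:E)%E).
Definition zvec (i : 'I_N) (t : R) : 'rV[R]_(nQ N) :=
  rv_of (fun s => fine (\int[P]_(w in [set w | q w t = s]) (Zage i w t)%:E)%E).

Definition meanAoI (i : 'I_N) (t : R) : R :=
  fine (\int[P]_w (AoI i w t)%:E)%E.

Definition condAoI (i : 'I_N) (t h : R) : R :=
  fine (\int[P]_(w in Ecomp i t h) (AoI_left i w t)%:E)%E / fine (P (Ecomp i t h)).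

End Model.

(* Main.v *)
(* A sample path changes only at the jumps of the driving counting processes, so
   the configuration at time [t] is a function of the initial data and of the
   increments up to [t].  Recomputing it from the increments over the cells of
   finer and finer grids shows that it is independent of the increments after
   [t].  Over a short interval [[a, b]], where process [p] has intensity [m_p] and
   all of them together [M], there is no event with probability [exp (- M)], a
   single event, of process [p], with probability [m_p * exp (- M)], and more than
   one with probability at most [M ^ 2].  Writing [c_t] for the configuration, a
   functional [f] with linear growth that is Lipschitz in time and in the
   generation times therefore satisfies
     E f (b, c_b) - E f (a, c_a) = (b - a) * E (df/dt)
       + sum_p m_p * (E f (step_p c_a) - E f (c_a)) + O (M * (b - a) + M ^ 2),
   whence the derivative of its mean.  Taking for [f] the ages on [q = s], and
   using that [L_i <= G] while class [i] is in service, gives the three systems.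
   For the peak age, a completion of class [i] in [(t, t + h)] is, up to
   probability [m_i * M], a single event of the service clock [i] while the state
   at [t] serves class [i]; this event has probability [m_i * exp (- M)]
   independently of the configuration at [t]. *)
Require Import Defs.
From mathcomp Require Import all_boot all_order all_algebra.
From mathcomp Require Import all_classical all_reals all_analysis measurable_realfun.
From mathcomp Require Import zify ring lra.
Set Implicit Arguments. Unset Strict Implicit. Unset Printing Implicit Defensive.
Import Order.TTheory GRing.Theory Num.Theory.
Import numFieldNormedType.Exports.
Local Open Scope classical_set_scope.
Local Open Scope ring_scope.

(** * Sample paths *)

(** The law of the drivers is given only through finite lists of increments together with threshold
    events on the initial data, whereas the configuration is given only through a pathwise
    description. The grid bridges the two: the recomputed configuration is measurable for a
    sigma-algebra generated by a pi-system on which the law is a product, and on a fine grid it has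
    exactly the true state, its recorded times being off by at most one mesh. Hence functionals have
    to be Lipschitz in the recorded times but may depend on the state in any way. Times recorded for
    an idle server or an empty buffer are not controlled initially, so growth is measured by the
    meaningful times alone. Means carry two times, the explicit argument of the functional and the
    time of the configuration, which separates ageing from jumps. For the peak age, the service rate
    may vanish at [t], so that a completion need not have a probability of order [h]. The errors
    therefore have to carry the factor [m_i], and the quotient is normalised by [m_i] rather than by
    [h]. *)

Section RealInduction.
Variable R : realType.
Implicit Types (Pr : R -> Prop) (a t : R).

(** At the supremum of the points up to which [Pr] holds without interruption, the left condition
    gives [Pr] and the right one passes beyond. This replaces an enumeration of the event times of a
    path. *)
Lemma real_induction Pr a : Pr a ->
  (forall t, a <= t -> Pr t ->
     exists2 e, 0 < e & forall u, t < u < t + e -> Pr u) ->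
  (forall t, a < t -> (forall u, a <= u < t -> Pr u) -> Pr t) ->
  forall t, a <= t -> Pr t.
Proof.
move=> Pa Pright Pleft t at_; apply: contrapT => nPt.
pose E := [set x | a <= x /\ forall u, a <= u <= x -> Pr u].
have Ea : E a by split => // u /andP[au ua]; have -> : u = a by apply/eqP; rewrite eq_le au ua.
have Et x : E x -> x <= t.
  move=> [ax Hx]; rewrite leNgt; apply/negP => tx; apply: nPt; apply: Hx.
  by rewrite at_ ltW.
have supE : has_sup E by split; [exists a | exists t => x /Et].
have as_ : a <= sup E by apply: sup_upper_bound.
have Plt u : a <= u < sup E -> Pr u.
  move=> /andP[au us]; have e0 : 0 < sup E - u by rewrite subr_gt0.
  have [x [ax Hx]] := sup_adherent e0 supE; rewrite opprB addrCA subrr addr0 => ux.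
  by apply: Hx; rewrite au ltW.
have Ps : Pr (sup E).
  have [<-//|sa] := eqVneq a (sup E).
  by apply: Pleft => //; rewrite lt_neqAle sa.
have [e e0 He] := Pright _ as_ Ps.
have : E (sup E + e / 2).
  split; first by rewrite (le_trans as_)// lerDl divr_ge0 ?ltW.
  move=> u /andP[au ue]; have [us|us|->//] := ltgtP u (sup E).
    by apply: Plt; rewrite au.
  apply: He; rewrite us (le_lt_trans ue)// ltrD2l.
  by rewrite ltr_pdivrMr// mulr_natr mulr2n ltrDl.
by move/(sup_upper_bound supE); rewrite leNgt ltrDl divr_gt0.
Qed.

End RealInduction.

(** The minimum of the radii serves all the driving processes at once. *)
Lemma fin_eps (R : realType) (I : finType) (Q : R -> I -> Prop) :
  (forall i, exists2 e, 0 < e & forall x, x <= e -> Q x i) ->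
  exists2 e, 0 < e & forall i, Q e i.
Proof.
move=> H; have /choice[e He] : forall i, exists e, 0 < e /\ forall x, x <= e -> Q x i.
  by move=> i; have [e e0 Qe] := H i; exists e.
exists (\big[Num.min/1]_i e i).
  by apply: lt_bigmin => // i _; case: (He i).
by move=> i; case: (He i) => _; apply; exact: bigmin_le.
Qed.

(** * Jumps of a counting path *)

Section CountingPaths.
Variables (R : realType) (f : R -> nat).
Hypothesis fP : counting_path f.
Implicit Types s t u v : R.

Let fle s t : 0 <= s -> s <= t -> (f s <= f t)%N.
Proof. by case: fP => _ [+ _]; apply. Qed.

Lemma jumps_lt s t : 0 <= s -> s < t -> jumps f t -> (f s < f t)%N.
Proof.
move=> s0 st [e e0 He].
pose v := Num.max ((s + t) / 2) (t - e / 2).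
have sv : s <= v by rewrite le_max; apply/orP; left; lra.
apply: leq_ltn_trans (fle s0 sv) _; apply: He.
by rewrite lt_max gt_max; apply/andP; split; [apply/orP; right|apply/andP; split]; lra.
Qed.

Lemma njumps_left s t : 0 <= s -> s < t -> ~ jumps f t ->
  exists2 u, s <= u < t & f u = f t.
Proof.
move=> s0 st nj; apply: contrapT => H; apply: nj.
exists (t - s); first by rewrite subr_gt0.
move=> u /andP[ut tu]; have su : s <= u by lra.
rewrite ltn_neqAle fle ?(le_trans s0) ?(ltW tu)// andbT; apply/eqP => fut.
by apply: H; exists u => //; rewrite su.
Qed.

Lemma no_jumps s t : 0 <= s -> s <= t ->
  (forall u, s < u <= t -> ~ jumps f u) -> f t = f s.
Proof.
move=> s0 st nj.
suff H u : s <= u -> u <= t -> f u = f s by apply: H.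
pose Pr u := u <= t -> f u = f s.
apply: (@real_induction _ Pr) => {u} // [u su Pu|u su Pu ut].
  case: fP => _ [_ /(_ u)[|e e0 He]]; first lra.
  by exists e => // v /andP[uv ve] vt; rewrite He ?(ltW uv)//; apply: Pu; lra.
have [|v vsu <-] := @njumps_left s u s0 su; first by apply: nj; rewrite su.
by apply: Pu => //; lra.
Qed.

(** Induction on a bound for [f t - f s]: if [f] is not constant on [[s, t)], restarting from a
    point where it has increased lowers this integer. *)
Lemma left_const t : 0 < t ->
  exists2 s, 0 <= s < t & forall u, s <= u < t -> f u = f s.
Proof.
move=> t0; suff H n s : 0 <= s < t -> (f t - f s <= n)%N ->
    exists2 s, 0 <= s < t & forall u, s <= u < t -> f u = f s.
  by apply: (H (f t) 0); rewrite ?lexx ?t0 ?leq_subr.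
elim: n s => [|n IH] s st fn; have [s0 slt] := andP st.
  exists s => // u /andP[su ut]; have := fle s0 su.
  by have := fle (_ : 0 <= u) (ltW ut); move=> /(_ ltac:(lra)); lia.
have [H|/existsNP[u /not_implyP[/andP[su ut] /eqP fu]]] :=
    pselect (forall u, s <= u < t -> f u = f s); first by exists s.
apply: (IH u); first by apply/andP; split; lra.
have := fle s0 su; have := fle (_ : 0 <= u) (ltW ut).
by move=> /(_ ltac:(lra)); move/eqP: fu; lia.
Qed.

Lemma jumpsP s t : 0 <= s -> s <= t ->
  (f s < f t)%N <-> exists2 u, s < u <= t & jumps f u.
Proof.
move=> s0 st; split=> [fst|[u /andP[su ut] ju]].
  apply: contrapT => H; suff E : f t = f s by rewrite E ltnn in fst.
  by apply: no_jumps => // u ust ju; apply: H; exists u.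
by apply: leq_trans (jumps_lt s0 su ju) _; apply: fle => //; lra.
Qed.

(** Two jumps would raise [f] by at least two. *)
Lemma single_jump s t : 0 <= s -> s <= t -> f t = (f s).+1 ->
  exists2 u, s < u <= t & forall v, s < v <= t -> (jumps f v <-> v = u).
Proof.
move=> s0 st fst; have /(jumpsP s0 st)[u ust ju] : (f s < f t)%N by rewrite fst.
exists u => // v vst; split=> [jv|->//].
suff lt2 x y : s < x -> x < y -> y <= t -> jumps f x -> jumps f y -> False.
  have [vu|uv|//] := ltgtP v u; exfalso; first by apply: (lt2 v u) => //; lra.
  by apply: (lt2 u v) => //; lra.
move=> sx xy yt jx jy; have := jumps_lt s0 sx jx.
have x0 : 0 <= x by lra.
by have := jumps_lt x0 xy jy; have := fle (le_trans x0 (ltW xy)) yt; rewrite fst; lia.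
Qed.

End CountingPaths.

(** * The configuration along a path *)

Section SamplePaths.
Variables (R : realType) (N : nat) (d : measure_display) (Omega : measurableType d).
Variables (A S : 'I_N -> Omega -> R -> nat) (q : Omega -> R -> st N)
  (G : Omega -> R -> R) (W L : 'I_N -> Omega -> R -> R).
Implicit Types (w : Omega) (s t u : R) (p : pidx N) (c : cfg R N).

Local Notation cnt := (cnt A S).
Local Notation config := (config q G W L).
Local Notation dynamics := (dynamics A S q G W L).

Definition step p t c : cfg R N :=
  match p with inl k => arr_step k t c | inr j => srv_step j c end.

Definition steps t (l : seq (pidx N)) c : cfg R N :=
  foldl (fun c p => step p t c) c l.

(** The order is that of [events], so that simultaneous events are processed alike by [step_all] and
    on a grid. *)
Definition pidx_enum : seq (pidx N) :=
  [seq inl k | k <- enum 'I_N] ++ [seq inr j | j <- enum 'I_N].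

Lemma mem_pidx_enum p : p \in pidx_enum.
Proof.
by rewrite mem_cat; case: p => i; [rewrite map_f ?mem_enum|
  rewrite orbC map_f ?mem_enum].
Qed.

Lemma pidx_enum_uniq : uniq pidx_enum.
Proof.
have inl_inj : injective (@inl 'I_N 'I_N) by move=> i j [].
have inr_inj : injective (@inr 'I_N 'I_N) by move=> i j [].
rewrite cat_uniq (map_inj_uniq inl_inj) (map_inj_uniq inr_inj).
apply/and3P; split; [exact: enum_uniq| |exact: enum_uniq].
by apply/hasPn => _ /mapP[i _ ->]; apply/mapP => -[].
Qed.

Lemma eventsE w t : events A S w t = [seq p <- pidx_enum | `[< jumps (cnt p w) t >]].
Proof. by rewrite /events filter_cat !filter_map. Qed.

Lemma step_allE w t c : step_all A S w t c = steps t (events A S w t) c.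
Proof. by []. Qed.

(** A process is listed once whatever its increment, just as [events] ignores the size of a jump. *)
Definition cell_events w s t : seq (pidx N) :=
  [seq p <- pidx_enum | (cnt p w s < cnt p w t)%N].

Lemma dynamics_cnt w p : dynamics w -> counting_path (cnt p w).
Proof. by move=> [cP _]; case: p => i /=; case: (cP i). Qed.

Lemma events_nil w t : (forall p, ~ jumps (cnt p w) t) -> events A S w t = [::].
Proof.
move=> nj; rewrite eventsE -(filter_pred0 pidx_enum).
by apply: eq_filter => p; apply/negbTE/asboolPn.
Qed.

Lemma cell_events_nil w s t : dynamics w -> 0 <= s -> s <= t ->
  (forall u, s < u <= t -> events A S w u = [::]) -> cell_events w s t = [::].
Proof.
move=> wP s0 st ev; rewrite /cell_events -(filter_pred0 pidx_enum).
apply: eq_filter => p; apply/negbTE/negP => /(jumpsP (dynamics_cnt p wP) s0 st)[u ust ju].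
have : p \in events A S w u.
  by rewrite eventsE mem_filter mem_pidx_enum andbT; apply/asboolP.
by rewrite ev.
Qed.

(** Real induction: right-constancy continues the value, and at a later time the value held on the
    left goes through an empty list of steps. *)
Lemma config_const w s t : dynamics w -> 0 <= s -> s <= t ->
  (forall u, s < u <= t -> events A S w u = [::]) -> config w t = config w s.
Proof.
move=> [_ [wr wl]] s0 st ev.
suff H u : s <= u -> u <= t -> config w u = config w s by apply: H.
pose Pr u := u <= t -> config w u = config w s.
apply: (@real_induction _ Pr) => {u} // [u su Pu|u su Pu ut].
  have [|e e0 He] := wr u; first lra.
  by exists e => // v /andP[uv ve] vt; rewrite He ?(ltW uv)//; apply: Pu; lra.
have [|c [e e0 [He ->]]] := wl u; first lra.
rewrite step_allE ev ?su//=.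
(* Close enough to [u] for the configuration to be [c], yet not before [s]. *)
pose v := Num.max s (u - e / 2).
have sv : s <= v by rewrite le_max lexx.
have vu : v < u by rewrite gt_max su; lra.
have ev' : u - e < v by rewrite lt_max; apply/orP; right; lra.
by rewrite -(He v) ?vu ?ev'//; apply: Pu; lra.
Qed.

Lemma config_step w s t u : dynamics w -> 0 <= s -> s < t -> t <= u ->
  (forall v, s < v <= u -> v <> t -> events A S w v = [::]) ->
  config w u = steps t (events A S w t) (config w s).
Proof.
move=> wP s0 st tu ev.
rewrite (@config_const w t u wP) ?(le_trans s0) ?(ltW st)//; last first.
  by move=> v vt; apply: ev; [lra|move=> vE; lra].
case: (wP) => _ [_ wl]; have [|c [e e0 [He ->]]] := wl t; first lra.
rewrite step_allE; congr steps.
pose v := Num.max s (t - e / 2).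
have sv : s <= v by rewrite le_max lexx.
have vt : v < t by rewrite gt_max st; lra.
have ev' : t - e < v by rewrite lt_max; apply/orP; right; lra.
rewrite -(He v) ?vt ?ev'//; apply: config_const => // x xv.
by apply: ev; [lra|move=> xE; lra].
Qed.

Lemma cell_events_step w s t u : dynamics w -> 0 <= s -> s < t -> t <= u ->
  (forall v, s < v <= u -> v <> t -> events A S w v = [::]) ->
  cell_events w s u = events A S w t.
Proof.
move=> wP s0 st tu ev; rewrite eventsE; apply: eq_filter => p.
have su : s <= u by lra.
apply/idP/asboolP => [/(jumpsP (dynamics_cnt p wP) s0 su)[v vsu jv]|jt].
  have [<-//|/eqP vt] := eqVneq v t.
  have : p \in events A S w v.
    by rewrite eventsE mem_filter mem_pidx_enum andbT; apply/asboolP.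
  by rewrite ev.
apply/(jumpsP (dynamics_cnt p wP) s0 su).
by exists t => //; rewrite st.
Qed.

(** The invariant may depend on time, provided that it survives the passage of time and every single
    step. The bounds on the recorded times and their ordering are obtained in this way. *)
Lemma config_ind w (Inv : R -> cfg R N -> Prop) s : dynamics w -> 0 <= s ->
  (forall t u c, s <= t -> t <= u -> Inv t c -> Inv u c) ->
  (forall p t c, s <= t -> Inv t c -> Inv t (step p t c)) ->
  Inv s (config w s) -> forall t, s <= t -> Inv t (config w t).
Proof.
move=> wP s0 mono stepP I0; apply: real_induction => // [t st It|t st It].
  case: wP => _ [/(_ t (le_trans s0 st))[e e0 He] _]; exists e => // u /andP[tu ue].
  by rewrite He ?(ltW tu)//; apply: mono It => //; exact: ltW.
case: (wP) => _ [_ wl]; have [|c [e e0 [He ->]]] := wl t; first lra.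
have Ic : Inv t c.
  pose v := Num.max s (t - e / 2).
  have sv : s <= v by rewrite le_max lexx.
  have vt : v < t by rewrite gt_max st; lra.
  have ev' : t - e < v by rewrite lt_max; apply/orP; right; lra.
  have Ec : config w v = c by apply: He; rewrite vt ev'.
  by apply: (@mono v) (ltW vt) _ => //; rewrite -Ec; apply: It; rewrite sv.
rewrite step_allE; elim: (events A S w t) c Ic {He} => //= p l IH c Ic.
by apply: IH; apply: stepP => //; exact: ltW.
Qed.

(** Real induction on the right end. After [t] there is no event for a while, so the gap is
    unchanged; before [t] there is none on some [(s, t)], so a new pair consists of [t] and a time
    at most [s]. *)
Lemma events_gap w t : dynamics w -> 0 <= t ->
  exists2 e, 0 < e & forall u v, 0 < u -> u < v -> v <= t ->
    events A S w u <> [::] -> events A S w v <> [::] -> e <= v - u.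
Proof.
move=> wP.
pose Gap x := exists2 e, 0 < e & forall u v, 0 < u -> u < v -> v <= x ->
    events A S w u <> [::] -> events A S w v <> [::] -> e <= v - u.
move: t; apply: (@real_induction _ Gap) => [|t t0 [e e0 He]|t t0 IH].
- by exists 1 => // u v; lra.
- have [e1 e10 He1] : exists2 e, 0 < e & forall p u, t < u < t + e -> ~ jumps (cnt p w) u.
    apply: fin_eps => p; have cP := dynamics_cnt p wP.
    case: (cP) => _ [_ /(_ t t0)[x x0 Hx]]; exists x => // y yx u /andP[tu ux].
    have ut : t <= u by lra.
    move=> ju; have : (cnt p w t < cnt p w u)%N.
      by apply/(jumpsP cP) => //; exists u; rewrite ?tu/=.
    by rewrite (Hx u) ?ltnn// ut; lra.
  exists e1 => // x /andP[tx xt]; exists e => // u v u0 uv vx eu ev.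
  have [vt|tv] := leP v t; first exact: He.
  by case: ev; apply: events_nil => p; apply: He1; lra.
- have [s s0 Hs] : exists2 s, 0 <= s < t & forall p u, s < u < t -> ~ jumps (cnt p w) u.
    have [e e0 He] : exists2 e, 0 < e & forall p u, t - e < u < t -> ~ jumps (cnt p w) u.
      apply: fin_eps => p; have cP := dynamics_cnt p wP.
      have [s /andP[s0 st] Hs] := left_const cP t0.
      exists (t - s) => [|x xts u /andP[tu ut] ju]; first lra.
      have : (cnt p w s < cnt p w u)%N.
        by apply/(jumpsP cP) => //; [lra|exists u => //; apply/andP; split; lra].
      by rewrite (Hs u) ?ltnn//; lra.
    exists (Num.max 0 (t - e)) => [|p u /andP[]].
      by rewrite le_max lexx gt_max t0/=; lra.
    by rewrite gt_max => /andP[_ tu] ut; apply: He; rewrite tu.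
  have [e e0 He] := IH s s0.
  exists (Num.min e (t - s)) => [|u v u0 uv vt eu ev]; first by rewrite lt_min e0; lra.
  have nos x : s < x < t -> events A S w x = [::].
    by move=> xst; apply: events_nil => p; exact: Hs.
  have us : u <= s.
    by rewrite leNgt; apply/negP => su; apply: eu; apply: nos; rewrite su; lra.
  rewrite ge_min; apply/orP; have [vs|sv] := leP v s; first by left; exact: He.
  have [vlt|tv] := ltP v t; last by right; lra.
  by case: ev; apply: nos; rewrite sv.
Qed.

End SamplePaths.

(** * Configurations and their discretization *)

Section Configurations.
Variables (R : realType) (N : nat).
Implicit Types (s : st N) (t u v M e : R) (p : pidx N) (c : cfg R N).

Definition cstate c : st N := c.1.1.1.
Definition cgen c : R := c.1.1.2.
Definition cwait c : {ffun 'I_N -> R} := c.1.2.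
Definition clast c : {ffun 'I_N -> R} := c.2.

Lemma nextc_Bst s k : nextc s = Some k -> Bst s k.
Proof.
rewrite /nextc; case E: [seq _ <- _ | _] => [//|i l] [<-].
have : i \in [seq j <- enum 'I_N | Bst s j] by rewrite E mem_head.
by rewrite mem_filter => /andP[].
Qed.

(* The times recorded for an empty server or buffer are junk, hence left free. *)
Definition times_le M c :=
  [/\ forall k, `|clast c k| <= M, cstate c != None -> `|cgen c| <= M
    & forall k, Bst (cstate c) k -> `|cwait c k| <= M].

(** The states agree exactly, so that a further step takes the same branch on both sides. Unlike in
    [times_le], all recorded times are compared, meaningful or not. *)
Definition cfg_close e c c' :=
  [/\ cstate c = cstate c', `|cgen c - cgen c'| <= e,
      forall k, `|cwait c k - cwait c' k| <= e
    & forall k, `|clast c k - clast c' k| <= e].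

(* In a reachable configuration the delivered, served and waiting packets of a
   class were generated in this order. *)
Definition ordered t c :=
  [/\ cgen c <= t, forall k, cwait c k <= t, forall k, clast c k <= t,
      forall k, Jst (cstate c) = Some k -> clast c k <= cgen c
    & forall k, Bst (cstate c) k -> clast c k <= cwait c k /\
                (Jst (cstate c) = Some k -> cgen c <= cwait c k)].

Lemma le_max_dist a b a' b' e : `|a - a'| <= e -> `|b - b'| <= e ->
  `|Num.max a b - Num.max a' b'| <= e.
Proof.
rewrite !ler_norml => /andP[? ?] /andP[? ?].
by rewrite /Num.max; case: ifP => [|/negbT]; case: ifP => [|/negbT];
  rewrite -?leNgt => ? ?; apply/andP; split; lra.
Qed.

Lemma le_max_norm a b M : `|a| <= M -> `|b| <= M -> `|Num.max a b| <= M.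
Proof. by rewrite /Num.max; case: ifP. Qed.

Lemma times_leW M M' c : M <= M' -> times_le M c -> times_le M' c.
Proof.
move=> MM' [lM gM wM]; split=> [k|/gM|k /wM] => [|?|?].
- exact: le_trans (lM k) MM'.
- exact: le_trans MM'.
- exact: le_trans MM'.
Qed.

Lemma step_times_le p t M c : `|t| <= M -> times_le M c -> times_le M (step p t c).
Proof.
move=> tM; case: c => [[[s g] wb] l]; rewrite /times_le /cstate/cgen/cwait/clast/=.
case: p => k /=.
  case: s => [[j b]|] [/= lM gM wM] /=; split=> //= i.
    by rewrite !ffunE; case: ifP => // _; rewrite orbF; exact: wM.
  by rewrite ffunE.
case: s => [[j b]|] [/= lM gM wM] //=; case: ifP => [/eqP[jk]|_] //=.
subst j; have gM' := gM isT.
have lM' i : `|[ffun i => if i == k then Num.max (l i) g else l i] i| <= M.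
  by rewrite ffunE; case: ifP => // _; exact: le_max_norm.
case E : nextc => [m|] //=; split => // [_|i].
  by apply: wM; exact: (nextc_Bst E).
by rewrite ffunE => /andP[+ _]; exact: wM.
Qed.

(** With equal states both steps do the same: they write the current time, copy a recorded time, or
    take a maximum, which is Lipschitz with constant 1. *)
Lemma step_close p t u e c c' : `|t - u| <= e -> cfg_close e c c' ->
  cfg_close e (step p t c) (step p u c').
Proof.
move=> tu; case: c c' => [[[s g] wb] l] [[[s' g'] wb'] l'].
rewrite /cfg_close /cstate/cgen/cwait/clast/= => -[<- {s'} gg ww ll].
case: p => k /=.
  by case: s => [[j b]|]; split => // i; rewrite !ffunE; case: ifP.
case: s => [[j b]|] //=; case: ifP => [/eqP[jk]|_] //=.
by case: nextc => [m|] //=; split=> // i; rewrite !ffunE; case: ifP => // _;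
  exact: le_max_dist.
Qed.

Lemma steps_close l t u e c c' : `|t - u| <= e -> cfg_close e c c' ->
  cfg_close e (steps t l c) (steps u l c').
Proof.
by move=> tu; elim: l c c' => //= p l IH c c' cc; apply: IH; exact: step_close.
Qed.

(** An arrival records the latest time so far. At a completion, a packet of the same class still
    waiting was generated no earlier than the delivered one, and the packet entering service leaves
    its buffer. *)
Lemma step_ordered p t c : ordered t c -> ordered t (step p t c).
Proof.
case: c => [[[s g] wb] l]; rewrite /ordered /cstate/cgen/cwait/clast/=.
move=> -[gt wt lt Jl Bl].
case: p => k /=.
  case: s Jl Bl => [[j b]|] /= Jl Bl; split=> // i; rewrite ?ffunE//.
    by case: ifP.
  case: ifP => [_ _|_]; first by split.
  by rewrite orbF; exact: Bl.
case: s Jl Bl => [[j b]|] //= Jl Bl; case: ifP => [/eqP[jk]|_] //=.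
subst j; have lg := Jl k erefl.
have wl i : b i -> [ffun i => if i == k then Num.max (l i) g else l i] i <= wb i.
  move=> bi; rewrite ffunE; case: eqP => [ik|_]; last by case: (Bl i bi).
  by have [lw gw] := Bl i bi; rewrite ge_max lw gw ?ik.
have lt' i : [ffun i => if i == k then Num.max (l i) g else l i] i <= t.
  by rewrite ffunE; case: ifP => // _; rewrite ge_max lt gt.
case E : nextc => [m|] //=; split => // i.
  by move=> -[<-]; apply: wl; exact: (nextc_Bst E).
rewrite ffunE => /andP[bi im]; split; first exact: wl.
by move=> [mi]; rewrite mi eqxx in im.
Qed.

End Configurations.

(** * Recomputation on a grid *)

Section Discretization.
Variables (R : realType) (N : nat) (d : measure_display) (Omega : measurableType d).
Variables (A S : 'I_N -> Omega -> R -> nat) (q : Omega -> R -> st N)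
  (G : Omega -> R -> R) (W L : 'I_N -> Omega -> R -> R).
Implicit Types (w : Omega) (h t : R) (j : nat).

Local Notation config := (config q G W L).
Local Notation dynamics := (dynamics A S q G W L).

(* The configuration recomputed from the increments over the cells of a grid of
   mesh [h], all events of a cell being moved to its right end. *)
Fixpoint grid_config h j w : cfg R N :=
  if j is i.+1 then
    steps (h * i.+1%:R) (cell_events A S w (h * i%:R) (h * i.+1%:R)) (grid_config h i w)
  else config w 0.

(** The mesh is below the gap between event times, so a cell contains at most one of them and its
    list of events is the true one. Only the time is moved, by at most [h]; as recorded times are
    written, copied or compared but never added, the errors do not accumulate. *)
Lemma grid_config_close w h e t j : dynamics w -> 0 <= h -> h < e ->
  (forall u v, 0 < u -> u < v -> v <= t ->
    events A S w u <> [::] -> events A S w v <> [::] -> e <= v - u) ->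
  h * j%:R <= t -> cfg_close h (grid_config h j w) (config w (h * j%:R)).
Proof.
move=> wP h0 he gap; elim: j => [_|j IH hj].
  by rewrite mulr0; split=> // *; rewrite subrr normr0.
set a := h * j%:R in IH *; set b := h * _ in hj *.
have ab : b = a + h by rewrite /a /b -natr1 mulrDr mulr1.
have a0 : 0 <= a by rewrite mulr_ge0.
have cl : cfg_close h (grid_config h j w) (config w a) by apply: IH; lra.
have [H|/existsNP[x /not_implyP[/andP[ax xb] ex]]] :=
    pselect (forall u, a < u <= b -> events A S w u = [::]).
  by rewrite /= -/a -/b (@cell_events_nil R N d Omega A S q G W L)//=;
     [rewrite (@config_const R N d Omega A S q G W L w a b)//; lra|lra].
have nev v : a < v <= b -> v <> x -> events A S w v = [::].
  move=> /andP[av vb] vx; apply: contrapT => ev.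
  have [vx'|xv|//] := ltgtP v x.
    by have := gap v x _ vx' _ ev ex; move=> /(_ ltac:(lra) ltac:(lra)); lra.
  by have := gap x v _ xv _ ex ev; move=> /(_ ltac:(lra) ltac:(lra)); lra.
rewrite /= -/a -/b (@cell_events_step R N d Omega A S q G W L w a x b)//.
rewrite (@config_step R N d Omega A S q G W L w a x b)//.
by apply: steps_close => //; rewrite ler_norml; apply/andP; split; lra.
Qed.

Lemma grid_config_cvg w t : dynamics w -> 0 <= t ->
  \forall n \near \oo, cfg_close (t / n.+1%:R) (grid_config (t / n.+1%:R) n.+1 w) (config w t).
Proof.
move=> wP t0; have [e e0 gap] := events_gap wP t0.
have : t / n.+1%:R @[n --> \oo] --> 0.
  rewrite -[0](mulr0 t); apply: cvgM; [exact: cvg_cst|].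
  exact: (@cvg_harmonic R).
move=> /cvgrPdist_lt /(_ e e0); apply: filterS => n.
rewrite sub0r normrN ger0_norm ?divr_ge0// => ne.
have E : t / n.+1%:R * n.+1%:R = t by rewrite divfK.
rewrite -[X in config w X]E; apply: (@grid_config_close w _ e t) => //.
  by rewrite divr_ge0.
by rewrite E.
Qed.

End Discretization.

(** * Measurable functionals of the configuration *)

Section MeasurableConfigurations.
Variables (R : realType) (N : nat).
Implicit Types (s : st N) (t u v M e : R) (p : pidx N) (c : cfg R N).

(** The effect of [step] on the state, which depends neither on the current time nor on the recorded
    ones. *)
Definition st_step p s : st N :=
  match p with inl k => arr k s | inr j => if Jst s == Some j then dest s else s end.

Lemma cstate_step p t c : cstate (step p t c) = st_step p (cstate c).
Proof.
case: c => [[[s g] wb] l]; case: p => k /=; first by case: s.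
by rewrite /cstate/=; case: ifP => //= _; case: nextc.
Qed.

Lemma cgen_step p t c : cgen (step p t c) =
  match p with
  | inl k => if cstate c == None then t else cgen c
  | inr j => if Jst (cstate c) == Some j then
      if nextc (cstate c) is Some m then cwait c m else cgen c else cgen c
  end.
Proof.
case: c => [[[s g] wb] l]; case: p => k /=; first by case: s.
by rewrite /cstate/cgen/cwait/=; case: ifP => //= _; case: nextc.
Qed.

Lemma cwait_step p t c i : cwait (step p t c) i =
  match p with
  | inl k => if (cstate c != None) && (i == k) then t else cwait c i
  | inr j => cwait c i
  end.
Proof.
case: c => [[[s g] wb] l]; case: p => k /=.
  by case: s => //= a; rewrite /cwait/= ffunE.
by rewrite /cwait/=; case: ifP => //= _; case: nextc.
Qed.

Lemma clast_step p t c i : clast (step p t c) i =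
  match p with
  | inl k => clast c i
  | inr j => if (Jst (cstate c) == Some j) && (i == j) then Num.max (clast c i) (cgen c)
             else clast c i
  end.
Proof.
case: c => [[[s g] wb] l]; case: p => k /=; first by case: s.
by rewrite /cstate/clast/cgen/=; case: ifP => //= _; case: nextc => [m|] /=; rewrite ffunE.
Qed.

(** Stated by components and over any measurable source: it is used on [Omega] and on [Omega] with
    the coarser sigma-algebra of a grid. *)
Definition cfg_measurable d (T : measurableType d) (X : T -> cfg R N) :=
  [/\ forall s, measurable [set w | cstate (X w) = s],
      measurable_fun setT (fun w => cgen (X w)),
      forall k, measurable_fun setT (fun w => cwait (X w) k)
    & forall k, measurable_fun setT (fun w => clast (X w) k)].

Section Closure.
Variables (d : measure_display) (T : measurableType d) (X : T -> cfg R N).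
Hypothesis mX : cfg_measurable X.

Lemma measurable_cstate_pred (Q : pred (st N)) : measurable [set w | Q (cstate (X w))].
Proof.
rewrite (_ : [set w | _] = \bigcup_(s in [set s | Q s]) [set w | cstate (X w) = s]).
  by apply: fin_bigcup_measurable => [|s _]; [exact: finite_finset|]; case: mX.
apply/seteqP; split=> [w Qw|w [s Qs /= sE]]; last by rewrite /= sE.
by exists (cstate (X w)).
Qed.

Lemma measurable_fun_cstate (g : st N -> T -> R) :
  (forall s, measurable_fun setT (g s)) -> measurable_fun setT (fun w => g (cstate (X w)) w).
Proof.
move=> mg _ Y mY; rewrite setTI.
rewrite (_ : _ @^-1` _ = \bigcup_s ([set w | cstate (X w) = s] `&` g s @^-1` Y)).
  apply: fin_bigcup_measurable => [|s _]; [exact: finite_finset|]; apply: measurableI; first by case: mX.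
  by rewrite -[X in measurable X]setTI; exact: mg.
apply/seteqP; split=> [w Yw|w [s _ [/= <- //]]].
by exists (cstate (X w)).
Qed.

Lemma cfg_measurable_if (D : T -> bool) (Y : T -> cfg R N) :
  measurable [set w | D w] -> cfg_measurable Y ->
  cfg_measurable (fun w => if D w then X w else Y w).
Proof.
move=> mD mY; have mDb : measurable_fun setT D.
  by apply: (@measurable_fun_bool _ _ _ _ true); rewrite setTI.
have mif (g1 g2 : T -> R) : measurable_fun setT g1 -> measurable_fun setT g2 ->
    measurable_fun setT (fun w => if D w then g1 w else g2 w).
  by move=> m1 m2; apply: measurable_fun_ifT.
case: mX mY => qX gX wX lX [qY gY wY lY]; split.
- move=> s; rewrite (_ : [set w | _] = ([set w | D w] `&` [set w | cstate (X w) = s]) `|`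
     (~` [set w | D w] `&` [set w | cstate (Y w) = s])).
    by apply: measurableU; apply: measurableI => //; exact: measurableC.
  apply/seteqP; split=> w /=; case: (D w) => //.
  + by left.
  + by right.
  + by move=> [[]|[]].
  + by move=> [[]|[]].
- by apply: eq_measurable_fun (mif _ _ gX gY) => w _ /=; case: ifP.
- by move=> k; apply: eq_measurable_fun (mif _ _ (wX k) (wY k)) => w _ /=; case: ifP.
- by move=> k; apply: eq_measurable_fun (mif _ _ (lX k) (lY k)) => w _ /=; case: ifP.
Qed.

Lemma cfg_measurable_step p t : cfg_measurable (fun w => step p t (X w)).
Proof.
have [_ gX wX lX] := mX.
have cstE k0 : measurable_fun setT (fun _ : T => k0 : R) by exact: measurable_cst.
split=> [s||i|i].
- have := measurable_cstate_pred (fun a => st_step p a == s).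
  rewrite (_ : [set w | st_step p (cstate (X w)) == s] = [set w | cstate (step p t (X w)) = s])//.
  by apply/seteqP; split=> w /=; rewrite cstate_step => /eqP.
- apply: eq_measurable_fun (@measurable_fun_cstate (fun a w =>
    match p with
    | inl k => if a == None then t else cgen (X w)
    | inr j => if Jst a == Some j then
        if nextc a is Some m then cwait (X w) m else cgen (X w) else cgen (X w)
    end) _) => [w _|a]; first by rewrite cgen_step.
  by case: p => k; case: (_ == _) => //; case: (nextc a).
- apply: eq_measurable_fun (@measurable_fun_cstate (fun a w =>
    match p with
    | inl k => if (a != None) && (i == k) then t else cwait (X w) i
    | inr j => cwait (X w) i
    end) _) => [w _|a]; first by rewrite cwait_step.
  by case: p => k //; case: (_ && _).
- apply: eq_measurable_fun (@measurable_fun_cstate (fun a w =>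
    match p with
    | inl k => clast (X w) i
    | inr j => if (Jst a == Some j) && (i == j) then Num.max (clast (X w) i) (cgen (X w))
               else clast (X w) i
    end) _) => [w _|a]; first by rewrite clast_step.
  by case: p => k //; case: (_ && _) => //; exact: measurable_maxr.
Qed.

End Closure.

(** The list of events is random, but each process enters it under a measurable condition, so that
    the filtered steps are a chain of conditional ones. *)
Lemma cfg_measurable_steps d (T : measurableType d) (l : seq (pidx N)) t
    (D : pidx N -> T -> bool) (X : T -> cfg R N) :
  (forall p, measurable [set w | D p w]) -> cfg_measurable X ->
  cfg_measurable (fun w => steps t [seq p <- l | D p w] (X w)).
Proof.
move=> mD; elim: l X => //= p l IH X mX.
have mX' := IH _ (cfg_measurable_if (cfg_measurable_step mX p t) (mD p) mX).
rewrite (_ : (fun w => _) = fun w => steps t [seq p <- l | D p w]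
  (if D p w then step p t (X w) else X w))//.
by apply/funext => w; case: (D p w).
Qed.

(* The growth bound gives integrability; the Lipschitz bounds absorb the
   displacement of event times, on a grid or within a short interval. *)
Definition good (f : R -> cfg R N -> R) := exists2 K, 0 <= K &
  [/\ forall d (T : measurableType d) (X : T -> cfg R N) u, cfg_measurable X ->
        measurable_fun setT (fun w => f u (X w)),
      forall u c M, 0 <= M -> times_le M c -> `|f u c| <= K * (`|u| + M + 1),
      forall u v c, `|f u c - f v c| <= K * `|u - v|
    & forall u c c' e, cfg_close e c c' -> `|f u c - f u c'| <= K * e].

(** The constant doubles because the time [u] now acts twice, as the argument of [f] and as the time
    that the step records. *)
Lemma good_comp_step f p : good f -> good (fun u c => f u (step p u c)).
Proof.
move=> [K K0 [mf bf lf cf]]; exists (2 * K); first by rewrite mulr_ge0.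
split=> [d T X u mX|u c M M0 cM|u v c|u c c' e cc].
- by apply: mf; exact: cfg_measurable_step.
- apply: le_trans (bf u _ (`|u| + M) _ _) _.
  + by rewrite addr_ge0.
  + by apply: step_times_le; [rewrite lerDl|apply: times_leW cM; rewrite lerDr].
  + by rewrite (mulrC 2) -mulrA ler_wpM2l//; have := normr_ge0 u; lra.
- rewrite (_ : _ - _ = (f u (step p u c) - f v (step p u c)) +
                       (f v (step p u c) - f v (step p v c))); last by ring.
  rewrite (le_trans (ler_normD _ _))// (mulrC 2) -mulrA mulr_natl mulr2n mulrDr lerD//.
  by apply: cf; apply: step_close => //; split=> *; rewrite ?subrr ?normr0.
- rewrite (@le_trans _ _ (K * e))//; first by apply: cf; apply: step_close => //; rewrite subrr normr0; case: cc => _ + _ _; exact: le_trans.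
  have : 0 <= e by case: cc => _ + _ _; exact: le_trans.
  by move=> e0; rewrite ler_wpM2r// ler_peMl// ler1n.
Qed.

(* Their means are the entries of the vectors a_i, y and z_i. *)
Definition delivered_age i s u c := if cstate c == s then u - clast c i else 0.
Definition served_age s u c := if (cstate c == s) && (s != None) then u - cgen c else 0.
Definition waiting_age i s u c := if (cstate c == s) && Bst s i then u - cwait c i else 0.

(** Every age is the difference of the current time and one recorded time, restricted to states
    where that time is meaningful and hence bounded through [times_le]. *)
Lemma good_if (Q : pred (st N)) (x : cfg R N -> R) :
  (forall d (T : measurableType d) (X : T -> cfg R N), cfg_measurable X ->
     measurable_fun setT (fun w => x (X w))) ->
  (forall c M, times_le M c -> Q (cstate c) -> `|x c| <= M) ->
  (forall e c c', cfg_close e c c' -> `|x c - x c'| <= e) ->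
  good (fun u c => if Q (cstate c) then u - x c else 0).
Proof.
move=> mx bx cx; exists 1 => //; split=> [d T X u mX|u c M M0 cM|u v c|u c c' e cc];
  rewrite ?mul1r.
- apply: (measurable_fun_cstate mX (g := fun s w => if Q s then u - x (X w) else 0)) => s.
  by case: (Q s) => //; apply: measurable_funB => //; exact: mx.
- case: ifP => [Qc|_]; last by rewrite normr0; have := normr_ge0 u; lra.
  by apply: le_trans (ler_normB _ _) _; have := bx c M cM Qc; lra.
- case: ifP => _; last by rewrite subrr normr0.
  by rewrite opprB addrACA (addrC (- x c)) -addrACA subrr addr0.
- have [cE _ _ _] := cc; rewrite cE; case: ifP => _.
    by rewrite (_ : _ - _ = - (x c - x c')) ?normrN; [exact: cx|ring].
  by rewrite subrr normr0; apply: le_trans (cx _ _ _ cc).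
Qed.

Lemma good_delivered i : good (fun u c => u - clast c i).
Proof.
exact: (@good_if xpredT (fun c => clast c i)
  (fun d T X mX => let: And4 _ _ _ l := mX in l i)
  (fun c M cM _ => let: And3 l _ _ := cM in l i)
  (fun e c c' cc => let: And4 _ _ _ l := cc in l i)).
Qed.

Lemma good_served : good (fun u c => if cstate c != None then u - cgen c else 0).
Proof.
exact: (@good_if (fun a => a != None) (fun c => cgen c)
  (fun d T X mX => let: And4 _ g _ _ := mX in g)
  (fun c M cM => let: And3 _ g _ := cM in g)
  (fun e c c' cc => let: And4 _ g _ _ := cc in g)).
Qed.

Lemma good_waiting i : good (fun u c => if Bst (cstate c) i then u - cwait c i else 0).
Proof.
exact: (@good_if (fun a => Bst a i) (fun c => cwait c i)
  (fun d T X mX => let: And4 _ _ l _ := mX in l i)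
  (fun c M cM => let: And3 _ _ l := cM in l i)
  (fun e c c' cc => let: And4 _ _ l _ := cc in l i)).
Qed.

Lemma good_delivered_age i s : good (delivered_age i s).
Proof.
apply: (@good_if (fun a => a == s) (fun c => clast c i)) => [d T X []//|c M []//|e c c' []//].
Qed.

Lemma good_served_age s : good (served_age s).
Proof.
apply: (@good_if (fun a => (a == s) && (s != None)) (fun c => cgen c)) =>
  [d T X []//|c M [_ gM _] /andP[/eqP <-]|e c c' []//]; exact: gM.
Qed.

Lemma good_waiting_age i s : good (waiting_age i s).
Proof.
apply: (@good_if (fun a => (a == s) && Bst s i) (fun c => cwait c i)) =>
  [d T X []//|c M [_ _ wM] /andP[/eqP <-]|e c c' []//]; exact: wM.
Qed.

Lemma good_cstate (g : st N -> R) : good (fun _ c => g (cstate c)).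
Proof.
exists (\sum_s `|g s|); first exact: sumr_ge0.
have gs s : `|g s| <= \sum_s `|g s| by rewrite (bigD1 s)//= lerDl sumr_ge0.
split=> [d T X u mX|u c M M0 cM|u v c|u c c' e cc].
- by apply: (measurable_fun_cstate mX (g := fun s _ => g s)).
- rewrite (le_trans (gs (cstate c)))// ler_peMr ?sumr_ge0//.
  by have := normr_ge0 u; lra.
- by rewrite subrr normr0 mulr_ge0 ?sumr_ge0.
- have [-> + _ _] := cc; rewrite subrr normr0 => /(le_trans (normr_ge0 _)) e0.
  by rewrite mulr_ge0 ?sumr_ge0.
Qed.

Lemma good_add f g : good f -> good g -> good (fun u c => f u c + g u c).
Proof.
move=> [K K0 [mf bf lf cf]] [K' K'0 [mg bg lg cg]]; exists (K + K'); first exact: addr_ge0.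
split=> [d T X u mX|u c M M0 cM|u v c|u c c' e cc]; rewrite ?mulrDl.
- by apply: measurable_funD; [exact: mf|exact: mg].
- by apply: le_trans (ler_normD _ _) _; rewrite lerD ?bf ?bg.
- by rewrite opprD addrACA; apply: le_trans (ler_normD _ _) _; rewrite lerD.
- by rewrite opprD addrACA; apply: le_trans (ler_normD _ _) _; rewrite lerD ?cf ?cg.
Qed.

Lemma good_mulr k f : good f -> good (fun u c => k * f u c).
Proof.
move=> [K K0 [mf bf lf cf]]; exists (`|k| * K); first exact: mulr_ge0.
split=> [d T X u mX|u c M M0 cM|u v c|u c c' e cc]; rewrite -?mulrBr ?normrM -?mulrA.
- by apply: measurable_funM => //; exact: mf.
- by rewrite ler_wpM2l// bf.
- by rewrite ler_wpM2l.
- by rewrite ler_wpM2l// cf.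
Qed.

Lemma good_norm f : good f -> good (fun u c => `|f u c|).
Proof.
move=> [K K0 [mf bf lf cf]]; exists K => //.
split=> [d T X u mX|u c M M0 cM|u v c|u c c' e cc].
- by apply: measurableT_comp => //; exact: mf.
- by rewrite normr_id bf.
- by apply: le_trans (ler_dist_dist _ _) _; exact: lf.
- by apply: le_trans (ler_dist_dist _ _) _; exact: cf.
Qed.

Lemma good_restrict (Q : pred (st N)) f : good f ->
  good (fun u c => if Q (cstate c) then f u c else 0).
Proof.
move=> [K K0 [mf bf lf cf]]; exists K => //.
split=> [d T X u mX|u c M M0 cM|u v c|u c c' e cc].
- apply: (measurable_fun_cstate mX (g := fun s w => if Q s then f u (X w) else 0)) => s.
  by case: (Q s) => //; exact: mf.
- case: ifP => _; first exact: bf.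
  by rewrite normr0 mulr_ge0// !addr_ge0.
- case: ifP => _; first exact: lf.
  by rewrite subrr normr0 mulr_ge0.
- have [-> e0 _ _] := cc; case: ifP => _; first exact: cf.
  by rewrite subrr normr0 mulr_ge0// (le_trans _ e0).
Qed.

(** An explicit [M] for [times_le]. At time 0 it is the sum of the absolute values of the initial
    ages, hence integrable. *)
Definition cfg_norm c : R := \sum_k `|clast c k| +
  ((if cstate c != None then `|cgen c| else 0) +
   \sum_k (if Bst (cstate c) k then `|cwait c k| else 0)).

Lemma cfg_norm_ge0 c : 0 <= cfg_norm c.
Proof.
by rewrite !addr_ge0 ?sumr_ge0// => [|k _]; case: ifP.
Qed.

Lemma times_le_cfg_norm c : times_le (cfg_norm c) c.
Proof.
have H0 : 0 <= (if cstate c != None then `|cgen c| else 0) by case: ifP.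
have H1 : 0 <= \sum_k (if Bst (cstate c) k then `|cwait c k| else 0).
  by apply: sumr_ge0 => k _; case: ifP.
have H2 : 0 <= \sum_k `|clast c k| by exact: sumr_ge0.
split=> [k|c0|k Bk]; rewrite /cfg_norm.
- have : `|clast c k| <= \sum_k `|clast c k| by rewrite (bigD1 k)//= lerDl sumr_ge0.
  by lra.
- by rewrite c0 in H0 *; lra.
- have : `|cwait c k| <= \sum_k (if Bst (cstate c) k then `|cwait c k| else 0).
    by rewrite (bigD1 k)//= Bk lerDl sumr_ge0// => j _; case: ifP.
  by lra.
Qed.

(** It keeps the mean of [cfg_norm] bounded over bounded times, as the remainder of [one_step]
    requires. *)
Lemma good_cfg_norm : good (fun _ => cfg_norm).
Proof.
have gsum (I : finType) (F : I -> R -> cfg R N -> R) : (forall i, good (F i)) ->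
    good (fun u c => \sum_i F i u c).
  move=> gF; suff : forall r : seq I, good (fun u c => \sum_(i <- r) F i u c) by apply.
  elim=> [|i r IH].
    rewrite (_ : (fun u c => _) = fun u c => 0); first exact: (good_cstate (fun=> 0)).
    by apply/funext => u; apply/funext => c; rewrite big_nil.
  rewrite (_ : (fun u c => _) = fun u c => F i u c + \sum_(j <- r) F j u c).
    exact: good_add.
  by apply/funext => u; apply/funext => c; rewrite big_cons.
(* Analogue of [good_if] for the size of a recorded time instead of an age. *)
have gabs (Q : pred (st N)) (x : cfg R N -> R) :
    (forall d (T : measurableType d) (X : T -> cfg R N), cfg_measurable X ->
     measurable_fun setT (fun w => x (X w))) ->
    (forall c M, times_le M c -> Q (cstate c) -> `|x c| <= M) ->
    (forall e c c', cfg_close e c c' -> `|x c - x c'| <= e) ->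
    good (fun _ c => if Q (cstate c) then `|x c| else 0).
  move=> mx bx cx; exists 1 => //; split=> [d T X u mX|u c M M0 cM|u v c|u c c' e cc];
    rewrite ?mul1r.
  - apply: (measurable_fun_cstate mX (g := fun s w => if Q s then `|x (X w)| else 0)) => s.
    by case: (Q s) => //; apply: measurableT_comp => //; exact: mx.
  - case: ifP => [Qc|_]; last by rewrite normr0; have := normr_ge0 u; lra.
    by rewrite normr_id; have := bx c M cM Qc; have := normr_ge0 u; lra.
  - by rewrite subrr normr0.
  - have [cE _ _ _] := cc; rewrite cE; case: ifP => _.
      by apply: le_trans (ler_dist_dist _ _) _; exact: cx.
    by rewrite subrr normr0; apply: le_trans (cx _ _ _ cc).
apply: good_add; last apply: good_add.
- apply: gsum => k; apply: (gabs xpredT (fun c => clast c k)) => [d T X []//|c M []//|e c c' []//].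
- apply: (gabs (fun a => a != None) (fun c => cgen c)) => [d T X []//|c M []//|e c c' []//].
- apply: gsum => k; apply: (gabs (fun a => Bst a k) (fun c => cwait c k)) =>
    [d T X []//|c M [_ _ wM]|e c c' []//]; exact: wM.
Qed.

End MeasurableConfigurations.

(** * Independence of the past and the future increments *)

Section Independence.
Variables (R : realType) (N : nat) (d : measure_display) (Omega : measurableType d).
Variables (lam mu : 'I_N -> R -> R) (A S : 'I_N -> Omega -> R -> nat)
  (q : Omega -> R -> st N) (G : Omega -> R -> R) (W L : 'I_N -> Omega -> R -> R).
Variable P : probability Omega R.
Implicit Types (w : Omega) (p : pidx N) (a b h t : R) (l : seq (pidx N * R * R * nat)).

Local Notation cnt := (cnt A S).
Local Notation config := (config q G W L).
Local Notation init_ev := (init_ev q G W L).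
Local Notation incr_ev := (incr_ev A S).

Hypothesis rate_ge0 : forall p t, 0 <= t -> 0 <= rate lam mu p t.
Hypothesis mcnt : forall p t n, measurable [set w | cnt p w t = n].
Hypothesis mconfig : forall t, cfg_measurable (fun w => config w t).
Hypothesis law : poisson_law lam mu A S q G W L P.
Hypothesis dyn : forall w, dynamics A S q G W L w.

Definition mean_incr p a b : R := intensity (rate lam mu p) a b.

Lemma mean_incr_ge0 p a b : 0 <= a -> 0 <= mean_incr p a b.
Proof.
move=> a0; apply: fine_ge0; apply: integral_ge0 => u /=.
by rewrite in_itv/= => /andP[au _]; rewrite lee_fin rate_ge0// (le_trans a0).
Qed.

(** [r] lists the processes under observation: all of them in [no_event] and [one_event], a single
    one in [quiet]. *)
Definition window (r : seq (pidx N)) a b (m : pidx N -> nat) : set Omega :=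
  [set w | forall p, p \in r -> (cnt p w b - cnt p w a)%N = m p].

Definition window_list r a b (m : pidx N -> nat) : seq (pidx N * R * R * nat) :=
  [seq (p, a, b, m p) | p <- r].

Definition window_prob r a b (m : pidx N -> nat) : R :=
  \prod_(p <- r) poissonp (mean_incr p a b) (m p).

Lemma window_prob_ge0 r a b m : 0 <= a -> 0 <= window_prob r a b m.
Proof.
move=> a0; apply: prodr_ge0 => p _.
by rewrite divr_ge0 ?mulr_ge0 ?expR_ge0 ?exprn_ge0 ?mean_incr_ge0.
Qed.

Lemma windowE r a b m : window r a b m = incr_ev (window_list r a b m).
Proof.
apply/seteqP; split=> w /=.
  by move=> H; apply/allP => _ /mapP[p pr ->] /=; apply/eqP; exact: H.
by move=> /allP H p pr; apply/eqP; apply: (H (p, a, b, m p)); exact: map_f.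
Qed.

Lemma measurable_incr p a b n : measurable [set w | (cnt p w b - cnt p w a)%N = n].
Proof.
rewrite (_ : [set w | _] = \bigcup_(x in [set x : nat * nat | (x.1 - x.2)%N = n])
    ([set w | cnt p w b = x.1] `&` [set w | cnt p w a = x.2])).
  rewrite bigcup_mkcond; apply: countable_bigcupT_measurable => // x.
  by case: ifP => // _; apply: measurableI.
apply/seteqP; split=> [w wn|w [x xn [/= -> ->]]]; last exact: xn.
by exists (cnt p w b, cnt p w a).
Qed.

Lemma measurable_incr_ev l : measurable (incr_ev l).
Proof.
elim: l => [|e l IH].
  by rewrite (_ : incr_ev _ = setT)//; apply/seteqP.
rewrite (_ : incr_ev _ = [set w | (cnt e.1.1.1 w e.1.2 - cnt e.1.1.1 w e.1.1.2)%N = e.2] `&` incr_ev l).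
  by apply: measurableI => //; exact: measurable_incr.
apply/seteqP; split=> w.
  by move=> /= /andP[/eqP].
by move=> [/eqP we wl]; apply/andP.
Qed.

Lemma measurable_window r a b m : measurable (window r a b m).
Proof. by rewrite windowE; exact: measurable_incr_ev. Qed.

Lemma measurable_init_ev s0 cG cW cL : measurable (init_ev s0 cG cW cL).
Proof.
have [mq mG mW mL] := mconfig 0.
have mle (g : Omega -> R) c : measurable_fun setT g -> measurable [set w | g w <= c].
  move=> mg; rewrite -[X in measurable X]setTI.
  rewrite (_ : [set w | _] = g @^-1` `]-oo, c]); first exact: mg.
  by apply/seteqP; split=> w /=; rewrite in_itv.
rewrite (_ : init_ev _ _ _ _ = [set w | cstate (config w 0) = s0] `&`
  ([set w | G w 0 <= cG] `&` (\bigcap_k [set w | W k w 0 <= cW k] `&`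
   \bigcap_k [set w | L k w 0 <= cL k]))).
  apply: measurableI => //; apply: measurableI; first exact: mle.
  apply: measurableI; apply: fin_bigcap_measurable => [|k _];
    try exact: finite_finset; apply: mle.
  - by apply: eq_measurable_fun (mW k) => w _; rewrite /cwait/= ffunE.
  - by apply: eq_measurable_fun (mL k) => w _; rewrite /clast/= ffunE.
apply/seteqP; split=> w /=.
  by move=> [? [? [HW HL]]]; split=> //; split=> //; split=> k _ /=.
by move=> [? [? [HW HL]]]; split=> //; split=> //; split=> k; [exact: HW|exact: HL].
Qed.

(** Boolean form of the disjointness in [admissible], which makes concatenated lists accessible to
    [pairwise_cat]. *)
Definition compatible (e1 e2 : pidx N * R * R * nat) : bool :=
  (e1.1.1.1 == e2.1.1.1) ==> ((e1.1.2 <= e2.1.1.2) || (e2.1.2 <= e1.1.1.2)).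

Lemma compatible_admissible l : all (fun e => 0 <= e.1.1.2 <= e.1.2) l ->
  pairwise compatible l -> admissible l.
Proof.
move=> /allP l0 pw; split=> [e /l0//|j1 j2 j1l j2l j12 e1 e2 E1 E2 e12].
have H i j : (i < j)%N -> (j < size l)%N -> compatible (nth e1 l i) (nth e1 l j).
  by move=> ij jl; move/(pairwiseP e1): pw; apply => //; exact: ltn_trans jl.
rewrite (set_nth_default e1) // in E2.
have [lt|gt|//] := ltngtP j1 j2.
  by have := H _ _ lt j2l; rewrite -E1 -E2 /compatible e12 eqxx => /orP.
by have := H _ _ gt j1l; rewrite -E1 -E2 /compatible e12 eqxx /= orbC => /orP.
Qed.

Lemma uniq_pairwise (T : eqType) (e : rel T) (s : seq T) : uniq s ->
  {in s &, forall x y, x != y -> e x y} -> pairwise e s.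
Proof.
elim: s => //= x s IH /andP[xs us] H; apply/andP; split; last first.
  by apply: IH => // y z ys zs; apply: H; rewrite inE ?ys ?zs orbT.
apply/allP => y ys; apply: H; rewrite ?inE ?eqxx ?ys ?orbT//.
by apply: contraNneq xs => ->.
Qed.

Section Grid.
Variables (h : R) (n : nat).
Hypothesis h0 : 0 <= h.

Definition grid_list (v : {ffun 'I_n * pidx N -> nat}) : seq (pidx N * R * R * nat) :=
  [seq (x.2, h * x.1%:R, h * x.1.+1%:R, v x) | x : 'I_n * pidx N <- enum {: 'I_n * pidx N}].

(** A member prescribes the initial state and all increments over the grid. Two members either share
    these, and meet in the minima of their thresholds, or are disjoint; with [set0] this is a
    pi-system. *)
Definition grid_system : set (set Omega) := [set B | B = set0 \/
  exists s0 cG cW cL v, B = init_ev s0 cG cW cL `&` incr_ev (grid_list v)].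

Lemma incr_grid_list v w : incr_ev (grid_list v) w <->
  forall (j : 'I_n) p, (cnt p w (h * j.+1%:R) - cnt p w (h * j%:R))%N = v (j, p).
Proof.
split=> [/allP H j p|H].
  apply/eqP; apply: (H (p, h * j%:R, h * j.+1%:R, v (j, p))).
  by apply/mapP; exists (j, p) => //; rewrite mem_enum.
by apply/allP => _ /mapP[[j p] _ ->] /=; apply/eqP; exact: H.
Qed.

Lemma grid_system_setI : setI_closed grid_system.
Proof.
move=> B C [->|[s0 [cG [cW [cL [v ->]]]]]]; first by left; rewrite set0I.
move=> [->|[s0' [cG' [cW' [cL' [v' ->]]]]]]; first by left; rewrite setI0.
have [ss|ss] := eqVneq s0 s0'; last first.
  left; apply/seteqP; split=> // w [[[s _] _] [[s' _] _]].
  by move/eqP: ss; apply; rewrite -s -s'.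
have [vv|vv] := eqVneq v v'; last first.
  left; apply/seteqP; split=> // w [[_ /incr_grid_list Hv] [_ /incr_grid_list Hv']].
  by move/eqP: vv; apply; apply/ffunP => -[j p]; rewrite -Hv -Hv'.
subst s0' v'; right; exists s0, (Num.min cG cG'), (fun k => Num.min (cW k) (cW' k)),
  (fun k => Num.min (cL k) (cL' k)), v.
apply/seteqP; split=> w.
  move=> [[[s [g [wk lk]]] wv] [[_ [g' [wk' lk']]] _]]; split=> //; split=> //.
  by split; [|split=> k]; rewrite le_min ?g ?g' ?wk ?wk' ?lk ?lk'.
move=> [[s [g [wk lk]]] wv]; move: g; rewrite le_min => /andP[g g'].
have {}wk k := andP (etrans (esym (le_min _ _ _)) (wk k)).
have {}lk k := andP (etrans (esym (le_min _ _ _)) (lk k)).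
by split; split=> //; split=> //; split=> //; split=> k; case: (wk k); case: (lk k).
Qed.

Lemma grid_system_measurable : grid_system `<=` measurable.
Proof.
move=> B [->//|[s0 [cG [cW [cL [v ->]]]]]].
by apply: measurableI; [exact: measurable_init_ev|exact: measurable_incr_ev].
Qed.

(** The window opens after the last grid point, so the concatenated list of increments is still
    admissible. Applying the law to it and to the grid list alone leaves the factor of the
    window. *)
Lemma grid_system_law B r a b m : uniq r -> h * n%:R <= a -> a <= b -> grid_system B ->
  P (B `&` window r a b m) = (P B * (window_prob r a b m)%:E)%E.
Proof.
move=> ur ha ab [->|[s0 [cG [cW [cL [v ->]]]]]]; first by rewrite set0I measure0 mul0e.
have adm1 : all (fun e : pidx N * R * R * nat => 0 <= e.1.1.2 <= e.1.2) (grid_list v).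
  apply/allP => _ /mapP[[j p] _ ->] /=.
  by rewrite mulr_ge0//= ler_wpM2l// ler_nat.
have adm2 : pairwise compatible (grid_list v).
  rewrite pairwise_map; apply: uniq_pairwise; first exact: enum_uniq.
  move=> [i p] [j p'] _ _; rewrite /compatible/= => ijp; apply/implyP => /eqP pp.
  have {}ijp : i != j by apply: contraNneq ijp => ->; rewrite pp.
  move: ijp; rewrite neq_ltn => /orP[ij|ij]; apply/orP; [left|right];
    by rewrite ler_wpM2l// ler_nat.
have a0 : 0 <= a by apply: le_trans ha; rewrite mulr_ge0.
have adm3 : all (fun e : pidx N * R * R * nat => 0 <= e.1.1.2 <= e.1.2)
    (window_list r a b m) by apply/allP => _ /mapP[p _ ->] /=; rewrite a0.
have adm4 : pairwise compatible (grid_list v ++ window_list r a b m).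
  rewrite pairwise_cat adm2 /= pairwise_map; apply/andP; split.
    apply/allrelP => _ _ /mapP[[j p] _ ->] /mapP[p' _ ->].
    apply/implyP => _ /=; apply/orP; left; apply: le_trans ha.
    by rewrite ler_wpM2l// ler_nat.
  apply: uniq_pairwise => // p p' _ _ pp; rewrite /compatible/=.
  by rewrite (negbTE pp).
rewrite windowE -setIA.
rewrite (_ : _ `&` incr_ev _ = incr_ev (grid_list v ++ window_list r a b m)); last first.
  apply/seteqP; split=> w; rewrite /Defs.incr_ev /=.
    by move=> wE; rewrite all_cat; apply/andP.
  by rewrite all_cat => /andP.
rewrite (law _ _ _ _ (compatible_admissible _ adm4)); last by rewrite all_cat adm1.
rewrite (law _ _ _ _ (compatible_admissible adm1 adm2)).
rewrite big_cat/= EFinM muleA; congr (_ * _%:E)%E.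
by rewrite big_map.
Qed.

Local Notation cells := (nat * st N * {ffun 'I_n * pidx N -> nat})%type.

(** A countable cover of [Omega] by members of the system, as uniqueness of measures requires; the
    integer [m] is an upper bound for the initial times. *)
Definition grid_cover (k : nat) : set Omega :=
  if unpickle k is Some (m, s0, v) then
    init_ev s0 m%:R (fun=> m%:R) (fun=> m%:R) `&` incr_ev (grid_list v)
  else set0.

Lemma init_bound w : exists m : nat,
  G w 0 <= m%:R /\ (forall k, W k w 0 <= m%:R) /\ (forall k, L k w 0 <= m%:R).
Proof.
pose x := `|G w 0| + (\sum_k `|W k w 0| + \sum_k `|L k w 0|).
have sW k : W k w 0 <= \sum_k `|W k w 0|.
  by rewrite (le_trans (ler_norm _))// (bigD1 k)//= lerDl sumr_ge0.
have sL k : L k w 0 <= \sum_k `|L k w 0|.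
  by rewrite (le_trans (ler_norm _))// (bigD1 k)//= lerDl sumr_ge0.
have gG := ler_norm (G w 0); have g0 := normr_ge0 (G w 0).
have W0 : 0 <= \sum_k `|W k w 0| by exact: sumr_ge0.
have L0 : 0 <= \sum_k `|L k w 0| by exact: sumr_ge0.
exists (Num.truncn x).+1; have xm : x <= (Num.truncn x).+1%:R by rewrite ltW// truncnS_gt.
rewrite /x in xm *; split; first lra.
by split=> k; [have := sW k|have := sL k]; lra.
Qed.

Definition grid_incr w : {ffun 'I_n * pidx N -> nat} :=
  [ffun x : 'I_n * pidx N => (cnt x.2 w (h * x.1.+1%:R) - cnt x.2 w (h * x.1%:R))%N].

Lemma grid_incrP w : incr_ev (grid_list (grid_incr w)) w.
Proof. by apply/incr_grid_list => j p; rewrite ffunE. Qed.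

Lemma grid_coverT : \bigcup_k grid_cover k = setT.
Proof.
rewrite -subTset => w _; have [m [Gm [Wm Lm]]] := init_bound w.
exists (pickle ((m, q w 0, grid_incr w) : cells)) => //.
rewrite /grid_cover pickleK; split; [by []|exact: grid_incrP].
Qed.

(** Restricting [P] to the window and multiplying [P] by the probability of the window give two
    finite measures that agree on the pi-system, hence on the sigma-algebra it generates. *)
Theorem grid_indep B r a b m : uniq r -> h * n%:R <= a -> a <= b ->
  <<s grid_system>> B ->
  P (B `&` window r a b m) = (P B * (window_prob r a b m)%:E)%E.
Proof.
move=> ur ha ab; have a0 : 0 <= a by apply: le_trans ha; rewrite mulr_ge0.
pose c := NngNum (window_prob_ge0 r b m a0).
move=> sB.
suff : mrestr P (measurable_window r a b m) B = mscale c P B.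
  by rewrite /mrestr/mscale/= muleC.
apply: (@g_sigma_algebra_measure_unique _ _ _ grid_system grid_system_measurable
  grid_cover _ grid_coverT (mrestr P (measurable_window r a b m)) (mscale c P)
  grid_system_setI _ _ B sB).
- move=> k; rewrite /grid_cover; case: unpickle => [[[m0 s0] v]|]; last by left.
  by right; do 5 eexists.
- move=> C GC; rewrite [LHS](grid_system_law m ur ha ab GC) muleC.
  by [].
- move=> k; rewrite /mrestr/=; apply: le_lt_trans (ltry 1).
  apply: probability_le1; apply: measurableI; last exact: measurable_window.
  apply: grid_system_measurable.
  rewrite /grid_cover; case: unpickle => [[[m0 s0] v]|]; last by left.
  by right; do 5 eexists.
Qed.

End Grid.
End Independence.

(** * Integrals over an independent event *)

Section IntegralIndependence.
Local Open Scope ereal_scope.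
Variables (R : realType) (d : measure_display) (T : measurableType d).

Lemma measurable_fun_le (X : T -> R) :
  (forall c, measurable [set w | (X w <= c)%R]) -> measurable_fun setT X.
Proof.
move=> mX; apply: (measurability _ (RGenOInfty.measurableE R)).
move=> _ [_ [c ->] <-]; rewrite setTI (_ : _ @^-1` _ = ~` [set w | (X w <= c)%R]).
  exact: measurableC.
by apply/seteqP; split=> w /=; rewrite in_itv/= andbT ltNge => /negP.
Qed.

(** The restriction of [P] to [F] and the multiple of [P] by [c] have the same image under [X], and
    both sides are integrals of [phi] for that image. *)
Lemma ge0_integral_indep (P : probability T R) (F : set T) (c : R) (X : T -> R)
    (phi : R -> \bar R) : measurable F -> (0 <= c)%R ->
  measurable_fun setT X -> measurable_fun setT phi -> (forall x, 0 <= phi x) ->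
  (forall Y, measurable Y -> P (X @^-1` Y `&` F) = P (X @^-1` Y) * c%:E) ->
  \int[P]_(w in F) phi (X w) = c%:E * \int[P]_w phi (X w).
Proof.
move=> mF c0 mX mphi phi0 XF; pose k := NngNum c0.
have mphiX : measurable_fun setT (phi \o X) by exact: measurableT_comp.
rewrite (@eq_measure_integral _ _ _ _ (mrestr P mF)); last first.
  by move=> A mA AF; rewrite -{1}(setIidl AF).
have -> : \int[mrestr P mF]_(w in F) phi (X w) = \int[mrestr P mF]_w (phi \o X) w.
  have F0 : mrestr P mF (~` F) = 0 by rewrite -(measure0 P) -(setICl F).
  rewrite [RHS](ge0_negligible_integral (measurableC mF) measurableT mphiX _ F0).
    by rewrite setTD setCK.
  by move=> x _; exact: phi0.
have pf (m : {measure set T -> \bar R}) :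
    \int[m]_w phi (X w) = \int[pushforward m X]_y phi y.
  by rewrite (ge0_integral_pushforward mX)// => y _.
transitivity (\int[pushforward (mrestr P mF) X]_y phi y); first exact: pf.
transitivity (c%:E * \int[pushforward P X]_y phi y); last first.
  by congr (_ * _); exact/esym/pf.
rewrite -[c]/(k%:num)%R -ge0_integral_mscale//.
apply: eq_measure_integral => Y mY _.
by apply: etrans (XF Y mY) _; rewrite muleC.
Qed.

Lemma integral_indep (P : probability T R) (F : set T) (c : R) (X : T -> R) :
  measurable F -> (0 <= c)%R -> P.-integrable setT (EFin \o X) ->
  (forall Y, measurable Y -> P (X @^-1` Y `&` F) = P (X @^-1` Y) * c%:E) ->
  \int[P]_(w in F) (X w)%:E = c%:E * \int[P]_w (X w)%:E.
Proof.
move=> mF c0 iX XF.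
have mX : measurable_fun setT X by apply/measurable_EFinP; exact: measurable_int iX.
have mE : measurable_fun setT (@EFin R) by apply/measurable_EFinP; exact: measurable_id.
rewrite [LHS]integralE [X in _ * X]integralE.
rewrite (_ : (fun w => (X w)%:E) = EFin \o X)// (funepos_comp EFin X) (funeneg_comp EFin X).
rewrite (ge0_integral_indep mF c0 mX (measurable_funepos mE))//.
rewrite (ge0_integral_indep mF c0 mX (measurable_funeneg mE))//.
rewrite -muleBr//.
by have := integrable_add_def measurableT iX; rewrite (funepos_comp EFin X) (funeneg_comp EFin X).
Qed.

End IntegralIndependence.

(** * Independence for the true configuration *)

Section ConfigIndependence.
Variables (R : realType) (N : nat) (d : measure_display) (Omega : measurableType d).
Variables (lam mu : 'I_N -> R -> R) (A S : 'I_N -> Omega -> R -> nat)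
  (q : Omega -> R -> st N) (G : Omega -> R -> R) (W L : 'I_N -> Omega -> R -> R).
Variable P : probability Omega R.
Implicit Types (w : Omega) (p : pidx N) (a b h t : R) (l : seq (pidx N * R * R * nat)).

Local Notation cnt := (cnt A S).
Local Notation config := (config q G W L).
Local Notation init_ev := (init_ev q G W L).
Local Notation incr_ev := (incr_ev A S).

Hypothesis rate_ge0 : forall p t, 0 <= t -> 0 <= rate lam mu p t.
Hypothesis mcnt : forall p t n, measurable [set w | cnt p w t = n].
Hypothesis mconfig : forall t, cfg_measurable (fun w => config w t).
Hypothesis law : poisson_law lam mu A S q G W L P.
Hypothesis dyn : forall w, dynamics A S q G W L w.

Section Grid.
Variables (h : R) (n : nat).
Hypothesis h0 : 0 <= h.

Local Notation grid_system := (grid_system A S q G W L h n).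
Local Notation sOmega := (g_sigma_algebraType grid_system).
Local Notation cells := (nat * st N * {ffun 'I_n * pidx N -> nat})%type.

(** An integer, a state and the increments form a countable index set. A threshold growing with the
    integer imposes nothing on the union, so that an event may constrain only the coordinates it is
    about. *)
Lemma grid_measurable_bigcup (Q : pred cells) (cG : nat -> R) (cW cL : nat -> 'I_N -> R) :
  measurable (\bigcup_(x in [set x | Q x]) (init_ev x.1.2 (cG x.1.1) (cW x.1.1) (cL x.1.1)
    `&` incr_ev (grid_list h x.2)) : set sOmega).
Proof.
rewrite bigcup_mkcond; apply: countable_bigcupT_measurable => [|x].
  exact: (@countableP cells).
case: ifP => // _; apply: sub_sigma_algebra; right.
by exists x.1.2, (cG x.1.1), (cW x.1.1), (cL x.1.1), x.2.
Qed.

Lemma grid_measurable_config0 : cfg_measurable (fun w : sOmega => config w 0).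
Proof.
(* For sublevel sets of one initial time: its threshold stays at [c], while the others grow with
   [m]. *)
have mnn (cG : nat -> R) (cW cL : nat -> 'I_N -> R) (E : set Omega) :
    (forall w, E w <-> exists m, [/\ G w 0 <= cG m, forall k, W k w 0 <= cW m k
       & forall k, L k w 0 <= cL m k]) -> measurable (E : set sOmega).
  move=> HE; have := @grid_measurable_bigcup xpredT cG cW cL.
  rewrite [X in measurable X -> _](_ : _ = E)//.
  apply/seteqP; split=> [w [x _ [[_ [g [wk lk]]] _]]|w /HE[m [g wk lk]]].
    by apply/HE; exists x.1.1.
  exists (m, q w 0, grid_incr A S h n w) => //.
  by split => //; exact: grid_incrP.
split=> [s||k|k].
- have := @grid_measurable_bigcup (fun x => x.1.2 == s) (fun m => m%:R)
    (fun m _ => m%:R) (fun m _ => m%:R).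
  rewrite [X in measurable X -> _](_ : _ = [set w | cstate (config w 0) = s])//.
  apply/seteqP; split=> [w [x xs [[qx _] _]]|w ws].
    by rewrite /cstate/= qx; exact/eqP.
  have [m [g [wk lk]]] := init_bound G W L w.
  exists (m, q w 0, grid_incr A S h n w); first by apply/eqP.
  by split => //; exact: grid_incrP.
- apply: measurable_fun_le => c.
  apply: (mnn (fun=> c) (fun m _ => m%:R) (fun m _ => m%:R)) => w; split=> [gc|[m []//]].
  by have [m [g [wk lk]]] := init_bound G W L w; exists m.
- apply: measurable_fun_le => c.
  apply: (mnn (fun m => m%:R) (fun m i => if i == k then c else m%:R) (fun m _ => m%:R)) => w.
  rewrite /cwait/= ffunE; split=> [gc|[m [_ /(_ k) + _]]]; last by rewrite eqxx.
  have [m [g [wk lk]]] := init_bound G W L w; exists m; split=> // i.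
  by case: eqP => [->|].
- apply: measurable_fun_le => c.
  apply: (mnn (fun m => m%:R) (fun m _ => m%:R) (fun m i => if i == k then c else m%:R)) => w.
  rewrite /clast/= ffunE; split=> [gc|[m [_ _ /(_ k)]]]; last by rewrite eqxx.
  have [m [g [wk lk]]] := init_bound G W L w; exists m; split=> // i.
  by case: eqP => [->|].
Qed.

(** The recursion only asks which increments over a cell are positive, and the members of
    [grid_system] prescribe them all. *)
Lemma grid_measurable_config j : (j <= n)%N ->
  cfg_measurable (fun w : sOmega => grid_config A S q G W L h j w).
Proof.
elim: j => [_|j IH jn]; first exact: grid_measurable_config0.
suff mD p : measurable ([set w | (cnt p w (h * j%:R) < cnt p w (h * j.+1%:R))%N] : set sOmega).
  exact: (cfg_measurable_steps (pidx_enum N) (h * j.+1%:R) mD (IH (ltnW jn))).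
 have := @grid_measurable_bigcup (fun x => (0 < x.2 (Ordinal jn, p))%N)
  (fun m => m%:R) (fun m _ => m%:R) (fun m _ => m%:R).
rewrite [X in measurable X -> _](_ : _ = [set w |
  (cnt p w (h * j%:R) < cnt p w (h * j.+1%:R))%N])//.
apply/seteqP; split=> [w [x /= x0 [_ /incr_grid_list/(_ (Ordinal jn) p)/=]]|w /= lt].
  by lia.
have [m [g [wk lk]]] := init_bound G W L w.
exists (m, q w 0, grid_incr A S h n w); first by rewrite /= ffunE/= subn_gt0.
by split => //; exact: grid_incrP.
Qed.

Lemma grid_window_integral f r a b m u : good f -> uniq r -> h * n%:R <= a -> a <= b ->
  P.-integrable setT (fun w => (f u (grid_config A S q G W L h n w))%:E) ->
  (\int[P]_(w in window A S r a b m) (f u (grid_config A S q G W L h n w))%:E =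
   (window_prob lam mu r a b m)%:E * \int[P]_w (f u (grid_config A S q G W L h n w))%:E)%E.
Proof.
move=> [K K0 [mf _ _ _]] ur ha ab fi.
have a0 : 0 <= a by apply: le_trans ha; rewrite mulr_ge0.
apply: (integral_indep (X := fun w => f u (grid_config A S q G W L h n w))) => //.
- exact: (@measurable_window _ _ _ _ A S mcnt).
- exact: window_prob_ge0.
move=> Y mY; apply: (grid_indep rate_ge0 mcnt mconfig law h0 m ur ha ab).
(* [good] grants measurability for any source, here for the sigma-algebra of the grid, to which
   [grid_indep] applies. *)
have := mf _ sOmega _ u (grid_measurable_config (leqnn n)).
move=> /(_ measurableT _ mY); rewrite setTI. exact.
Qed.

End Grid.

Lemma config_times_le w s t : 0 <= s -> s <= t ->
  times_le (cfg_norm (config w s) + t) (config w t).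
Proof.
move=> s0; apply: (config_ind (Inv := fun t => times_le (cfg_norm (config w s) + t))) => //.
- by move=> u v c su uv; apply: times_leW; rewrite lerD2l.
- move=> p u c su; apply: step_times_le.
  by rewrite ger0_norm ?(le_trans s0)// lerDr cfg_norm_ge0.
- by apply: times_leW (times_le_cfg_norm _); rewrite lerDl.
Qed.

Lemma grid_times_le w h j : 0 <= h ->
  times_le (cfg_norm (config w 0) + h * j%:R) (grid_config A S q G W L h j w).
Proof.
move=> h0; elim: j => [|j IH]; first by rewrite mulr0 addr0; exact: times_le_cfg_norm.
rewrite /=; set M := _ + h * _.
have : times_le M (grid_config A S q G W L h j w).
  by apply: times_leW IH; rewrite lerD2l ler_wpM2l// ler_nat.
elim: (cell_events _ _ _ _ _) (grid_config _ _ _ _ _ _ _ _ _) => //= p l IHl c cM.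
apply: IHl; apply: step_times_le => //.
by rewrite ger0_norm ?mulr_ge0// lerDr cfg_norm_ge0.
Qed.

Hypothesis norm0_integrable : P.-integrable setT (fun w => (cfg_norm (config w 0))%:E).

(** A step only writes the current time, so the initial norm plus the elapsed time bounds all
    meaningful times; this envelope then dominates [good] functionals. *)
Lemma integrable_envelope K x : P.-integrable setT
  (fun w => (K * (cfg_norm (config w 0) + x))%:E).
Proof.
rewrite (_ : (fun w => _) =
  (fun w => (K%:E * ((cfg_norm (config w 0))%:E + (cst x%:E) w))%E)); last first.
  by apply/funext => w; rewrite EFinM EFinD.
apply: integrableZl => //; apply: integrableD => //.
exact: finite_measure_integrable_cst.
Qed.

Lemma integrable_config f t u : good f -> 0 <= t ->
  P.-integrable setT (fun w => (f u (config w t))%:E).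
Proof.
move=> [K K0 [mf bf _ _]] t0.
apply: le_integrable (integrable_envelope K (`|u| + t + 1)) => //.
  by apply/measurable_EFinP; apply: mf; exact: mconfig.
move=> w _; rewrite /= lee_fin.
have M0 : 0 <= cfg_norm (config w 0) + t by rewrite addr_ge0 ?cfg_norm_ge0.
rewrite (le_trans (bf _ _ _ M0 (config_times_le w (lexx 0) t0)))// (le_trans _ (ler_norm _))//.
by rewrite ler_wpM2l//; lra.
Qed.

(* Independence passes to the limit along ever finer grids of [[0, t]]. *)
Lemma window_integral f t r b m u : good f -> uniq r -> 0 <= t -> t <= b ->
  (\int[P]_(w in window A S r t b m) (f u (config w t))%:E =
   (window_prob lam mu r t b m)%:E * \int[P]_w (f u (config w t))%:E)%E.
Proof.
move=> gf ur t0 tb; have [K K0 [mf bf lf cf]] := gf.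
pose h n := t / n.+1%:R : R.
have h0 n : 0 <= h n by rewrite divr_ge0.
have hn n : h n * n.+1%:R = t by rewrite divfK.
pose X n w := f u (grid_config A S q G W L (h n) n.+1 w).
(* Inherited from the sigma-algebra of the grid, which is contained in that of [Omega]. *)
have mX n : measurable_fun setT (X n).
  have mg := grid_measurable_config (h0 n) (leqnn n.+1).
  move=> _ Y mY; rewrite setTI.
  have := mf _ _ _ u mg measurableT _ mY; rewrite setTI.
  apply: smallest_sub; first exact: sigma_algebra_measurable.
  exact: grid_system_measurable.
have bX n w : `|X n w| <= K * (cfg_norm (config w 0) + (`|u| + t + 1)).
  have M0 : 0 <= cfg_norm (config w 0) + t by rewrite addr_ge0 ?cfg_norm_ge0.
  have := @grid_times_le w (h n) n.+1 (h0 n); rewrite hn => Mc.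
  by rewrite (le_trans (bf _ _ _ M0 Mc))// ler_wpM2l//; lra.
have iX n : P.-integrable setT (fun w => (X n w)%:E).
  apply: le_integrable (integrable_envelope K (`|u| + t + 1)) => //.
    exact/measurable_EFinP.
  by move=> w _; rewrite /= lee_fin (le_trans (bX n w))// ler_norm.
(* Once the mesh is below the gap of the path, the states agree and the error is at most
   [K * h n]. *)
have cX w : X ^~ w @ \oo --> f u (config w t).
  apply/cvgrPdist_lt => e e0.
  have hK : K * h n @[n --> \oo] --> 0.
    rewrite -[0](mulr0 K); apply: cvgM; [exact: cvg_cst|].
    rewrite -[0](mulr0 t); apply: cvgM; [exact: cvg_cst|exact: (@cvg_harmonic R)].
  have := grid_config_cvg (dyn w) t0.
  move/cvgrPdist_lt: hK => /(_ e e0); apply: filterS2 => n.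
  rewrite sub0r normrN ger0_norm ?mulr_ge0// => hne /cf H.
  by rewrite distrC (le_lt_trans (H u)).
have mW := @measurable_window _ _ _ _ A S mcnt r t b m.
have ienv := integrable_envelope K (`|u| + t + 1).
(* Dominated convergence, used on the window and on the whole space. *)
have lim D : measurable D -> (\int[P]_(w in D) (X n w)%:E)%E @[n --> \oo] -->
    (\int[P]_(w in D) (f u (config w t))%:E)%E.
  move=> mD; apply: (@dominated_cvg _ _ _ _ _ mD _ _
     (fun w => (K * (cfg_norm (config w 0) + (`|u| + t + 1)))%:E)) => //.
  - by move=> n; apply: measurable_funTS; exact/measurable_EFinP.
  - by move=> w _; apply: cvg_EFin; [exact: nearW|exact: cX].
  - exact: integrableS ienv.
  - by move=> n w _; rewrite /= lee_fin.
have lim1 := lim _ mW.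
have lim2 : (\int[P]_(w in window A S r t b m) (X n w)%:E)%E @[n --> \oo] -->
    ((window_prob lam mu r t b m)%:E * \int[P]_w (f u (config w t))%:E)%E.
  rewrite (_ : (fun n => _) = fun n => ((window_prob lam mu r t b m)%:E *
      \int[P]_w (X n w)%:E)%E).
    by apply: cvgeZl => //; exact: lim.
  apply/funext => n; rewrite /X.
  by rewrite (grid_window_integral (h0 n) m gf ur _ tb) ?hn//; exact: iX.
by rewrite -(cvg_lim (@ereal_hausdorff R) lim1) (cvg_lim (@ereal_hausdorff R) lim2).
Qed.

End ConfigIndependence.

(** * Short-time expansion of means *)

Section RealIntegrals.
Variables (R : realType) (d : measure_display) (T : measurableType d).
Variable P : probability T R.
Implicit Types (X Y : T -> R) (F : set T).

Local Notation integrable X := (P.-integrable setT (fun w => (X w)%:E)).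

Lemma integrable_addr X Y : integrable X -> integrable Y ->
  integrable (fun w => X w + Y w).
Proof. by move=> iX iY; exact: (integrableD measurableT iX iY). Qed.

Lemma integrable_mulr k X : integrable X -> integrable (fun w => k * X w).
Proof. by move=> iX; exact: (integrableZl measurableT k iX). Qed.

Lemma integrable_cst k : integrable (fun=> k).
Proof. exact: finite_measure_integrable_cst. Qed.

Lemma Rintegral_cstT k : \int[P]_w k = k.
Proof.
transitivity (k * fine (P setT)); first exact: Rintegral_cst.
by rewrite probability_setT mulr1.
Qed.

Lemma integrable_sumr (I : Type) (r : seq I) (Q : pred I) (X : I -> T -> R) :
  (forall i, integrable (X i)) -> integrable (fun w => \sum_(i <- r | Q i) X i w).
Proof.
move=> iX; elim: r => [|i r IH].
  by under eq_fun do rewrite big_nil; exact: integrable_cst.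
under eq_fun do rewrite big_cons.
by case: (Q i); [exact: integrable_addr|exact: IH].
Qed.

Lemma Rintegral_sumr (I : Type) (r : seq I) (Q : pred I) (X : I -> T -> R) :
  (forall i, integrable (X i)) ->
  \int[P]_w (\sum_(i <- r | Q i) X i w) = \sum_(i <- r | Q i) \int[P]_w X i w.
Proof.
move=> iX; elim: r => [|i r IH].
  by under eq_Rintegral do rewrite big_nil; rewrite Rintegral_cstT big_nil.
under eq_Rintegral do rewrite big_cons.
rewrite big_cons; case: (Q i); last exact: IH.
rewrite RintegralD//; [by rewrite IH|exact: iX|exact: integrable_sumr].
Qed.

Lemma Rintegral_indic F X : measurable F ->
  \int[P]_w (\1_F w * X w) = \int[P]_(w in F) X w.
Proof.
move=> mF; rewrite [RHS]Rintegral_mkcond; apply: eq_Rintegral => w _.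
by rewrite patchE indicE; case: ifP; rewrite ?mul1r ?mul0r.
Qed.

Lemma integrable_indicM F X : measurable F -> integrable X ->
  integrable (fun w => \1_F w * X w).
Proof.
move=> mF iX; apply: (le_integrable measurableT _ _ iX).
  apply/measurable_EFinP; apply: measurable_funM => //.
  by apply/measurable_EFinP; exact: measurable_int iX.
move=> w _; rewrite lee_fin normrM indicE ler_piMl//.
by case: (w \in F); rewrite ?normr1 ?normr0.
Qed.

Lemma le_Rintegral_dist X Y Z : integrable X -> integrable Y -> integrable Z ->
  (forall w, `|X w - Y w| <= Z w) ->
  `|\int[P]_w X w - \int[P]_w Y w| <= \int[P]_w Z w.
Proof.
move=> iX iY iZ XYZ; rewrite -RintegralB//.
have iXY : integrable (fun w => X w - Y w) by exact: (integrableB measurableT iX iY).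
apply: le_trans (le_normr_Rintegral _ iXY) _ => //.
by apply: le_Rintegral => //; exact: integrable_norm iXY.
Qed.

End RealIntegrals.

(** * No event, a single event, several events *)

Section ShortTime.
Variables (R : realType) (N : nat) (d : measure_display) (Omega : measurableType d).
Variables (lam mu : 'I_N -> R -> R) (A S : 'I_N -> Omega -> R -> nat)
  (q : Omega -> R -> st N) (G : Omega -> R -> R) (W L : 'I_N -> Omega -> R -> R).
Variable P : probability Omega R.
Implicit Types (w : Omega) (p : pidx N) (a b h t u v : R) (f : R -> cfg R N -> R).

Local Notation cnt := (cnt A S).
Local Notation config := (config q G W L).

Hypothesis rate_ge0 : forall p t, 0 <= t -> 0 <= rate lam mu p t.
Hypothesis mcnt : forall p t n, measurable [set w | cnt p w t = n].
Hypothesis mconfig : forall t, cfg_measurable (fun w => config w t).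
Hypothesis law : poisson_law lam mu A S q G W L P.
Hypothesis dyn : forall w, dynamics A S q G W L w.

Local Notation m_ := (mean_incr lam mu).
Local Notation integrable X := (P.-integrable setT (fun w => (X w)%:E)).

Definition total_incr a b : R := \sum_p m_ p a b.

Definition no_event a b : set Omega := window A S (enum {: pidx N}) a b (fun=> 0%N).
Definition one_event p a b : set Omega :=
  window A S (enum {: pidx N}) a b (fun p' => nat_of_bool (p' == p)).

Lemma total_incr_ge0 a b : 0 <= a -> 0 <= total_incr a b.
Proof. by move=> a0; apply: sumr_ge0 => p _; exact: mean_incr_ge0. Qed.

Lemma poissonp0 (m : R) : poissonp m 0 = expR (- m).
Proof. by rewrite /poissonp expr0 mulr1 fact0 divr1. Qed.

Lemma poissonp1 (m : R) : poissonp m 1 = m * expR (- m).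
Proof. by rewrite /poissonp expr1 factS fact0 muln1 divr1 mulrC. Qed.

Lemma no_event_prob a b :
  window_prob lam mu (enum {: pidx N}) a b (fun=> 0%N) = expR (- total_incr a b).
Proof.
rewrite /window_prob big_enum/= /total_incr -sumrN expR_sum.
by apply: eq_bigr => p _; rewrite poissonp0.
Qed.

Lemma one_event_prob p a b :
  window_prob lam mu (enum {: pidx N}) a b (fun p' => nat_of_bool (p' == p)) =
  m_ p a b * expR (- total_incr a b).
Proof.
rewrite /window_prob big_enum/= /total_incr -sumrN expR_sum (bigD1 p)//= eqxx poissonp1.
rewrite [in RHS](bigD1 p)//= mulrA; congr (_ * _).
by apply: eq_bigr => p' /negbTE ->; rewrite poissonp0.
Qed.

Lemma measurable_no_event a b : measurable (no_event a b).
Proof. exact: (measurable_window mcnt). Qed.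

Lemma measurable_one_event p a b : measurable (one_event p a b).
Proof. exact: (measurable_window mcnt). Qed.

Lemma no_eventP a b w : no_event a b w <-> forall p, (cnt p w b - cnt p w a)%N = 0%N.
Proof. by split=> H p; [apply: H; rewrite mem_enum|move=> _; exact: H]. Qed.

Lemma one_eventP p a b w : one_event p a b w <->
  forall p', (cnt p' w b - cnt p' w a)%N = (p' == p).
Proof. by split=> H p'; [apply: H; rewrite mem_enum|move=> _; exact: H]. Qed.

Lemma config_no_event a b w : 0 <= a -> a <= b -> no_event a b w ->
  config w b = config w a.
Proof.
move=> a0 ab /no_eventP H; apply: (config_const (dyn w)) => // u /andP[au ub].
apply: events_nil => p ju.
have : (cnt p w a < cnt p w b)%N.
  by apply/(jumpsP (dynamics_cnt p (dyn w))) => //; exists u => //; rewrite au.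
by have := H p; lia.
Qed.

(** The event itself excludes ties: its total increment is one, so only [p] jumps, and only once. *)
Lemma one_event_time p a b w : 0 <= a -> a <= b -> one_event p a b w ->
  exists2 t, a < t <= b &
    forall p' v, a < v <= b -> (jumps (cnt p' w) v <-> p' = p /\ v = t).
Proof.
move=> a0 ab /one_eventP H.
have pb : cnt p w b = (cnt p w a).+1.
  by have := H p; rewrite eqxx /=; lia.
have [t tab Ht] := single_jump (dynamics_cnt p (dyn w)) a0 ab pb.
exists t => // p' v vab; have [->|pp] := eqVneq p' p.
  by split=> [/(Ht v vab)//|[_] /(Ht v vab)].
split=> [jv|[/eqP]]; last by rewrite (negbTE pp).
have : (cnt p' w a < cnt p' w b)%N.
  by apply/(jumpsP (dynamics_cnt p' (dyn w)) a0 ab); exists v.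
by have := H p'; rewrite (negbTE pp) /=; lia.
Qed.

Lemma config_one_event p a b w : 0 <= a -> a <= b -> one_event p a b w ->
  exists2 t, a < t <= b & config w b = step p t (config w a).
Proof.
move=> a0 ab wp; have [t tab Ht] := one_event_time a0 ab wp.
have [at_ tb] := andP tab; exists t => //.
rewrite (config_step (dyn w) a0 at_ tb) => [|v vab vt].
  suff -> : events A S w t = [:: p] by [].
  rewrite eventsE (@eq_filter _ _ (pred1 p)) ?(filter_pred1_uniq (pidx_enum_uniq N))//.
    exact: mem_pidx_enum.
  move=> p' /=; apply/asboolP/eqP => [/(Ht p' t tab)[]//|->].
  exact/(Ht p t tab).
by apply: events_nil => p' /(Ht p' v vab)[_] /vt.
Qed.

Hypothesis norm0_integrable : P.-integrable setT (fun w => (cfg_norm (config w 0))%:E).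

Lemma config_norm_integrable a : 0 <= a -> integrable (fun w => cfg_norm (config w a)).
Proof.
by move=> a0; exact: (integrable_config mconfig dyn norm0_integrable a (@good_cfg_norm R N) a0).
Qed.

(** The explicit time [u] and the time [t] of the configuration are kept apart, so that ageing and
    jumps can be expanded separately. *)
Definition mean f u t : R := \int[P]_w f u (config w t).

Lemma good_integrable f u t : good f -> 0 <= t -> integrable (fun w => f u (config w t)).
Proof.
by move=> gf t0; exact: (integrable_config mconfig dyn norm0_integrable u gf t0).
Qed.

Lemma mean_no_event f u a b : good f -> 0 <= a -> a <= b ->
  \int[P]_w (\1_(no_event a b) w * f u (config w a)) = expR (- total_incr a b) * mean f u a.
Proof.
move=> gf a0 ab; rewrite Rintegral_indic; last exact: measurable_no_event.
rewrite /Rintegral /no_event (window_integral rate_ge0 mcnt mconfig law dyn norm0_integrable)//.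
  by rewrite no_event_prob fineM// integrable_fin_num//; exact: good_integrable.
exact: enum_uniq.
Qed.

Lemma mean_one_event f u p a b : good f -> 0 <= a -> a <= b ->
  \int[P]_w (\1_(one_event p a b) w * f u (config w a)) =
  m_ p a b * expR (- total_incr a b) * mean f u a.
Proof.
move=> gf a0 ab; rewrite Rintegral_indic; last exact: measurable_one_event.
rewrite /Rintegral /one_event (window_integral rate_ge0 mcnt mconfig law dyn norm0_integrable)//.
  by rewrite one_event_prob fineM// integrable_fin_num//; exact: good_integrable.
exact: enum_uniq.
Qed.

Lemma mean_time_lipschitz f : good f -> exists2 K, 0 <= K &
  forall u v t, 0 <= t -> `|mean f u t - mean f v t| <= K * `|u - v|.
Proof.
move=> gf; have [K K0 [_ _ lf _]] := gf; exists K => // u v t t0.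
rewrite (_ : K * _ = \int[P]_w (K * `|u - v|)); last first.
  by rewrite Rintegral_cstT.
apply: le_Rintegral_dist => //; try exact: good_integrable.
exact: integrable_cst.
Qed.

Lemma mean_bounded f T0 : good f -> 0 <= T0 -> exists2 C, 0 <= C &
  forall u t, `|u| <= T0 -> 0 <= t <= T0 -> `|mean f u t| <= C.
Proof.
move=> gf T00; have [K K0 [_ bf _ _]] := gf.
pose Z w := K * (cfg_norm (config w 0) + (T0 + T0 + 1)).
have iZ : integrable Z by exact: (integrable_envelope norm0_integrable).
exists (\int[P]_w Z w).
  by apply: Rintegral_ge0 => w _; rewrite mulr_ge0// addr_ge0 ?cfg_norm_ge0//; lra.
move=> u t uT /andP[t0 tT]; have if_ := good_integrable u gf t0.
apply: le_trans (le_normr_Rintegral _ if_) _ => //.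
apply: le_Rintegral => //; first exact: integrable_norm if_.
move=> w _; have M0 : 0 <= cfg_norm (config w 0) + t by rewrite addr_ge0 ?cfg_norm_ge0.
apply: le_trans (bf _ _ _ M0 (config_times_le dyn w (lexx 0) t0)) _.
by rewrite ler_wpM2l//; lra.
Qed.

(** [f] at [b] is compared with the variable [Y] built from the configuration at [a]. Without event
    they are equal; after one event they differ by at most [K * (b - a)], the event time being moved
    to [b]; otherwise [Y] is 0 and [f] is bounded by an envelope, on an event of probability at most
    [M ^ 2]. *)
Lemma one_step f T0 : good f -> 0 <= T0 -> exists2 C, 0 <= C &
  forall a b, 0 <= a -> a <= b -> b <= T0 ->
  `|mean f b b - expR (- total_incr a b) *
      (mean f b a + \sum_p m_ p a b * mean (fun u c => f u (step p u c)) b a)|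
  <= C * (total_incr a b * (b - a) + total_incr a b ^+ 2).
Proof.
move=> gf T00; have [K K0 [_ bf _ cf]] := gf.
have [C0 C00 HC0] := mean_bounded (@good_cfg_norm R N) T00.
pose C1 := K * (C0 + (T0 + T0 + 1)).
have C10 : 0 <= C1 by rewrite mulr_ge0// addr_ge0//; lra.
exists (K + C1); first exact: addr_ge0.
move=> a b a0 ab bT; set M := total_incr a b.
have M0 : 0 <= M by exact: total_incr_ge0.
have b0 : 0 <= b by exact: le_trans ab.
pose E0 := no_event a b; pose E1 p := one_event p a b.
have mE0 : measurable E0 by exact: measurable_no_event.
have mE1 p : measurable (E1 p) by exact: measurable_one_event.
pose fs p u c := f u (step p u c).
have gfs p : good (fs p) by exact: good_comp_step.
(* Bounds [f] at [b] through the configuration at [a], to which independence applies. One [b] is the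
   explicit time, the other bounds the times recorded since [a]. *)
pose env (c : cfg R N) := K * (cfg_norm c + (b + b + 1)).
have genv : good (fun _ : R => env).
  exact: (good_mulr K (good_add (@good_cfg_norm R N) (good_cstate (fun=> b + b + 1)))).
pose Y w := \1_E0 w * f b (config w a) + \sum_p \1_(E1 p) w * fs p b (config w a).
(* The second summand is the envelope off [E0] and all the [E1 p]. *)
pose Z w := \sum_p \1_(E1 p) w * (K * (b - a)) +
  (env (config w a) + (- (\1_E0 w * env (config w a)) - \sum_p \1_(E1 p) w * env (config w a))).
have iY : integrable Y.
  apply: integrable_addr; first by apply: integrable_indicM => //; exact: good_integrable.
  apply: integrable_sumr => p; apply: integrable_indicM => //; exact: good_integrable.
have ienv : integrable (fun w => env (config w a)) by exact: (good_integrable 0 genv a0).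
have i1 : integrable (fun w => \sum_p \1_(E1 p) w * (K * (b - a))).
  by apply: integrable_sumr => p; apply: integrable_indicM => //; exact: integrable_cst.
have i2 : integrable (fun w => - (\1_E0 w * env (config w a))).
  rewrite (_ : (fun w => _) = fun w => (-1 * (\1_E0 w * env (config w a)))%:E).
    by apply: integrable_mulr; exact: integrable_indicM.
  by apply/funext => w; rewrite mulN1r.
have i3 : integrable (fun w => \sum_p \1_(E1 p) w * env (config w a)).
  by apply: integrable_sumr => p; exact: integrable_indicM.
have i23 : integrable (fun w => - (\1_E0 w * env (config w a)) -
    \sum_p \1_(E1 p) w * env (config w a)) by exact: (integrableB measurableT i2 i3).
have iZ : integrable Z.
  by apply: integrable_addr => //; exact: integrable_addr.
have YE : \int[P]_w Y w = expR (- M) * (mean f b a + \sum_p m_ p a b * mean (fs p) b a).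
  rewrite RintegralD//; last 2 first.
  - by apply: integrable_indicM => //; exact: good_integrable.
  - by apply: integrable_sumr => p; apply: integrable_indicM => //; exact: good_integrable.
  rewrite mean_no_event// mulrDr; congr (_ + _).
  rewrite Rintegral_sumr; last by move=> p; apply: integrable_indicM => //; exact: good_integrable.
  rewrite mulr_sumr; apply: eq_bigr => p _.
  by rewrite mean_one_event// -/M; ring.
have ZE : \int[P]_w Z w = M * expR (- M) * (K * (b - a)) +
    (1 - expR (- M) - M * expR (- M)) * mean (fun _ : R => env) 0 a.
  rewrite RintegralD//; last exact: integrable_addr.
  rewrite RintegralD// RintegralB// !Rintegral_sumr//; last 2 first.
  - by move=> p; exact: integrable_indicM.
  - by move=> p; apply: integrable_indicM => //; exact: integrable_cst.
  have -> : \int[P]_w (- (\1_E0 w * env (config w a))) =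
      - (expR (- M) * mean (fun _ : R => env) 0 a).
    under eq_Rintegral do rewrite -mulN1r.
    rewrite RintegralZl ?mulN1r//; last exact: integrable_indicM.
    by rewrite (mean_no_event 0 genv).
  have S1 : \sum_p \int[P]_w (\1_(E1 p) w * (K * (b - a))) = M * expR (- M) * (K * (b - a)).
    rewrite /M /total_incr !mulr_suml; apply: eq_bigr => p _.
    rewrite (mean_one_event 0 p (good_cstate (fun=> K * (b - a))))//.
    by rewrite /mean Rintegral_cstT.
  have S2 : \sum_p \int[P]_w (\1_(E1 p) w * env (config w a)) =
      M * expR (- M) * mean (fun _ : R => env) 0 a.
    rewrite /M /total_incr !mulr_suml; apply: eq_bigr => p _.
    by rewrite (mean_one_event 0 p genv).
  by rewrite S1 S2 /mean; ring.
rewrite -YE; apply: (@le_trans _ _ (\int[P]_w Z w)).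
  apply: le_Rintegral_dist => //; first exact: good_integrable.
  move=> w.
  have ind0 p : E0 w -> \1_(E1 p) w = 0 :> R.
    move=> /no_eventP w0; rewrite indicE memNset// => /one_eventP/(_ p).
    by rewrite w0 eqxx.
  have [w0|nw0] := pselect (E0 w).
    have s0 (x : pidx N -> R) : \sum_p \1_(E1 p) w * x p = 0.
      by rewrite big1// => p _; rewrite ind0// mul0r.
    rewrite /Y /Z !s0 indicE mem_set// !mul1r (config_no_event a0 ab w0) addr0 subrr normr0.
    by lra.
  have i00 : \1_E0 w = 0 :> R by rewrite indicE memNset.
  have [[p wp]|nw1] := pselect (exists p, E1 p w).
    have s1 (x : pidx N -> R) : \sum_p \1_(E1 p) w * x p = x p.
      rewrite (bigD1 p)//= big1 ?addr0; first by rewrite indicE mem_set// mul1r.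
      move=> p' pp; rewrite indicE memNset ?mul0r// => /one_eventP/(_ p').
      by move/one_eventP: wp => /(_ p'); rewrite (negbTE pp) eqxx => ->.
    have [t /andP[at_ tb] ->] := config_one_event a0 ab wp.
    rewrite /Y /Z !s1 i00 !mul0r add0r oppr0 sub0r subrr addr0 /fs.
    apply: cf; apply: step_close; last by split=> *; rewrite ?subrr ?normr0//; lra.
    by rewrite ler_norml; apply/andP; split; lra.
  have s2 (x : pidx N -> R) : \sum_p \1_(E1 p) w * x p = 0.
    rewrite big1// => p _; rewrite indicE memNset ?mul0r// => wp.
    by apply: nw1; exists p.
  have -> : Y w = 0 by rewrite /Y s2 i00; ring.
  have -> : Z w = env (config w a) by rewrite /Z !s2 i00; ring.
  rewrite subr0.
  have Mb : 0 <= cfg_norm (config w a) + b by rewrite addr_ge0 ?cfg_norm_ge0.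
  apply: le_trans (bf _ _ _ Mb (config_times_le dyn w a0 ab)) _.
  by rewrite ler_wpM2l// ger0_norm//; lra.
rewrite ZE mulrDl [X in _ <= X]mulrDr.
have e1 : expR (- M) <= 1 by rewrite expR_le1; lra.
have e0 : 0 <= expR (- M) by exact: expR_ge0.
have e2 : 1 - M <= expR (- M) by have := expR_ge1Dx (- M).
have envC : mean (fun _ : R => env) 0 a <= C1.
  rewrite /mean /env RintegralZl//; last first.
    by apply: integrable_addr; [exact: config_norm_integrable|exact: integrable_cst].
  rewrite ler_wpM2l// RintegralD//; [|exact: config_norm_integrable|exact: integrable_cst].
  rewrite Rintegral_cstT lerD//; last lra.
  apply: le_trans (ler_norm _) (HC0 0 a _ _); first by rewrite normr0.
  by rewrite a0 (le_trans ab).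
have env0 : 0 <= mean (fun _ : R => env) 0 a.
  apply: Rintegral_ge0 => w _; rewrite mulr_ge0// addr_ge0 ?cfg_norm_ge0//; lra.
(* By [e2], since [(1 + M) * (1 - M) = 1 - M ^ 2]. *)
have rest0 : 1 - expR (- M) - M * expR (- M) <= M ^+ 2 by nra.
have ba0 : 0 <= b - a by lra.
have h1 : M * expR (- M) * (K * (b - a)) <= K * (M * (b - a)).
  rewrite (_ : K * (M * (b - a)) = M * (K * (b - a))); last by ring.
  by rewrite ler_wpM2r ?mulr_ge0// ler_piMr.
have h2 : (1 - expR (- M) - M * expR (- M)) * mean (fun _ : R => env) 0 a <= C1 * M ^+ 2.
  apply: le_trans (_ : M ^+ 2 * mean (fun _ : R => env) 0 a <= _).
    by rewrite ler_wpM2r.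
  by rewrite mulrC ler_wpM2r// sqr_ge0.
have h3 : 0 <= C1 * (M * (b - a)) by apply: mulr_ge0 => //; exact: mulr_ge0.
have h4 : 0 <= K * M ^+ 2 by rewrite mulr_ge0// sqr_ge0.
by lra.
Qed.

End ShortTime.

(** * Bounds on intensities *)

Section Intensities.
Variable R : realType.
Implicit Types (f : R -> R) (a b l r : R).

(* The integral of a nonnegative function, measurable or not, is a supremum over
   the simple functions below it. *)
Lemma ge0_le_integral_sup d (T : measurableType d) (m : {measure set T -> \bar R})
    (D : set T) (f g : T -> \bar R) :
  (forall x, D x -> 0 <= f x)%E -> (forall x, D x -> f x <= g x)%E ->
  (\int[m]_(x in D) f x <= \int[m]_(x in D) g x)%E.
Proof.
move=> f0 fg; have g0 x : D x -> (0 <= g x)%E by move=> Dx; exact: le_trans (f0 x Dx) (fg x Dx).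
rewrite !ge0_integralE//; apply: ereal_sup_le => _ [h /= hf <-]; exists h => // x.
apply: le_trans (hf x) _; rewrite !patchE; case: ifPn => // xD.
by apply: fg; rewrite inE in xD.
Qed.

(** Nonnegativity of [l] allows the comparison with integrals of constants, and the finite bounds
    make [fine] harmless. Continuity of a rate, or a one-sided bound on it, becomes an estimate of
    its increments in this way. *)
Lemma intensity_bounds f a b l r : a <= b -> 0 <= l ->
  (forall u, a <= u <= b -> l <= f u <= r) ->
  l * (b - a) <= intensity f a b <= r * (b - a).
Proof.
move=> ab l0 lfr.
have lab : lebesgue_measure (`[a, b]%classic : set R) = (b - a)%:E.
  rewrite lebesgue_measure_itv/= lte_fin; case: ifP => [_|/negbT]; first by rewrite EFinB.
  by rewrite -leNgt => ba; have -> : b = a; [lra|rewrite subrr].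
have icst k : (\int[lebesgue_measure]_(u in `[a, b]) (k%:E) = (k * (b - a))%:E)%E.
  by rewrite integral_cst//= lab EFinM.
have h1 : ((l * (b - a))%:E <= \int[lebesgue_measure]_(u in `[a, b]) (f u)%:E)%E.
  rewrite -icst; apply: ge0_le_integral_sup => u /=; rewrite in_itv/= lee_fin => // uab.
  by have /andP[] := lfr u uab.
have h2 : (\int[lebesgue_measure]_(u in `[a, b]) (f u)%:E <= (r * (b - a))%:E)%E.
  rewrite -icst; apply: ge0_le_integral_sup => u /=; rewrite in_itv/= lee_fin => uab;
    have /andP[lu ur] := lfr u uab => //; exact: le_trans l0 lu.
have I0 : (0 <= \int[lebesgue_measure]_(u in `[a, b]) (f u)%:E)%E.
  by apply: le_trans h1; rewrite lee_fin mulr_ge0// subr_ge0.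
rewrite /intensity -2!lee_fin fineK ?h1 ?h2// ge0_fin_numE//.
exact: le_lt_trans h2 (ltry _).
Qed.

End Intensities.

(** * Increments of means *)

Section Generator.
Variables (R : realType) (N : nat) (d : measure_display) (Omega : measurableType d).
Variables (lam mu : 'I_N -> R -> R) (A S : 'I_N -> Omega -> R -> nat)
  (q : Omega -> R -> st N) (G : Omega -> R -> R) (W L : 'I_N -> Omega -> R -> R).
Variable P : probability Omega R.
Implicit Types (w : Omega) (p : pidx N) (a b h t u v : R) (f : R -> cfg R N -> R).

Local Notation cnt := (cnt A S).
Local Notation config := (config q G W L).
Local Notation rate := (rate lam mu).

Hypothesis rate_ge0 : forall p t, 0 <= t -> 0 <= rate p t.
Hypothesis mcnt : forall p t n, measurable [set w | cnt p w t = n].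
Hypothesis mconfig : forall t, cfg_measurable (fun w => config w t).
Hypothesis law : poisson_law lam mu A S q G W L P.
Hypothesis dyn : forall w, dynamics A S q G W L w.
Hypothesis norm0_integrable : P.-integrable setT (fun w => (cfg_norm (config w 0))%:E).

Local Notation m_ := (mean_incr lam mu).
Local Notation total := (total_incr lam mu).
Local Notation Ef := (mean q G W L P).
Local Notation after f p := (fun u c => f u (step p u c)).

Let bounded := mean_bounded mconfig dyn norm0_integrable.
Let time_lip := mean_time_lipschitz mconfig dyn norm0_integrable.
Let one_step := one_step rate_ge0 mcnt mconfig law dyn norm0_integrable.

Lemma mean_after_bounded f T0 : good f -> 0 <= T0 -> exists2 C, 0 <= C &
  forall a b, 0 <= a -> a <= b -> b <= T0 ->
  `|\sum_p m_ p a b * Ef (after f p) b a| <= C * total a b.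
Proof.
move=> gf T00.
have /choice[C HC] : forall p, exists C, 0 <= C /\
    forall u t, `|u| <= T0 -> 0 <= t <= T0 -> `|Ef (after f p) u t| <= C.
  by move=> p; have [C C0 HC] := bounded (good_comp_step p gf) T00; exists C.
have C0 p : 0 <= C p by case: (HC p).
exists (\sum_p C p); first exact: sumr_ge0.
move=> a b a0 ab bT; apply: le_trans (ler_norm_sum _ _ _) _.
rewrite /total_incr mulr_sumr ler_sum// => p _.
have m0 : 0 <= m_ p a b by exact: mean_incr_ge0.
rewrite normrM (ger0_norm m0) mulrC ler_wpM2r//.
apply: (@le_trans _ _ (C p)); last by rewrite (bigD1 p)//= lerDl sumr_ge0.
have [_] := HC p; apply.
  by rewrite ger0_norm// (le_trans a0).
by rewrite a0 (le_trans ab).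
Qed.

(** [f] is affine in its explicit time with slope [kappa], which gives the ageing term exactly. In
    the expansion of [one_step], replacing [expR (- M)] by [1 - M] before the mean of [f] and by 1
    before the jump terms costs a multiple of [M ^ 2]. *)
Lemma mean_increment f kappa T0 : good f ->
  (forall u v c, f v c - f u c = (v - u) * kappa c) -> good (fun=> kappa) -> 0 <= T0 ->
  exists2 C, 0 <= C & forall a b, 0 <= a -> a <= b -> b <= T0 ->
  `|Ef f b b - Ef f a a - ((b - a) * Ef (fun=> kappa) a a +
      \sum_p m_ p a b * (Ef (after f p) b a - Ef f b a))|
  <= C * (total a b * (b - a) + total a b ^+ 2).
Proof.
move=> gf fk gk T00.
have [C1 C10 H1] := one_step gf T00.
have [C2 C20 H2] := bounded gf T00.
have [C3 C30 H3] := mean_after_bounded gf T00.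
exists (C1 + (C2 + C3)); first by rewrite !addr_ge0.
move=> a b a0 ab bT; set M := total a b.
have M0 : 0 <= M by exact: total_incr_ge0.
have b0 : 0 <= b by exact: le_trans ab.
have E1 : (b - a) * Ef (fun=> kappa) a a = Ef f b a - Ef f a a.
  rewrite /mean -RintegralB//; try exact: (good_integrable mconfig dyn norm0_integrable).
  rewrite -RintegralZl//; last exact: (good_integrable mconfig dyn norm0_integrable a gk a0).
  by apply: eq_Rintegral => w _; rewrite fk.
have E2 : \sum_p m_ p a b * (Ef (after f p) b a - Ef f b a) =
    \sum_p m_ p a b * Ef (after f p) b a - M * Ef f b a.
  by rewrite /M /total_incr mulr_suml -sumrB; apply: eq_bigr => p _; rewrite mulrBr.
have := H1 a b a0 ab bT; have := H3 a b a0 ab bT.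
have : `|Ef f b a| <= C2.
  by apply: H2; [rewrite ger0_norm|rewrite a0 (le_trans ab)].
rewrite {}E1 {}E2 -/M; set B := \sum_p _; set X := Ef f b a; set F := Ef f b b.
have e1 : expR (- M) <= 1 by rewrite expR_le1; lra.
have e2 : 1 - M <= expR (- M) by have := expR_ge1Dx (- M).
(* From [expR (- M) * (1 + M) <= 1] and [(1 + M) * (1 - M + M ^ 2) = 1 + M ^ 3]. *)
have e3 : expR (- M) <= 1 - M + M ^+ 2.
  have em : expR (- M) * (1 + M) <= 1.
    by rewrite -[leRHS](expRxMexpNx_1 M) mulrC ler_wpM2r ?expR_ge0// expR_ge1Dx.
  have M3 : 0 <= expR (- M) * M ^+ 3 by rewrite mulr_ge0 ?expR_ge0// exprn_ge0.
  have : expR (- M) * (1 + M) * (1 - M + M ^+ 2) <= 1 * (1 - M + M ^+ 2).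
    by rewrite ler_wpM2r//; nra.
  by nra.
move=> HX HB HF.
have -> : F - Ef f a a - (X - Ef f a a + (B - M * X)) =
    (F - expR (- M) * (X + B)) + ((expR (- M) - 1 + M) * X + (expR (- M) - 1) * B) by ring.
apply: le_trans (ler_normD _ _) _; rewrite [leRHS]mulrDl lerD//.
apply: le_trans (ler_normD _ _) _; rewrite [leRHS]mulrDl !normrM.
have ba : 0 <= b - a by lra.
have Mba : 0 <= M * (b - a) by exact: mulr_ge0.
have n1 : `|expR (- M) - 1 + M| <= M ^+ 2 by rewrite ger0_norm; lra.
have n2 : `|expR (- M) - 1| <= M by rewrite ler0_norm; lra.
apply: lerD.
  apply: (@le_trans _ _ (M ^+ 2 * C2)); first exact: ler_pM.
  by rewrite mulrC ler_wpM2l// lerDr.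
apply: (@le_trans _ _ (M * (C3 * M))); first exact: ler_pM.
by rewrite mulrCA -expr2 ler_wpM2l// lerDr.
Qed.

(** Only of first order, but for every [good] functional: it gives the continuity of the means of
    [kappa] and of the functionals after a step, which are the coefficients of the expansion. *)
Lemma mean_lipschitz f T0 : good f -> 0 <= T0 -> exists2 C, 0 <= C &
  forall a b, 0 <= a -> a <= b -> b <= T0 ->
  `|Ef f b b - Ef f a a| <= C * ((b - a) + total a b + total a b * (b - a) + total a b ^+ 2).
Proof.
move=> gf T00.
have [C1 C10 H1] := one_step gf T00.
have [C2 C20 H2] := bounded gf T00.
have [C3 C30 H3] := mean_after_bounded gf T00.
have [K K0 HK] := time_lip gf.
exists (C1 + (C2 + C3) + K); first by rewrite !addr_ge0.
move=> a b a0 ab bT; set M := total a b.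
have M0 : 0 <= M by exact: total_incr_ge0.
have b0 : 0 <= b by exact: le_trans ab.
have := H1 a b a0 ab bT; have := H3 a b a0 ab bT; have := HK b a a a0.
have : `|Ef f b a| <= C2.
  by apply: H2; [rewrite ger0_norm|rewrite a0 (le_trans ab)].
rewrite -/M; set B := \sum_p _; set X := Ef f b a; set F := Ef f b b.
have e0 : 0 <= expR (- M) by exact: expR_ge0.
have e1 : expR (- M) <= 1 by rewrite expR_le1; lra.
have e2 : 1 - M <= expR (- M) by have := expR_ge1Dx (- M).
have ba : 0 <= b - a by lra.
rewrite (ger0_norm ba) => HX HXa HB HF.
have -> : F - Ef f a a =
    (F - expR (- M) * (X + B)) + ((X - Ef f a a) + ((expR (- M) - 1) * X + expR (- M) * B))
  by ring.
have n2 : `|expR (- M) - 1| <= M by rewrite ler0_norm; lra.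
have nX : `|(expR (- M) - 1) * X| <= M * C2 by rewrite normrM ler_pM.
have nB : `|expR (- M) * B| <= C3 * M.
  by rewrite normrM (ger0_norm e0) -[leRHS]mul1r ler_pM// mulr_ge0.
have Mba : 0 <= M * (b - a) by exact: mulr_ge0.
have M2 : 0 <= M ^+ 2 by exact: sqr_ge0.
apply: le_trans (ler_normD _ _) _.
apply: le_trans (lerD (lexx _) (ler_normD _ _)) _.
apply: le_trans (lerD (lexx _) (lerD (lexx _) (ler_normD _ _))) _.
set D := b - a + M + M * (b - a) + M ^+ 2.
have D1 : C1 * (M * (b - a) + M ^+ 2) <= C1 * D by rewrite ler_wpM2l// /D; lra.
have D2 : C2 * M <= C2 * D by rewrite ler_wpM2l// /D; lra.
have D3 : C3 * M <= C3 * D by rewrite ler_wpM2l// /D; lra.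
have D4 : K * (b - a) <= K * D by rewrite ler_wpM2l// /D; lra.
rewrite [leRHS](_ : _ = C1 * D + C2 * D + C3 * D + K * D); last by ring.
by rewrite (mulrC M) in nX; lra.
Qed.

End Generator.

Lemma cvg_bound (R : realType) (F : set_system R) (x e : R -> R) (l : R) :
  Filter F -> (\forall h \near F, `|x h - l| <= e h) -> e h @[h --> F] --> (0 : R) ->
  x h @[h --> F] --> l.
Proof.
move=> FF xe /cvgrPdist_lt e0; apply/cvgrPdist_lt => r r0.
have := e0 r r0; move: xe; apply: filterS2 => h xh.
rewrite sub0r normrN distrC => er.
by apply: le_lt_trans xh _; apply: le_lt_trans er; exact: ler_norm.
Qed.

Lemma cvg_sumr (R : realType) (I : finType) (T : Type) (F : set_system T)
    (x : I -> T -> R) (l : I -> R) : Filter F ->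
  (forall i, x i h @[h --> F] --> l i) -> \sum_i x i h @[h --> F] --> \sum_i l i.
Proof. by move=> FF xl; apply: cvg_big => //; exact: add_continuous. Qed.

(** * Time derivatives of means *)

Section Derivatives.
Variables (R : realType) (N : nat) (d : measure_display) (Omega : measurableType d).
Variables (lam mu : 'I_N -> R -> R) (A S : 'I_N -> Omega -> R -> nat)
  (q : Omega -> R -> st N) (G : Omega -> R -> R) (W L : 'I_N -> Omega -> R -> R).
Variable P : probability Omega R.
Implicit Types (w : Omega) (p : pidx N) (a b h u v : R) (f : R -> cfg R N -> R).

Local Notation cnt := (cnt A S).
Local Notation config := (config q G W L).
Local Notation rate := (rate lam mu).

Hypothesis rate_ge0 : forall p t, 0 <= t -> 0 <= rate p t.
Hypothesis mcnt : forall p t n, measurable [set w | cnt p w t = n].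
Hypothesis mconfig : forall t, cfg_measurable (fun w => config w t).
Hypothesis law : poisson_law lam mu A S q G W L P.
Hypothesis dyn : forall w, dynamics A S q G W L w.
Hypothesis norm0_integrable : P.-integrable setT (fun w => (cfg_norm (config w 0))%:E).

Local Notation m_ := (mean_incr lam mu).
Local Notation total := (total_incr lam mu).
Local Notation Ef := (mean q G W L P).
Local Notation after f p := (fun u c => f u (step p u c)).

Variable t : R.
Hypothesis t0 : 0 < t.
Hypothesis rate_cont : forall p, {for t, continuous (rate p)}.

(* One-sided increments on both sides of [t] are handled at once through the
   interval with endpoints [t] and [t + h]. *)
Local Notation lo h := (Num.min t (t + h)).
Local Notation hi h := (Num.max t (t + h)).

Let hi_lo h : hi h - lo h = `|h|.
Proof.
have [h0|h0] := leP 0 h.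
  by rewrite max_r ?min_l ?ger0_norm//; lra.
by rewrite max_l ?min_r ?ltr0_norm//; lra.
Qed.

Let lo_le h : lo h <= t. Proof. by rewrite ge_min lexx. Qed.
Let hi_ge h : t <= hi h. Proof. by rewrite le_max lexx. Qed.

Let near_small (e : R) : 0 < e -> \forall h \near (0 : R)^', `|h| < e /\ h != 0.
Proof.
move=> e0; near=> h; split; last by near: h; exact: nbhs_dnbhs_neq.
near: h; apply: dnbhs0_lt => //.
Unshelve. all: by end_near. Qed.

Let norm_cvg0 : `|h| @[h --> (0 : R)^'] --> (0 : R).
Proof.
apply/cvgrPdist_lt => e /near_small; apply: filterS => h [he _].
by rewrite sub0r normrN normr_id.
Qed.

Lemma incr_rate_cvg p : m_ p (lo h) (hi h) / `|h| @[h --> (0 : R)^'] --> rate p t.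
Proof.
apply/cvgrPdist_le => e e0.
have /cvgrPdist_le/(_ e e0)/nbhs_ballP[r /= r0 Hr] := @rate_cont p.
have := near_small r0; have := near_small t0; apply: filterS2 => h [ht h0] [hr _].
have hp : 0 < `|h| by rewrite normr_gt0.
have loh := hi_lo h; have lot := lo_le h; have hit := hi_ge h.
(* The lower bound is clipped at 0 because [intensity_bounds] wants it nonnegative. *)
have /andP[m1 m2] : Num.max 0 (rate p t - e) * (hi h - lo h) <= m_ p (lo h) (hi h) <=
    (rate p t + e) * (hi h - lo h).
  apply: intensity_bounds; [lra|by rewrite le_max lexx|move=> u /andP[lu uh]].
  have u0 : 0 <= u by lra.
  have : `|rate p t - rate p u| <= e.
    by apply: Hr; rewrite /ball/= ltr_norml; apply/andP; split; lra.
  by rewrite ler_norml ge_max rate_ge0//= => /andP[? ?]; apply/andP; split; lra.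
rewrite loh in m1 m2.
have m1' : Num.max 0 (rate p t - e) <= m_ p (lo h) (hi h) / `|h| by rewrite ler_pdivlMr.
have m2' : m_ p (lo h) (hi h) / `|h| <= rate p t + e by rewrite ler_pdivrMr.
move: m1'; rewrite ge_max => /andP[_ m1'].
by rewrite ler_norml; apply/andP; split; lra.
Qed.

Lemma total_rate_cvg : total (lo h) (hi h) / `|h| @[h --> (0 : R)^'] --> \sum_p rate p t.
Proof.
under eq_fun do rewrite /total_incr mulr_suml.
by apply: cvg_sumr => p; exact: incr_rate_cvg.
Qed.

Lemma total_cvg0 : total (lo h) (hi h) @[h --> (0 : R)^'] --> (0 : R).
Proof.
have : total (lo h) (hi h) / `|h| * `|h| @[h --> (0 : R)^'] --> (\sum_p rate p t) * 0.
  by apply: cvgM; [exact: total_rate_cvg|exact: norm_cvg0].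
rewrite mulr0; apply: cvg_trans; apply: near_eq_cvg.
by have := near_small t0; apply: filterS => h [_ h0]; rewrite divfK// normr_eq0.
Qed.

Lemma mean_cvg f : good f -> Ef f (hi h) (lo h) @[h --> (0 : R)^'] --> Ef f t t.
Proof.
move=> gf.
have T0 : 0 <= t + t by rewrite addr_ge0// ltW.
have [C C0 HC] := mean_lipschitz rate_ge0 mcnt mconfig law dyn norm0_integrable gf T0.
have [K K0 HK] := mean_time_lipschitz mconfig dyn norm0_integrable gf.
pose e h := K * `|h| + C * (`|h| + total (lo h) (hi h) + total (lo h) (hi h) * `|h| +
   total (lo h) (hi h) * total (lo h) (hi h)).
apply: (@cvg_bound _ _ _ e).
  have := near_small t0; apply: filterS => h [ht h0].
  have loh := hi_lo h; have lot := lo_le h; have hit := hi_ge h.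
  have lo0 : 0 <= lo h by rewrite le_min ltW//=; have := ler_norm (- h); rewrite normrN; lra.
  have hiT : hi h <= t + t.
    by rewrite ge_max; apply/andP; split; have := ler_norm h; lra.
  have -> : Ef f (hi h) (lo h) - Ef f t t =
    (Ef f (hi h) (lo h) - Ef f (lo h) (lo h)) + (Ef f (lo h) (lo h) - Ef f t t) by ring.
  apply: le_trans (ler_normD _ _) _; apply: lerD.
    by rewrite -[X in K * X](@normr_id _ _ h) -loh; exact: HK.
  have tot0 : 0 <= total (lo h) (hi h) by exact: total_incr_ge0.
  have h0' : 0 <= `|h| by [].
  (* For [h >= 0] the interval starts at [t] and the second difference vanishes; for [h < 0] it ends
     at [t] and [mean_lipschitz] applies. *)
  have [h0p|hn] := leP 0 h.
    have loE : lo h = t by rewrite min_l//; lra.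
    by rewrite {1 2}loE subrr normr0 mulr_ge0// !addr_ge0// mulr_ge0.
  have hiE : hi h = t by rewrite max_l//; lra.
  have := HC (lo h) (hi h) lo0 (le_trans lot hit) hiT.
  by rewrite loh distrC -expr2 hiE.
have e0 : K * 0 + C * (0 + 0 + 0 * 0 + 0 * 0) = 0 :> R by rewrite !(mulr0, addr0).
rewrite -[0 in X in _ --> X]e0 /e.
have n0 := norm_cvg0; have tc := total_cvg0.
apply: cvgD; apply: cvgM; [exact: cvg_cst|exact: n0|exact: cvg_cst|].
by apply: cvgD; [apply: cvgD; [exact: cvgD|exact: cvgM]|exact: cvgM].
Qed.

(** [mean_increment] between [t] and [t + h], divided by [|h|]: the remainder becomes
    [C * (M + (M / |h|) * M)], where [M / |h|] converges and [M] tends to 0. *)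
Theorem generator_derive f kappa : good f ->
  (forall u v c, f v c - f u c = (v - u) * kappa c) -> good (fun=> kappa) ->
  is_derive t 1 (fun u => Ef f u u)
    (Ef (fun=> kappa) t t + \sum_p rate p t * (Ef (after f p) t t - Ef f t t)).
Proof.
move=> gf fk gk; set D := (X in is_derive _ _ _ X).
suff H : h^-1 *: (((fun u => Ef f u u) \o shift t) (h *: (1 : R)) - Ef f t t)
    @[h --> (0 : R)^'] --> D.
  by apply: DeriveDef; [apply/cvg_ex; exists D; exact: H|exact/cvg_lim].
pose B h := Ef (fun=> kappa) (hi h) (lo h) + \sum_p m_ p (lo h) (hi h) / `|h| *
  (Ef (after f p) (hi h) (lo h) - Ef f (hi h) (lo h)).
have BD : B h @[h --> (0 : R)^'] --> D.
  apply: cvgD; first exact: mean_cvg.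
  apply: cvg_sumr => p; apply: cvgM; first exact: incr_rate_cvg.
  by apply: cvgB; apply: mean_cvg => //; exact: good_comp_step.
have T0 : 0 <= t + t by rewrite addr_ge0// ltW.
have [C C0 HC] := mean_increment rate_ge0 mcnt mconfig law dyn norm0_integrable gf fk gk T0.
rewrite -[D]addr0.
pose Q h := h^-1 *: (Ef f (h *: (1 : R) + t) (h *: (1 : R) + t) - Ef f t t).
have -> : (fun h => h^-1 *: (((fun u => Ef f u u) \o shift t) (h *: (1 : R)) - Ef f t t)) =
    fun h => B h + (Q h - B h) by apply/funext => h; rewrite /Q /=; ring.
apply: cvgD; first exact: BD.
pose e h := C * (total (lo h) (hi h) + total (lo h) (hi h) / `|h| * total (lo h) (hi h)).
apply: (@cvg_bound _ _ _ e); last first.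
  have tc := total_cvg0; have tr := total_rate_cvg.
  rewrite -[0 in X in _ --> X](mulr0 C) -[0 in X in _ --> C * X](addr0 0).
  rewrite -[0 in X in _ --> C * (_ + X)](mulr0 (\sum_p rate p t)).
  by apply: cvgM; [exact: cvg_cst|apply: cvgD => //; exact: cvgM].
have := near_small t0; apply: filterS => h [ht h0].
have loh := hi_lo h; have lot := lo_le h; have hit := hi_ge h.
have lo0 : 0 <= lo h by rewrite le_min ltW//=; have := ler_norm (- h); rewrite normrN; lra.
have hiT : hi h <= t + t.
  by rewrite ge_max; apply/andP; split; have := ler_norm h; lra.
have hp : 0 < `|h| by rewrite normr_gt0.
have hn0 : `|h| != 0 by rewrite normr_eq0.
(* For [h < 0] numerator and denominator both change sign. *)
have QE : Q h = (Ef f (hi h) (hi h) - Ef f (lo h) (lo h)) / `|h|.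
  rewrite /Q; have -> : h *: (1 : R) + t = t + h by rewrite addrC /GRing.scale/= mulr1.
  rewrite /GRing.scale/= mulrC.
  have [h0p|hn] := leP 0 h.
    by rewrite max_r ?min_l ?ger0_norm//; lra.
  have -> : hi h = t by rewrite max_l//; lra.
  have -> : lo h = t + h by rewrite min_r//; lra.
  by rewrite (ltr0_norm hn) invrN mulrN -mulNr opprB.
have BE : B h = ((hi h - lo h) * Ef (fun=> kappa) (lo h) (lo h) +
    \sum_p m_ p (lo h) (hi h) * (Ef (after f p) (hi h) (lo h) - Ef f (hi h) (lo h))) / `|h|.
  rewrite mulrDl loh mulrAC divff// mul1r; congr (_ + _).
  by rewrite mulr_suml; apply: eq_bigr => p _; rewrite mulrAC.
rewrite subr0 QE BE -mulrBl normrM normfV normr_id ler_pdivrMr//.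
have := HC (lo h) (hi h) lo0; rewrite loh => /(_ _ hiT) H.
apply: le_trans (H _) _; first by lra.
rewrite /e -[leRHS]mulrA ler_wpM2l// mulrDl lerD// expr2.
by rewrite [leRHS]mulrAC divfK.
Qed.

End Derivatives.

(** * State vectors *)

Section StateIndex.
Variable N : nat.
Implicit Types (s a b : st N).

Lemma binary_lt n (b : 'I_n -> bool) : (\sum_(i < n) 2 ^ i * b i < 2 ^ n)%N.
Proof.
elim: n b => [|n IH] b; first by rewrite big_ord0.
rewrite big_ord_recr/= expnS mul2n -addnn -addSn leq_add ?IH//.
by case: (b ord_max); rewrite ?muln1 ?muln0.
Qed.

(** The lower digits sum to less than [2 ^ n], so they cannot compensate for a difference in the top
    one. *)
Lemma binary_inj n (b c : 'I_n -> bool) :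
  (\sum_(i < n) 2 ^ i * b i = \sum_(i < n) 2 ^ i * c i)%N -> b =1 c.
Proof.
elim: n b c => [|n IH] b c; first by move=> _ [].
rewrite !big_ord_recr/=.
have := binary_lt (fun i => b (widen_ord (leqnSn n) i)).
have := binary_lt (fun i => c (widen_ord (leqnSn n) i)).
set x := (\sum_(i < n) 2 ^ i * c _)%N; set y := (\sum_(i < n) 2 ^ i * b _)%N.
move=> xn yn E.
have [bc xy] : b ord_max = c ord_max /\ y = x.
  by move: E; case: (b ord_max); case: (c ord_max); rewrite ?muln1 ?muln0; lia.
move=> i; case: (unliftP ord_max i) => [j ->|->//].
have -> : lift ord_max j = widen_ord (leqnSn n) j by apply/val_inj; rewrite /= /bump leqNgt ltn_ord.
exact: (IH _ _ xy).
Qed.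

Lemma sigma_lt s : (sigma s < nQ N)%N.
Proof.
case: s => [[j b]|]; rewrite /sigma /nQ; last by rewrite add1n.
have := binary_lt b; have jN := ltn_ord j.
have : (2 ^ N * j.+1 <= 2 ^ N * N)%N by rewrite leq_mul2l jN orbT.
by rewrite mulnS (mulnC N); lia.
Qed.

Definition state_index s : 'I_(nQ N) := Ordinal (sigma_lt s).

(** For a busy state, dividing [sigma s - 1] by [2 ^ N] returns the class in service as quotient and
    the buffer word as remainder. *)
Lemma state_index_inj : injective state_index.
Proof.
move=> [[j b]|] [[k c]|] // /(congr1 val); rewrite /= /sigma => E; try lia.
have Nb := binary_lt b; have Nc := binary_lt c.
have P0 : (0 < 2 ^ N)%N by rewrite expn_gt0.
have {}E : ((\sum_(i < N) 2 ^ i * b i) + j * 2 ^ N = (\sum_(i < N) 2 ^ i * c i) + k * 2 ^ N)%N.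
  by apply: (@addnI 1); rewrite ![(_ + _ * 2 ^ N)%N]addnC !addnA !(mulnC _ (2 ^ N)%N).
have jk : j = k :> nat.
  have := congr1 (fun x => x %/ 2 ^ N)%N E.
  by rewrite !(addnC (\sum_(i < N) _)%N) !divnMDl// (divn_small Nb) (divn_small Nc) !addn0.
have bc : b =1 c by apply: binary_inj; move: E; rewrite jk => /addIn.
by congr (Some (_, _)); [exact: val_inj|exact/ffunP].
Qed.

Lemma card_state : #|{: st N}| = nQ N.
Proof.
by rewrite card_option card_prod card_ffun card_bool !card_ord /nQ add1n.
Qed.

Lemma state_index_bij : bijective state_index.
Proof. by apply: (inj_card_bij state_index_inj); rewrite card_ord card_state. Qed.

End StateIndex.

(** * The generator in terms of the driving processes *)

Section StateVectors.
Variables (R : realType) (N : nat) (lam mu : 'I_N -> R -> R).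
Implicit Types (s a b : st N) (g : st N -> R) (t : R) (p : pidx N).

Lemma sigma_eq a b : (sigma a == sigma b) = (a == b).
Proof.
apply/eqP/eqP => [ab|->//]; apply: state_index_inj; exact: val_inj.
Qed.

Lemma rv_ofE g s : rv_of g 0 (state_index s) = g s.
Proof.
rewrite mxE (bigD1 s)//= sigma_eq eqxx big1 ?addr0// => a /negbTE as_.
by rewrite sigma_eq as_.
Qed.

Lemma mx_ofE (f : st N -> st N -> R) a b : mx_of f (state_index a) (state_index b) = f a b.
Proof.
rewrite mxE (bigD1 a)//= (bigD1 b)//= !sigma_eq !eqxx/= !big1 ?addr0// => [c|c] /negbTE E.
  by rewrite big1// => e _; rewrite !sigma_eq E.
by rewrite sigma_eq E ?andbF.
Qed.

Lemma rv_mulmx g f s :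
  (rv_of g *m mx_of f) 0 (state_index s) = \sum_a g a * f a s.
Proof.
rewrite mxE (reindex (@state_index N)); last exact/onW_bij/state_index_bij.
by apply: eq_bigr => a _; rewrite rv_ofE mx_ofE.
Qed.

(** Puts arrivals and service clocks on the same footing: the clock of a class not in service leaves
    the state unchanged, and [a != b] discards such self-loops. *)
Lemma qoffE t a b : a != b ->
  qoff lam mu t a b = \sum_p (if st_step p a == b then rate lam mu p t else 0).
Proof.
move=> ab; rewrite /qoff big_sumType/=; congr (_ + _).
  by apply: eq_bigr => k _; rewrite ab.
case: a ab => [[j c]|] ab; last first.
  by rewrite big1// => j _; rewrite /= (negbTE ab).
rewrite (bigD1 j)//= eqxx ab/= big1 ?addr0// => k kj.
have -> : (Some j == Some k :> option 'I_N) = false by rewrite -(negbTE kj) eq_sym.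
by rewrite (negbTE ab).
Qed.

(* Each driving process [p] moves the mass of [a] to [st_step p a]; a process
   that leaves the state unchanged contributes nothing. *)
Lemma rv_Qgen g t s : (rv_of g *m Qgen lam mu t) 0 (state_index s) =
  \sum_p rate lam mu p t * (\sum_(a | st_step p a == s) g a - g s).
Proof.
rewrite rv_mulmx (bigD1 s)//= eqxx.
have -> : \sum_(a | a != s) g a * (if a == s then - \sum_(c | c != a) qoff lam mu t a c
      else qoff lam mu t a s) =
    \sum_p \sum_(a | a != s) g a * (if st_step p a == s then rate lam mu p t else 0).
  rewrite exchange_big/=; apply: eq_bigr => a as_.
  by rewrite (negbTE as_) qoffE// mulr_sumr.
have -> : \sum_(c | c != s) qoff lam mu t s c =
    \sum_p \sum_(c | c != s) (if st_step p s == c then rate lam mu p t else 0).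
  by rewrite exchange_big/=; apply: eq_bigr => c cs; rewrite qoffE 1?eq_sym.
rewrite mulrN mulr_sumr addrC -sumrB.
apply: eq_bigr => p _; rewrite mulrBr; set r := rate lam mu p t.
have -> : \sum_(a | a != s) g a * (if st_step p a == s then r else 0) =
    r * \sum_(a | (st_step p a == s) && (a != s)) g a.
  rewrite mulr_sumr big_mkcondl/=; apply: eq_bigr => a _.
  by case: ifP; rewrite ?mulr0// mulrC.
have -> : \sum_(c | c != s) (if st_step p s == c then r else 0) = r * (st_step p s != s)%:R.
  have [ss|ss] := eqVneq (st_step p s) s.
    by rewrite mulr0 big1// => c /negbTE; rewrite ss eq_sym => ->.
  rewrite (bigD1 (st_step p s))//= eqxx big1 ?addr0 ?mulr1// => c /andP[_ /negbTE].
  by rewrite eq_sym => ->.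
have [ss|ss] := eqVneq (st_step p s) s.
  by rewrite /= [in RHS](bigD1 s)/= ?ss//; ring.
rewrite /= [in RHS](eq_bigl (fun a => (st_step p a == s) && (a != s))); first by ring.
by move=> a; case: (eqVneq a s) => [->|]; rewrite ?andbT// (negbTE ss).
Qed.

(** When [p] acts, the mass coming from [a] need not keep the value [g a], since an age may be reset
    or handed over. [h p a] is the value it carries; the excess over [g a] produces the terms of the
    systems beyond transport by the generator. *)
Lemma rv_Qgen_correction g t s (h : pidx N -> st N -> R) :
  \sum_p rate lam mu p t * (\sum_(a | st_step p a == s) h p a - g s) =
  (rv_of g *m Qgen lam mu t) 0 (state_index s) +
  \sum_p rate lam mu p t * \sum_(a | st_step p a == s) (h p a - g a).
Proof.
rewrite rv_Qgen -big_split/=; apply: eq_bigr => p _.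
by rewrite sumrB -mulrDr; congr (_ * _); ring.
Qed.

(** From [a] only the clock of the class in service counts, so the sum over clocks collapses to a
    product with a matrix supported on the pairs [(a, dest a)]. *)
Lemma sum_service t s (k : 'I_N -> st N -> R) :
  \sum_j mu j t * \sum_(a | st_step (inr j) a == s)
    (if Jst a == Some j then k j a else 0) =
  \sum_a (if Jst a is Some j then if s == dest a then mu j t * k j a else 0 else 0).
Proof.
under eq_bigr => j _ do rewrite big_mkcond mulr_sumr.
rewrite exchange_big/=; apply: eq_bigr => a _.
case E : (Jst a) => [j|]; last first.
  by rewrite big1// => j _; case: ifP; rewrite /= mulr0.
rewrite (bigD1 j)//= eqxx (eq_sym s) big1 ?addr0; first by case: ifP; rewrite ?mulr0.
move=> i /negbTE ij; have -> : (Some j == Some i :> option 'I_N) = false by rewrite -ij eq_sym.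
by case: ifP; rewrite mulr0.
Qed.

End StateVectors.

Section StateVectorAlgebra.
Variables (R : realType) (N : nat).
Implicit Types (s : st N) (g h : st N -> R).

Lemma state_rowP (u v : 'rV[R]_(nQ N)) :
  (forall s, u 0 (state_index s) = v 0 (state_index s)) -> u = v.
Proof.
move=> uv; apply/rowP => x; have [k _ kK] := state_index_bij N.
by rewrite -(kK x); exact: uv.
Qed.

Lemma rv_ofB g h : rv_of g - rv_of h = rv_of (fun s => g s - h s).
Proof. by apply: state_rowP => s; rewrite [LHS]mxE [X in _ + X]mxE !rv_ofE. Qed.

Lemma rv_of_hadamard g h : hadamard (rv_of g) (rv_of h) = rv_of (fun s => g s * h s).
Proof. by apply: state_rowP => s; rewrite [LHS]mxE !rv_ofE. Qed.

Lemma rv_of_sum (g : 'I_N -> st N -> R) :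
  \sum_k rv_of (g k) = rv_of (fun s => \sum_k g k s).
Proof.
apply: state_rowP => s; rewrite summxE rv_ofE.
by apply: eq_bigr => k _; rewrite rv_ofE.
Qed.

End StateVectorAlgebra.

(** * The three systems *)

Section StateMoments.
Variables (R : realType) (N : nat) (d : measure_display) (Omega : measurableType d).
Variables (lam mu : 'I_N -> R -> R) (A S : 'I_N -> Omega -> R -> nat)
  (q : Omega -> R -> st N) (G : Omega -> R -> R) (W L : 'I_N -> Omega -> R -> R).
Variable P : probability Omega R.
Implicit Types (w : Omega) (p : pidx N) (u : R) (s a : st N) (f : R -> cfg R N -> R).

Local Notation cnt := (cnt A S).
Local Notation config := (config q G W L).
Local Notation rate := (rate lam mu).
Local Notation Ef := (mean q G W L P).

Definition in_state s : R -> cfg R N -> R := fun _ c => if cstate c == s then 1 else 0.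

Lemma good_in_state s : good (in_state s).
Proof. exact: (good_cstate (fun a => if a == s then 1 else 0)). Qed.

Lemma mean_state s f u (X : Omega -> R) :
  (forall w, f u (config w u) = if q w u == s then X w else 0) ->
  fine (\int[P]_(w in [set w | q w u = s]) (X w)%:E) = Ef f u u.
Proof.
move=> fX; rewrite /mean -/(Rintegral P _ X) Rintegral_mkcond.
apply: eq_Rintegral => w _; rewrite patchE fX.
by case: eqP => qs; [rewrite mem_set|rewrite memNset].
Qed.

Hypothesis rate_ge0 : forall p t, 0 <= t -> 0 <= rate p t.
Hypothesis mcnt : forall p t n, measurable [set w | cnt p w t = n].
Hypothesis mconfig : forall t, cfg_measurable (fun w => config w t).
Hypothesis law : poisson_law lam mu A S q G W L P.
Hypothesis dyn : forall w, dynamics A S q G W L w.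
Hypothesis norm0_integrable : P.-integrable setT (fun w => (cfg_norm (config w 0))%:E).
Hypothesis consistent : {ae P, forall w, init_consistent q G W L w}.

Lemma pvecE u : pvec q P u = rv_of (fun s => Ef (in_state s) u u).
Proof.
congr rv_of; apply/funext => s; rewrite -(@mean_state s _ u (fun=> 1))//.
rewrite integral_cst ?mul1e//.
by have [mQ _ _ _] := mconfig u; exact: mQ.
Qed.

Lemma avecE i u : avec q L P i u = rv_of (fun s => Ef (delivered_age i s) u u).
Proof.
congr rv_of; apply/funext => s; apply: mean_state => w.
by rewrite /delivered_age /AoI /clast/= ffunE.
Qed.

Lemma yvecE u : yvec q G P u = rv_of (fun s => Ef (served_age s) u u).
Proof.
congr rv_of; apply/funext => s; apply: mean_state => w.
rewrite /served_age /Yage /cstate/cgen/=; case: eqP => [->|//] /=.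
by case: s.
Qed.

Lemma zvecE i u : zvec q W P i u = rv_of (fun s => Ef (waiting_age i s) u u).
Proof.
congr rv_of; apply/funext => s; apply: mean_state => w.
by rewrite /waiting_age /Zage /cstate/cwait/= ffunE; case: eqP => [->|].
Qed.

Lemma ordered_config w t : init_consistent q G W L w -> 0 <= t -> ordered t (config w t).
Proof.
move=> [G0 [WL0 [JL BL]]].
apply: (config_ind (Inv := fun t c => ordered t c) (dyn w) (lexx 0)).
- move=> s u c _ su [gs ws ls Jl Bl]; split => // [|k|k]; exact: le_trans su.
- by move=> p u c _; exact: step_ordered.
rewrite /ordered /cstate/cgen/cwait/clast/=; split=> // k; rewrite ?ffunE.
- by case: (WL0 k).
- by case: (WL0 k).
- exact: JL.
- exact: BL.
Qed.

Section Time.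
Variable t : R.
Hypothesis t0 : 0 < t.

(** [H a] expresses the value after the event through the configuration before it, on the state [a].
    The identity is asked of ordered configurations only, which suffices almost surely by
    [consistent]. *)
Lemma mean_after f p s (H : st N -> R -> cfg R N -> R) : good f -> (forall a, good (H a)) ->
  (forall a c, cstate c != a -> H a t c = 0) ->
  (forall c, ordered t c -> f t (step p t c) =
     if st_step p (cstate c) == s then H (cstate c) t c else 0) ->
  Ef (fun u c => f u (step p u c)) t t = \sum_(a | st_step p a == s) Ef (H a) t t.
Proof.
move=> gf gH H0 fH; have t0' := ltW t0.
have iH a := good_integrable mconfig dyn norm0_integrable t (gH a) t0'.
rewrite /mean -Rintegral_sumr//; congr fine.
apply: ae_eq_integral => //.
- apply: measurable_int.
  exact: (good_integrable mconfig dyn norm0_integrable t (good_comp_step p gf) t0').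
- apply: measurable_int; exact: (integrable_sumr _ _ iH).
move: consistent; apply: filterS => w wc _ /=; congr EFin.
rewrite fH; last exact: ordered_config.
case: ifP => ps.
  rewrite (bigD1 (cstate (config w t)))//= big1 ?addr0// => a /andP[_ aw].
  by rewrite H0// eq_sym.
rewrite big1// => a ap; apply: H0.
by apply: contraTneq ap => <-; rewrite ps.
Qed.

Hypothesis rate_cont : forall p, {for t, continuous (rate p)}.

(** Common form of the three systems: ageing with slope [kappa], transport by the generator, and
    corrections read off from [Hf]. *)
Lemma mean_after_derive f kappa s (Hf : pidx N -> st N -> R -> cfg R N -> R)
    (g : st N -> R -> cfg R N -> R) :
  (forall a, good (g a)) -> f = g s ->
  (forall u v c, f v c - f u c = (v - u) * kappa c) -> good (fun=> kappa) ->
  (forall p a, good (Hf p a)) -> (forall p a c, cstate c != a -> Hf p a t c = 0) ->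
  (forall p c, ordered t c -> f t (step p t c) =
     if st_step p (cstate c) == s then Hf p (cstate c) t c else 0) ->
  is_derive t 1 (fun u => Ef f u u) (Ef (fun=> kappa) t t +
    ((rv_of (fun a => Ef (g a) t t) *m Qgen lam mu t) 0 (state_index s) +
     \sum_p rate p t * \sum_(a | st_step p a == s) (Ef (Hf p a) t t - Ef (g a) t t))).
Proof.
move=> gg fg fk gk gH H0 fH; subst f.
rewrite -(rv_Qgen_correction lam mu (fun a => Ef (g a) t t) t s (fun p a => Ef (Hf p a) t t)).
rewrite (_ : \sum_p _ = \sum_p rate p t *
    (Ef (fun u c => g s u (step p u c)) t t - Ef (g s) t t)).
  exact: (generator_derive rate_ge0 mcnt mconfig law dyn norm0_integrable t0 rate_cont).
apply: eq_bigr => p _; congr (_ * (_ - _)); apply/esym.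
exact: (@mean_after (g s) p s (Hf p) (gg s) (gH p) (@H0 p) (@fH p)).
Qed.

Theorem avec_derive i s : is_derive t 1 (fun u => avec q L P i u 0 (state_index s))
  ((pvec q P t + avec q L P i t *m Qgen lam mu t
    + (yvec q G P t - avec q L P i t) *m Mcls mu i t) 0 (state_index s)).
Proof.
(* Only a completion of class [i] changes the delivered age, which becomes the age of the packet
   just served. *)
pose Hf p a : R -> cfg R N -> R :=
  if p is inr j then if (Jst a == Some j) && (i == j) then served_age a else delivered_age i a
  else delivered_age i a.
have gH p a : good (Hf p a).
  case: p => j /=; [exact: good_delivered_age|rewrite /Hf; case: ifP => _].
    exact: good_served_age.
  exact: good_delivered_age.
rewrite (_ : (fun u => _) = fun u => Ef (delivered_age i s) u u); last first.
  by apply/funext => u; rewrite avecE rv_ofE.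
have D := @mean_after_derive (delivered_age i s) (fun c => if cstate c == s then 1 else 0) s
  Hf (delivered_age i) (good_delivered_age R i) erefl _ (good_in_state s) gH _ _.
apply: (is_derive_eq (D _ _ _)) => {D}.
- by move=> u v c; rewrite /delivered_age; case: ifP => _; rewrite ?mulr1 ?mulr0 ?subr0//; ring.
- move=> [k|j] a c ca; rewrite /Hf/=; first by rewrite /delivered_age (negbTE ca).
  by case: ifP => _; rewrite /served_age /delivered_age (negbTE ca).
- move=> p c [gt wt lt Jl Bl]; rewrite /delivered_age cstate_step clast_step.
  case: ifP => // _; case: p => j; rewrite /Hf/=; first by rewrite /delivered_age eqxx.
  case: ifP => [/andP[/eqP Jj /eqP ij]|_]; last by rewrite /delivered_age eqxx.
  rewrite /served_age eqxx /=; have -> : cstate c != None.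
    by apply: contra_eq_neq Jj => ->.
  (* By the ordering, the maximum in [srv_step] is the generation time of the packet just
     delivered. *)
  by rewrite ij max_r// Jl.
rewrite [RHS]mxE [X in _ = X + _]mxE -addrA pvecE rv_ofE avecE yvecE rv_ofB; congr (_ + (_ + _)).
rewrite rv_mulmx big_sumType/= [X in X + _ = _]big1 ?add0r; last first.
  by move=> k _; rewrite /Hf/= big1 ?mulr0// => a _; rewrite subrr.
rewrite [LHS](_ : _ = \sum_j mu j t * \sum_(a | st_step (inr j) a == s)
    (if Jst a == Some j then (if i == j then Ef (served_age a) t t - Ef (delivered_age i a) t t
                              else 0) else 0)).
  rewrite sum_service; apply: eq_bigr => a _; case: (Jst a) => [j|]; last by rewrite mulr0.
  case: ifP => _; last by rewrite mulr0.
  by rewrite [j == i]eq_sym; case: eqP => [->|_]; rewrite ?mulr1 ?mulr0// mulrC.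
apply: eq_bigr => j _; congr (_ * _); apply: eq_bigr => a _; rewrite /Hf/=.
by case: (Jst a == Some j) => //=; case: (i == j); rewrite ?subrr.
Qed.

Theorem yvec_derive s : is_derive t 1 (fun u => yvec q G P u 0 (state_index s))
  ((hadamard (pvec q P t) (delta R (fun s : st N => Jst s != None))
    + yvec q G P t *m Qgen lam mu t
    + (\sum_(k < N) hadamard (zvec q W P k t) (delta R (fun s : st N => nextc s == Some k))
       - yvec q G P t) *m Mcomp mu t) 0 (state_index s)).
Proof.
(* If no packet waits, the server becomes idle, with age 0 by convention. *)
pose next_age a : R -> cfg R N -> R :=
  if nextc a is Some m then waiting_age m a else fun _ _ => 0.
have gnext a : good (next_age a).
  by rewrite /next_age; case: nextc => [m|]; [exact: good_waiting_age|exact: (good_cstate (fun=> 0))].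
pose Hf p a : R -> cfg R N -> R :=
  if p is inr j then if Jst a == Some j then next_age a else served_age a else served_age a.
have gH p a : good (Hf p a).
  case: p => j /=; [exact: good_served_age|rewrite /Hf; case: ifP => _ //].
  exact: good_served_age.
pose kappa (c : cfg R N) : R := if (cstate c == s) && (s != None) then 1 else 0.
have gk : good (fun _ : R => kappa).
  exact: (good_cstate (fun a => if (a == s) && (s != None) then 1 else 0)).
rewrite (_ : (fun u => _) = fun u => Ef (served_age s) u u); last first.
  by apply/funext => u; rewrite yvecE rv_ofE.
have D := @mean_after_derive (served_age s) kappa s
  Hf (@served_age R N) (good_served_age R (N := N)) erefl _ gk gH _ _.
apply: (is_derive_eq (D _ _ _)) => {D}.
- by move=> u v c; rewrite /served_age /kappa; case: ifP => _; rewrite ?mulr1 ?mulr0 ?subrr//; ring.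
- move=> [k|j] a c ca; rewrite /Hf/=; first by rewrite /served_age (negbTE ca).
  case: ifP => _; last by rewrite /served_age (negbTE ca).
  by rewrite /next_age; case: nextc => // m; rewrite /waiting_age (negbTE ca).
- move=> p c _; rewrite /served_age cstate_step cgen_step.
  have [ps|//] := eqVneq (st_step p (cstate c)) s; rewrite /= -{}ps.
  case: p => j; rewrite /Hf/=.
    (* An arrival at the idle server starts the service of a packet of age 0, which is also the age
       attached to the idle state, so arrivals need no correction. *)
    by rewrite /served_age eqxx; case: (cstate c) => [[k b]|] //=; rewrite subrr.
  have [Jj|_] := eqVneq (Jst (cstate c)) (Some j); last by rewrite /served_age eqxx.
  rewrite /next_age; case E : (cstate c) Jj => [[k b]|] //= _.
  case E' : (nextc _) => [m|] //=.
  by rewrite /waiting_age E eqxx/=; have /= -> := nextc_Bst E'.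
rewrite [RHS]mxE [X in _ = X + _]mxE -addrA pvecE rv_of_hadamard yvecE rv_ofE.
congr (_ + (_ + _)).
  rewrite -[X in _ * X]/(if Jst s != None then 1 else 0 : R).
  have -> : (Jst s != None) = (s != None) by case: (s) => [[]|].
  rewrite /mean /kappa /in_state; case: ifP => _.
    by rewrite mulr1; under eq_Rintegral do rewrite andbT.
  by rewrite mulr0; under eq_Rintegral do rewrite andbF; rewrite Rintegral_cstT.
rewrite (_ : \sum_k _ = rv_of (fun a => Ef (next_age a) t t)); last first.
  under eq_bigr do rewrite zvecE rv_of_hadamard.
  rewrite rv_of_sum; congr rv_of; apply/funext => a; rewrite /next_age.
  case: nextc => [m|]; last first.
    by rewrite big1 => [|k _]; rewrite ?mulr0// /mean Rintegral_cstT.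
  rewrite (bigD1 m)//= eqxx mulr1 big1 ?addr0// => k km.
  by rewrite (_ : (Some m == Some k :> option 'I_N) = false) ?mulr0// -(negbTE km) eq_sym.
rewrite rv_ofB rv_mulmx big_sumType/= [X in X + _ = _]big1 ?add0r; last first.
  by move=> k _; rewrite /Hf/= big1 ?mulr0// => a _; rewrite subrr.
rewrite [LHS](_ : _ = \sum_j mu j t * \sum_(a | st_step (inr j) a == s)
    (if Jst a == Some j then Ef (next_age a) t t - Ef (served_age a) t t else 0)).
  rewrite sum_service; apply: eq_bigr => a _; case: (Jst a) => [j|]; last by rewrite mulr0.
  by case: ifP => _; rewrite ?mulr0// mulrC.
apply: eq_bigr => j _; congr (_ * _); apply: eq_bigr => a _; rewrite /Hf/=.
by case: (Jst a == Some j) => //=; rewrite subrr.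
Qed.

Lemma Bst_arr k i a : Bst (arr k a) i = (a != None) && (Bst a i || (i == k)).
Proof. by case: a => [[j b]|] /=; rewrite ffunE. Qed.

Lemma nextc_None i a : nextc a = None -> Bst a i = false.
Proof.
rewrite /nextc; case E : [seq _ <- _ | _] => [|//] _; apply/negP => Bi.
have : i \in [seq j <- enum 'I_N | Bst a j] by rewrite mem_filter Bi mem_enum.
by rewrite E.
Qed.

Lemma Bst_dest i a : Bst (dest a) i = Bst a i && (nextc a != Some i).
Proof.
case: a => [[j b]|] //; rewrite /dest; case E : nextc => [m|]; rewrite /=.
  by rewrite ffunE; congr (_ && ~~ _); apply/eqP/eqP => [->|[->]].
by rewrite andbT -[b i]/(Bst (Some (j, b)) i) nextc_None.
Qed.

Theorem zvec_derive i s : is_derive t 1 (fun u => zvec q W P i u 0 (state_index s))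
  ((hadamard (pvec q P t) (delta R (fun s : st N => Bst s i))
    + zvec q W P i t *m Qgen lam mu t
    - lam i t *: hadamard (zvec q W P i t) (delta R (fun s : st N => Bst s i))
    - zvec q W P i t *m Mnext mu i t) 0 (state_index s)).
Proof.
(* The waiting age is reset to 0 by an arrival of class [i], which replaces the packet, and by the
   entry of the packet into service. *)
pose Hf p a : R -> cfg R N -> R :=
  match p with
  | inl k => if i == k then fun _ _ => 0 else waiting_age i a
  | inr j => if (Jst a == Some j) && (nextc a == Some i) then fun _ _ => 0
             else waiting_age i a
  end.
have g0 : good (fun (_ : R) (_ : cfg R N) => 0) by exact: (good_cstate (fun=> 0)).
have gH p a : good (Hf p a).
  by case: p => j; rewrite /Hf/=; case: ifP => _ //; exact: good_waiting_age.
pose kappa (c : cfg R N) : R := if (cstate c == s) && Bst s i then 1 else 0.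
have gk : good (fun _ : R => kappa).
  exact: (good_cstate (fun a => if (a == s) && Bst s i then 1 else 0)).
rewrite (_ : (fun u => _) = fun u => Ef (waiting_age i s) u u); last first.
  by apply/funext => u; rewrite zvecE rv_ofE.
have D := @mean_after_derive (waiting_age i s) kappa s
  Hf (waiting_age i) (good_waiting_age R i) erefl _ gk gH _ _.
apply: (is_derive_eq (D _ _ _)) => {D}.
- by move=> u v c; rewrite /waiting_age /kappa; case: ifP => _; rewrite ?mulr1 ?mulr0 ?subrr//; ring.
- by move=> [k|j] a c ca; rewrite /Hf/=; case: ifP => _ //; rewrite /waiting_age (negbTE ca).
- move=> p c _; rewrite /waiting_age cstate_step cwait_step.
  have [ps|//] := eqVneq (st_step p (cstate c)) s; rewrite /= -{}ps.
  case: p => j; rewrite /Hf/=.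
    rewrite Bst_arr; have [->|ij] := eqVneq i j.
      by case: (cstate c != None); rewrite /= ?orbT ?subrr.
    rewrite /waiting_age eqxx andbF orbF/=.
    by case: (cstate c).
  have [Jj|_] := eqVneq (Jst (cstate c)) (Some j); last by rewrite /= /waiting_age eqxx.
  rewrite Bst_dest /=; case: eqP => _; first by rewrite andbF.
  by rewrite andbT /waiting_age eqxx.
have Z0 a : ~~ Bst a i -> Ef (waiting_age i a) t t = 0.
  move=> /negbTE Ba; rewrite /mean /waiting_age.
  by under eq_Rintegral do rewrite Ba andbF; rewrite Rintegral_cstT.
rewrite [RHS]mxE [X in _ = X + _]mxE [X in _ = X + _ + _]mxE -!addrA.
rewrite pvecE !zvecE !rv_of_hadamard rv_ofE; congr (_ + (_ + _)).
  rewrite /mean /kappa /in_state; case: ifP => _.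
    by rewrite mulr1; under eq_Rintegral do rewrite andbT.
  by rewrite mulr0; under eq_Rintegral do rewrite andbF; rewrite Rintegral_cstT.
rewrite big_sumType/=; congr (_ + _).
  rewrite (bigD1 i)//= [X in _ + X]big1 ?addr0 => [|k ki]; last first.
    rewrite big1 ?mulr0// => a _.
    by rewrite /Hf/= eq_sym (negbTE ki) subrr.
  rewrite [RHS]mxE [X in - X]mxE rv_ofE -mulrN; congr (_ * _).
  (* The correction for arrivals of class [i] reduces to the state [s] itself: [arr i] fixes the
     states with a full buffer [i], and the others carry no waiting age. *)
  rewrite (_ : _ * _ = Ef (waiting_age i s) t t); last first.
    by case: ifP => [_|/negbT/Z0 ->]; rewrite ?mulr1 ?mul0r.
  rewrite (_ : Ef (waiting_age i s) t t = \sum_(a | a == s) Ef (waiting_age i a) t t);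
    last by rewrite big_pred1_eq.
  rewrite -sumrN big_mkcond [RHS]big_mkcond; apply: eq_bigr => a _.
  rewrite /Hf/= eqxx {1}/mean Rintegral_cstT sub0r.
  have [Ba|/Z0 ->] := boolP (Bst a i); last by rewrite oppr0 !if_same.
  suff -> : arr i a = a by [].
  case: a Ba => [[j b]|] //= bi; congr (Some (_, _)); apply/ffunP => k.
  by rewrite ffunE; case: eqP => [->|]; rewrite ?bi ?orbF.
rewrite [RHS]mxE rv_mulmx -sumrN.
rewrite [LHS](_ : _ = \sum_j mu j t * \sum_(a | st_step (inr j) a == s)
    (if Jst a == Some j then (if nextc a == Some i then - Ef (waiting_age i a) t t else 0) else 0)).
  rewrite sum_service; apply: eq_bigr => a _; case: (Jst a) => [j|]; last by rewrite mulr0 oppr0.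
  by case: (s == dest a); case: (nextc a == Some i); rewrite /= ?mulr0 ?mulr1 ?oppr0// mulrN mulrC.
apply: eq_bigr => j _; congr (_ * _); apply: eq_bigr => a _; rewrite /Hf/=.
case: (Jst a == Some j) => /=; last by rewrite subrr.
by case: (nextc a == Some i); rewrite ?subrr// {1}/mean Rintegral_cstT sub0r.
Qed.

End Time.

End StateMoments.

(** * Peak age *)

Section OneSidedBounds.
Variable R : realType.
Implicit Types (f : R -> R) (t u : R).

Lemma cvg_right_bounded f t : cvg (f @ t^'+) ->
  exists C, exists2 e, 0 < e & forall u, t <= u < t + e -> f u <= C.
Proof.
move=> /cvg_ex[l /cvgrPdist_lt/(_ 1 ltr01)[e /= e0 He]].
(* The one-sided limit says nothing about [f t], which enters the bound separately. *)
exists (Num.max (f t) (l + 1)), e => // u /andP[tu ut].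
have [->|ut'] := eqVneq u t; first by rewrite le_max lexx.
have tu' : t < u by rewrite lt_neqAle eq_sym ut'.
have : `|l - f u| < 1.
  by apply: He => //; rewrite /ball/= ltr_norml; apply/andP; split; lra.
by rewrite ltr_norml le_max => /andP[? ?]; apply/orP; right; lra.
Qed.

Lemma cvg_left_bounded f t : cvg (f @ t^'-) ->
  exists C, exists2 e, 0 < e & forall u, t - e < u <= t -> f u <= C.
Proof.
move=> /cvg_ex[l /cvgrPdist_lt/(_ 1 ltr01)[e /= e0 He]].
exists (Num.max (f t) (l + 1)), e => // u /andP[tu ut].
have [->|ut'] := eqVneq u t; first by rewrite le_max lexx.
have tu' : u < t by rewrite lt_neqAle ut'.
have : `|l - f u| < 1.
  by apply: He => //; rewrite /ball/= ltr_norml; apply/andP; split; lra.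
by rewrite ltr_norml le_max => /andP[? ?]; apply/orP; right; lra.
Qed.

End OneSidedBounds.

Lemma ae_le_Rintegral_dist (R : realType) d (T : measurableType d) (P : probability T R)
    (X Y Z : T -> R) :
  P.-integrable setT (fun w => (X w)%:E) -> P.-integrable setT (fun w => (Y w)%:E) ->
  P.-integrable setT (fun w => (Z w)%:E) -> (forall w, 0 <= Z w) ->
  {ae P, forall w, `|X w - Y w| <= Z w} ->
  `|\int[P]_w X w - \int[P]_w Y w| <= \int[P]_w Z w.
Proof.
move=> iX iY iZ Z0 XYZ; rewrite -RintegralB//.
have iXY : P.-integrable setT (fun w => (X w - Y w)%:E).
  exact: (integrableB measurableT iX iY).
apply: le_trans (le_normr_Rintegral _ iXY) _ => //.
have iN : P.-integrable setT (fun w => (`|X w - Y w|)%:E) by exact: integrable_norm iXY.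
rewrite -lee_fin !fineK; [|exact: integrable_fin_num..].
apply: ae_ge0_le_integral => //.
- exact: measurable_int iN.
- by move=> w _; rewrite lee_fin.
- exact: measurable_int iZ.
- by move: XYZ; apply: filterS => w H _; rewrite lee_fin.
Qed.

(** * Completions in a short interval *)

Section PeakAge.
Variables (R : realType) (N : nat) (d : measure_display) (Omega : measurableType d).
Variables (lam mu : 'I_N -> R -> R) (A S : 'I_N -> Omega -> R -> nat)
  (q : Omega -> R -> st N) (G : Omega -> R -> R) (W L : 'I_N -> Omega -> R -> R).
Variable P : probability Omega R.
Implicit Types (w : Omega) (p : pidx N) (a b u : R) (s : st N) (f : R -> cfg R N -> R).

Local Notation cnt := (cnt A S).
Local Notation config := (config q G W L).
Local Notation rate := (rate lam mu).
Local Notation Ef := (mean q G W L P).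
Local Notation m_ := (mean_incr lam mu).
Local Notation total := (total_incr lam mu).

Hypothesis rate_ge0 : forall p t, 0 <= t -> 0 <= rate p t.
Hypothesis rate_left : forall p t, 0 < t -> cvg (rate p @ t^'-).
Hypothesis rate_right : forall p t, 0 <= t -> cvg (rate p @ t^'+).
Hypothesis mcnt : forall p t n, measurable [set w | cnt p w t = n].
Hypothesis mconfig : forall t, cfg_measurable (fun w => config w t).
Hypothesis law : poisson_law lam mu A S q G W L P.
Hypothesis dyn : forall w, dynamics A S q G W L w.
Hypothesis norm0_integrable : P.-integrable setT (fun w => (cfg_norm (config w 0))%:E).

(** Watches [p] alone: the complement has probability at most the intensity of [p], whereas that of
    [no_event] involves the total intensity. *)
Definition quiet p a b : set Omega := window A S [:: p] a b (fun=> 0%N).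

Lemma measurable_quiet p a b : measurable (quiet p a b).
Proof. exact: (measurable_window mcnt). Qed.

Lemma mean_quiet f u p a b : good f -> 0 <= a -> a <= b ->
  \int[P]_w (\1_(quiet p a b) w * f u (config w a)) = expR (- m_ p a b) * Ef f u a.
Proof.
move=> gf a0 ab; rewrite Rintegral_indic; last exact: measurable_quiet.
rewrite /Rintegral /quiet (window_integral rate_ge0 mcnt mconfig law dyn norm0_integrable)//.
rewrite fineM//; last first.
  by apply: integrable_fin_num => //; exact: (good_integrable mconfig dyn norm0_integrable).
by rewrite /window_prob big_seq1 poissonp0.
Qed.

Lemma quiet_prob p a b : 0 <= a -> a <= b -> P (quiet p a b) = (expR (- m_ p a b))%:E.
Proof.
move=> a0 ab; have := mean_quiet 0 p (good_cstate (fun=> 1)) a0 ab.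
rewrite /mean Rintegral_cstT mulr1.
rewrite Rintegral_indic; last exact: measurable_quiet.
rewrite /Rintegral integral_cst ?mul1e; last exact: measurable_quiet.
by move=> <-; rewrite fineK//; apply: fin_num_measure; exact: measurable_quiet.
Qed.

Lemma not_quiet_prob p a b : 0 <= a -> a <= b ->
  (P (~` quiet p a b) <= (m_ p a b)%:E)%E.
Proof.
move=> a0 ab; rewrite probability_setC; last exact: measurable_quiet.
rewrite quiet_prob// -EFinB lee_fin.
by have := expR_ge1Dx (- m_ p a b); lra.
Qed.

Lemma jumps_not_quiet p a b u w : 0 <= a -> a < u <= b -> jumps (cnt p w) u ->
  (~` quiet p a b) w.
Proof.
move=> a0 /andP[au ub] ju /(_ p (mem_head _ _)).
have : (cnt p w a < cnt p w b)%N.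
  apply/(jumpsP (dynamics_cnt p (dyn w))) => //; first by lra.
  by exists u => //; rewrite au.
by lia.
Qed.

(** A jump at [u] forces a positive increment over each [(u - u / n.+1, u]], which has probability
    at most [C * (u / n.+1)] for large [n] because the rate is bounded on the left of [u]. *)
Lemma no_jump_ae p u : 0 < u -> {ae P, forall w, ~ jumps (cnt p w) u}.
Proof.
move=> u0; have [C [e e0 HC]] := cvg_left_bounded (@rate_left p u u0).
have C0 : 0 <= C.
  by apply: le_trans (HC u _); [apply: rate_ge0; exact: ltW|rewrite lexx andbT; lra].
pose E := \bigcap_n ~` quiet p (u - u / n.+1%:R) u.
have mE : measurable E.
  by apply: bigcapT_measurable => n; apply: measurableC; exact: measurable_quiet.
have un n : 0 <= u - u / n.+1%:R.
  by rewrite subr_ge0 ler_pdivrMr// -[leLHS]mulr1 ler_wpM2l ?ler1n// ltW.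
have un' n : 0 < u / n.+1%:R by rewrite divr_gt0.
exists E; split => //; last first.
  move=> w /= /contrapT ju n _; apply: jumps_not_quiet ju => //.
  by rewrite lexx andbT ltrBlDr ltrDl.
apply/eqP; rewrite eq_le measure_ge0 andbT.
have H n : u / n.+1%:R < e -> (P E <= (C * (u / n.+1%:R))%:E)%E.
  move=> ne; apply: (@le_trans _ _ (P (~` quiet p (u - u / n.+1%:R) u))).
    apply: le_measure; rewrite ?inE//; first by apply: measurableC; exact: measurable_quiet.
    by move=> w /(_ n I).
  have ab : u - u / n.+1%:R <= u by rewrite lerBlDr lerDl ltW.
  apply: le_trans (not_quiet_prob p (un n) ab) _; rewrite lee_fin.
  have /andP[_] : 0 * (u - (u - u / n.+1%:R)) <= m_ p (u - u / n.+1%:R) u <=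
      C * (u - (u - u / n.+1%:R)).
    apply: intensity_bounds => // v /andP[v1 v2].
    rewrite rate_ge0/= ?HC// ?(le_trans (un n))// v2 andbT.
    by apply: lt_le_trans v1; rewrite ltrD2l ltrN2.
  by rewrite opprB addrCA subrr addr0.
have hu : u / n.+1%:R @[n --> \oo] --> (0 : R).
  rewrite -[0](mulr0 u); apply: cvgM; [exact: cvg_cst|exact: (@cvg_harmonic R)].
have hC : C * (u / n.+1%:R) @[n --> \oo] --> (0 : R).
  by rewrite -[0](mulr0 C); apply: cvgM => //; exact: cvg_cst.
apply/lee_addgt0Pr => r r0; rewrite add0e.
have /cvgrPdist_lt/(_ e e0) h1 := hu; have /cvgrPdist_lt/(_ r r0) h2 := hC.
have [n [n1 n2]] := filter_ex (filterI h1 h2).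
rewrite sub0r normrN gtr0_norm// in n1.
apply: le_trans (H n n1) _; rewrite lee_fin ltW//.
by rewrite sub0r normrN in n2; exact: le_lt_trans (ler_norm _) n2.
Qed.

Variable t : R.
Hypothesis t0 : 0 < t.
Variable i : 'I_N.

(** The configuration is constant just before [t], so the limit exists on every path, whatever
    happens at [t]. *)
Lemma AoI_left_cvg w : AoI L i w u @[u --> t^'-] --> AoI_left L i w t.
Proof.
have [_ [_ /(_ t t0)[c [e e0 [He _]]]]] := dyn w.
have H : AoI L i w u @[u --> t^'-] --> t - clast c i.
  rewrite /AoI; apply: cvgB; first exact: cvg_at_left_filter cvg_id.
  apply: cvg_near_cst; exists e => //= u; rewrite /ball/= ltr_norml => /andP[? ?] ut.
  by rewrite -(He u) ?ut ?andbT; [rewrite /clast/= ffunE|lra].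
by rewrite /AoI_left (cvg_lim _ H).
Qed.

Lemma AoI_left_ae : {ae P, forall w, AoI_left L i w t = AoI L i w t}.
Proof.
have : {ae P, forall w, forall p, ~ jumps (cnt p w) t}.
  have : forall p, {ae P, forall w, ~ jumps (cnt p w) t} by move=> p; exact: no_jump_ae.
  by move=> H; apply: filter_forall.
apply: filterS => w nj; have [_ [_ /(_ t t0)[c [e e0 [He]]]]] := dyn w.
rewrite step_allE events_nil//= => ct.
apply: cvg_lim => //; rewrite {2}/AoI; apply: cvgB; first exact: cvg_at_left_filter cvg_id.
apply: cvg_near_cst; exists e => //= u; rewrite /ball/= ltr_norml => /andP[? ?] ut.
have : config w u = config w t by rewrite ct; apply: He; rewrite ut andbT; lra.
by move=> /(congr1 (fun c => clast c i)); rewrite /clast/= !ffunE.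
Qed.

Lemma measurable_AoI u : measurable_fun setT (fun w => AoI L i w u).
Proof.
apply: measurable_funB => //; have [_ _ _ /(_ i)] := mconfig u.
by apply: eq_measurable_fun => w _; rewrite /clast/= ffunE.
Qed.

(** The left limit is reached along the sequence [t - t / n.+1], hence is a limit of measurable
    functions. *)
Lemma measurable_AoI_left : measurable_fun setT (fun w => AoI_left L i w t).
Proof.
pose x n : R := t - t / n.+1%:R.
have xt n : x n < t by rewrite /x ltrBlDr ltrDl divr_gt0.
have cx : x n @[n --> \oo] --> t^'-.
  have : x n @[n --> \oo] --> t.
    rewrite -[X in _ --> X]subr0; apply: cvgB; first exact: cvg_cst.
    rewrite -[0](mulr0 t); apply: cvgM; [exact: cvg_cst|exact: (@cvg_harmonic R)].
  move=> /cvgrPdist_lt H D [e /= e0 He]; move: (H e e0); apply: filterS => n ne.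
  exact: He.
apply: (measurable_fun_cvg (h := fun n w => AoI L i w (x n))).
  by move=> n; exact: measurable_AoI.
move=> w _; exact: (cvg_comp _ _ cx (AoI_left_cvg (w := w))).
Qed.

Lemma Ecomp_not_quiet h w : Ecomp S q i t h w -> (~` quiet (inr i) t (t + h)) w.
Proof.
move=> [s [/andP[ts sh] [js _]]]; apply: (@jumps_not_quiet _ _ _ s) => //.
  exact: ltW.
by rewrite ts ltW.
Qed.

(** Nothing changes before the only event, so the class in service just before it is the one at [t].
    A jump at the right end is excluded because [Ecomp] concerns an open interval. *)
Lemma Ecomp_one_event h w : 0 < h -> one_event A S (inr i) t (t + h) w ->
  ~ jumps (S i w) (t + h) -> Ecomp S q i t h w <-> Jst (q w t) = Some i.
Proof.
move=> h0 w1 nj; have th : t <= t + h by rewrite lerDl ltW.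
have [s /andP[ts sh] Hs] := one_event_time dyn (ltW t0) th w1.
have js : jumps (S i w) s by apply/(Hs (inr i) s); rewrite ?ts.
have cst u : t <= u < s -> config w u = config w t.
  move=> /andP[tu us]; apply: (config_const (dyn w)); [exact: ltW|exact: tu|].
  move=> v /andP[tv vu]; apply: events_nil => p /(Hs p v)[|_ vs]; last by lra.
  by rewrite tv; lra.
have Jcst u : t <= u < s -> Jst (q w u) = Jst (q w t).
  by move=> /cst/(congr1 (fun c => Jst (cstate c))).
split=> [[v [/andP[tv vh] [jv [e e0 He]]]]|Ji].
  have vs : v = s by have [|[]//] := Hs (inr i) v; rewrite tv ltW.
  subst v; pose u := Num.max t (s - e / 2).
  have us : u < s by rewrite gt_max ts; lra.
  have eu : s - e < u by rewrite lt_max; apply/orP; right; lra.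
  by rewrite -(Jcst u) ?us ?le_max ?lexx// He// us eu.
exists s; split; [|split=> //].
  rewrite ts lt_neqAle sh andbT; apply/eqP => E; apply: nj.
  by rewrite -E.
exists (s - t); first by lra.
by move=> u /andP[su us]; rewrite Jcst ?us ?andbT//; lra.
Qed.

(* Up to events of probability [m * M], a completion in [(t, t + h)] is a single
   event, of the service clock [i], while the state at [t] serves class [i]. *)
Lemma Ecomp_estimate f h : good f -> 0 < h -> measurable (Ecomp S q i t h) ->
  `|\int[P]_w (\1_(Ecomp S q i t h) w * f t (config w t)) -
    m_ (inr i) t (t + h) * expR (- total t (t + h)) *
      Ef (fun u c => if Jst (cstate c) == Some i then f u c else 0) t t|
  <= m_ (inr i) t (t + h) * (total t (t + h) * Ef (fun u c => `|f u c|) t t).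
Proof.
move=> gf h0 mE; set m := m_ _ _ _; set M := total _ _.
have t0' := ltW t0; have th : t <= t + h by rewrite lerDl ltW.
have m0 : 0 <= m by exact: mean_incr_ge0.
have gJ := good_restrict (fun s => Jst s == Some i) gf; have gN := good_norm gf.
have good_int := good_integrable mconfig dyn norm0_integrable.
have mF1 : measurable (one_event A S (inr i) t (t + h)) by exact: measurable_one_event.
have mQ : measurable (quiet (inr i) t (t + h)) by exact: measurable_quiet.
set F1 := one_event _ _ _ _ _ in mF1; set Q := quiet _ _ _ in mQ.
rewrite -(mean_one_event rate_ge0 mcnt mconfig law dyn norm0_integrable t (inr i) gJ t0' th).
(* [|f|] off [Q] and [F1]. On [Q] both variables vanish, and on [F1] they agree almost surely. *)
pose Z w := `|f t (config w t)| -
  (\1_Q w * `|f t (config w t)| + \1_F1 w * `|f t (config w t)|).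
have iN := good_int _ t t gN t0'.
have iQ := integrable_indicM mQ iN; have iF := integrable_indicM mF1 iN.
have iQF := integrable_addr iQ iF.
have iZ : P.-integrable setT (fun w => (Z w)%:E) by exact: (integrableB measurableT iN iQF).
have F1Q w : F1 w -> ~ Q w.
  move=> /one_eventP/(_ (inr i)); rewrite eqxx => F /(_ (inr i) (mem_head _ _)).
  by rewrite F.
have ZE w : Z w = (if pselect (Q w \/ F1 w) then 0 else `|f t (config w t)|).
  rewrite /Z !indicE; case: pselect => [[Qw|Fw]|nQF].
  - rewrite (mem_set Qw) memNset; first by rewrite /=; ring.
    by move=> /F1Q.
  - rewrite (mem_set Fw) memNset; first by rewrite /=; ring.
    exact: F1Q.
  - rewrite !memNset; first by rewrite /=; ring.
    + by move=> ?; apply: nQF; right.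
    + by move=> ?; apply: nQF; left.
have Z0 w : 0 <= Z w by rewrite ZE; case: pselect.
apply: (@le_trans _ _ (\int[P]_w Z w)).
  apply: ae_le_Rintegral_dist => //.
  - by apply: integrable_indicM => //; exact: (good_int _ t t gf).
  - by apply: integrable_indicM => //; exact: (good_int _ t t gJ).
  have th0 : 0 < t + h by rewrite addr_gt0.
  move: (no_jump_ae (inr i) th0); apply: filterS => w nj.
  have [F1w|nF1] := pselect (F1 w).
    have Ew := Ecomp_one_event h0 F1w nj.
    rewrite [\1_F1 w]indicE (mem_set F1w) mul1r.
    rewrite -[cstate (config w t)]/(q w t) indicE.
    have [/eqP/Ew Ji|/eqP nJ] := boolP (Jst (q w t) == Some i).
      by rewrite (mem_set Ji) mul1r subrr normr0.
    by rewrite memNset ?mul0r ?subrr ?normr0// => /Ew.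
  rewrite [\1_F1 w]indicE (memNset nF1) mul0r subr0 normrM.
  have [Ew|nE] := pselect (Ecomp S q i t h w); last first.
    by rewrite indicE (memNset nE) normr0 mul0r.
  rewrite indicE (mem_set Ew) normr1 mul1r ZE; case: pselect => // -[Qw|//].
  by have := Ecomp_not_quiet Ew; case.
rewrite RintegralB// RintegralD//.
rewrite (mean_quiet t (inr i) gN t0' th).
rewrite (mean_one_event rate_ge0 mcnt mconfig law dyn norm0_integrable t (inr i) gN t0' th).
rewrite -/m -/M -/(mean q G W L P (fun u c => `|f u c|) t t).
set B := mean _ _ _ _ _ _ _ _.
have B0 : 0 <= B by apply: Rintegral_ge0.
have M0 : 0 <= M by exact: total_incr_ge0.
(* As [1 - expR (- m) <= m] and [1 - expR (- M) <= M], the mean of [Z] is at most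
   [m * (1 - expR (- M)) * B], hence at most [m * (M * B)]. *)
have e1 := expR_ge1Dx (- m); have e2 := expR_ge1Dx (- M).
have h1 : (1 - expR (- m) - m) * B <= 0 by rewrite mulr_le0_ge0//; lra.
have h2 : 0 <= m * ((expR (- M) - 1 + M) * B) by rewrite !mulr_ge0//; lra.
by lra.
Qed.

Lemma total_right_cvg0 : total t (t + h) @[h --> (0 : R)^'+] --> (0 : R).
Proof.
suff H : total t (t + h) @[h --> (0 : R)^'+] --> \sum_(p : pidx N) (0 : R) by rewrite big1 in H.
apply: cvg_sumr => p; have t0' := ltW t0.
have [C [e e0 HC]] := cvg_right_bounded (@rate_right p t t0').
apply: (@cvg_bound _ _ _ (fun h => C * h)); last first.
  rewrite -[X in _ --> X](mulr0 C); apply: cvgM; first exact: cvg_cst.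
  by apply: (@cvg_at_right_filter _ _ id); exact: cvg_id.
near=> h.
have h0 : 0 < h by near: h; exact: nbhs_right_gt.
have he : h < e by near: h; exact: nbhs_right_lt.
rewrite subr0 ger0_norm; last exact: mean_incr_ge0.
have /andP[_] : 0 * (t + h - t) <= m_ p t (t + h) <= C * (t + h - t).
  apply: intensity_bounds => //; first by rewrite lerDl ltW.
  move=> v /andP[tv vh]; rewrite rate_ge0/= ?HC ?tv//; last exact: le_trans tv.
  by apply: le_lt_trans vh _; rewrite ltrD2l.
by rewrite addrAC subrr add0r.
Unshelve. all: by end_near. Qed.

(** Numerator and denominator are divided by the intensity [m h] of the service clock. It may be of
    smaller order than [h], but it is positive, since it bounds the positive probability of a
    completion. *)
Theorem condAoI_cvg :
  (forall h : R, 0 < h -> measurable (Ecomp S q i t h) /\ (0 < P (Ecomp S q i t h))%E) ->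
  0 < Ef (fun _ c => if Jst (cstate c) == Some i then 1 else 0) t t ->
  condAoI S q L P i t @ 0^'+ -->
    Ef (fun u c => if Jst (cstate c) == Some i then u - clast c i else 0) t t /
    Ef (fun _ c => if Jst (cstate c) == Some i then 1 else 0) t t.
Proof.
move=> HE J0; have t0' := ltW t0.
pose fA u (c : cfg R N) := u - clast c i.
have gA : good fA by exact: good_delivered.
have g1 : good (fun (_ : R) (_ : cfg R N) => 1 : R) by exact: (good_cstate (fun=> 1)).
pose m h := m_ (inr i) t (t + h).
pose num f h := \int[P]_w (\1_(Ecomp S q i t h) w * f t (config w t)) : R.
have m_gt0 h : 0 < h -> 0 < m h.
  move=> h0; have th : t <= t + h by rewrite lerDl ltW.
  have [mE PE] := HE h h0.
  have : (P (Ecomp S q i t h) <= (m h)%:E)%E.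
    apply: le_trans (not_quiet_prob (inr i) t0' th); apply: le_measure; rewrite ?inE//.
      by apply: measurableC; exact: measurable_quiet.
    exact: Ecomp_not_quiet.
  by move=> /(lt_le_trans PE); rewrite lte_fin.
have num_cvg f : good f -> num f h / m h @[h --> (0 : R)^'+] -->
    Ef (fun u c => if Jst (cstate c) == Some i then f u c else 0) t t.
  move=> gf; set a := mean _ _ _ _ _ _ _ _; set B := Ef (fun u c => `|f u c|) t t.
  apply: (@cvg_bound _ _ _ (fun h => total t (t + h) * (B + `|a|))); last first.
    rewrite -[0 in X in _ --> X](mul0r (B + `|a|)).
    by apply: cvgM; [exact: total_right_cvg0|exact: cvg_cst].
  near=> h; have h0 : 0 < h by near: h; exact: nbhs_right_gt.
  have mh := m_gt0 h h0; have := Ecomp_estimate gf h0 (HE h h0).1.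
  rewrite -/a -/B -/(m h) -/(num f h); set M := total _ _ => H.
  have M0 : 0 <= M by exact: total_incr_ge0.
  have -> : num f h / m h - a = (num f h - m h * expR (- M) * a) / m h + (expR (- M) - 1) * a.
    by field; rewrite gt_eqF.
  apply: le_trans (ler_normD _ _) _; rewrite mulrDr lerD//.
    by rewrite normrM normfV (gtr0_norm mh) ler_pdivrMr// (mulrC _ (m h)).
  rewrite normrM ler_wpM2r//.
  have e1 : expR (- M) <= 1 by rewrite expR_le1 oppr_le0.
  have e2 := expR_ge1Dx (- M).
  by rewrite ler0_norm; lra.
have numE h : 0 < h -> condAoI S q L P i t h = (num fA h / m h) / (num (fun _ _ => 1) h / m h).
  move=> h0; have mh := m_gt0 h h0; have [mE PE] := HE h h0.
  have -> : num (fun _ _ => 1) h = fine (P (Ecomp S q i t h)).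
    by rewrite /num Rintegral_indic// /Rintegral integral_cst// mul1e.
  (* Almost surely no event falls at [t], so the left limit may be replaced by the age at [t]. *)
  have -> : num fA h = fine (\int[P]_(w in Ecomp S q i t h) (AoI_left L i w t)%:E).
    rewrite /num Rintegral_indic//; congr fine; apply: ae_eq_integral => //.
    - apply: measurable_funTS; apply: measurable_int.
      exact: (good_integrable mconfig dyn norm0_integrable t gA t0').
    - by apply: measurable_funTS; apply/measurable_EFinP; exact: measurable_AoI_left.
    move: AoI_left_ae; apply: filterS => w -> _.
    by rewrite /fA /AoI /clast/= ffunE.
  rewrite /condAoI; have PE0 : fine (P (Ecomp S q i t h)) != 0.
    rewrite gt_eqF// fine_gt0// PE/=.
    by rewrite ltey_eq fin_num_measure.
  by field; rewrite PE0 gt_eqF.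
have H : (num fA h / m h) / (num (fun _ _ => 1) h / m h) @[h --> (0 : R)^'+] -->
    Ef (fun u c => if Jst (cstate c) == Some i then u - clast c i else 0) t t /
    Ef (fun _ c => if Jst (cstate c) == Some i then 1 else 0) t t.
  apply: cvgM; first exact: (num_cvg _ gA).
  by apply: cvgV; [rewrite gt_eqF|exact: (num_cvg _ g1)].
apply: cvg_trans H; apply: near_eq_cvg; near=> h.
by rewrite numE//; near: h; exact: nbhs_right_gt.
Unshelve. all: by end_near. Qed.

End PeakAge.

(** * Summation over states *)

Section Totals.
Variables (R : realType) (N : nat) (d : measure_display) (Omega : measurableType d).
Variables (A S : 'I_N -> Omega -> R -> nat)
  (q : Omega -> R -> st N) (G : Omega -> R -> R) (W L : 'I_N -> Omega -> R -> R).
Variable P : probability Omega R.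
Implicit Types (w : Omega) (t u : R) (s a : st N) (f : R -> cfg R N -> R) (i : 'I_N).

Local Notation config := (config q G W L).
Local Notation Ef := (mean q G W L P).

Lemma rv_mulmx_col (g : st N -> R) (v : 'cV[R]_(nQ N)) :
  (rv_of g *m v) 0 0 = \sum_s g s * v (state_index s) 0.
Proof.
rewrite mxE (reindex (@state_index N)); last exact/onW_bij/state_index_bij.
by apply: eq_bigr => a _; rewrite rv_ofE.
Qed.

Lemma measurable_config :
  (forall (t : R) s, measurable [set w | q w t = s]) ->
  (forall t : R, measurable_fun setT (fun w => G w t)) ->
  (forall k (t : R), measurable_fun setT (fun w => W k w t) /\
                     measurable_fun setT (fun w => L k w t)) ->
  forall t, cfg_measurable (fun w => config w t).
Proof.
move=> mq mG mWL t; split=> [s||k|k]; [exact: mq|exact: mG| |]; have [mW mL] := mWL k t.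
- by apply: eq_measurable_fun mW => w _; rewrite /cwait/= ffunE.
- by apply: eq_measurable_fun mL => w _; rewrite /clast/= ffunE.
Qed.

(** At time 0 each summand of [cfg_norm] is the absolute value of an initial age, both being 0 for
    an idle server or an empty buffer. *)
Lemma initial_norm_integrable :
  (forall i, P.-integrable setT (fun w => (AoI L i w 0)%:E) /\
             P.-integrable setT (fun w => (Zage q W i w 0)%:E)) ->
  P.-integrable setT (fun w => (Yage q G w 0)%:E) ->
  P.-integrable setT (fun w => (cfg_norm (config w 0))%:E).
Proof.
move=> iAZ iY.
rewrite (_ : (fun w => _) = fun w => (\sum_i `|AoI L i w 0| +
    (`|Yage q G w 0| + \sum_i `|Zage q W i w 0|))%:E).
  apply: integrable_addr; first by apply: integrable_sumr => i; exact: integrable_norm (iAZ i).1.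
  apply: integrable_addr; first exact: integrable_norm iY.
  by apply: integrable_sumr => i; exact: integrable_norm (iAZ i).2.
apply/funext => w; congr EFin; rewrite /cfg_norm /cstate/cgen/cwait/clast/=; congr (_ + (_ + _)).
- by apply: eq_bigr => i _; rewrite ffunE /AoI sub0r normrN.
- by rewrite /Yage; case: (q w 0) => [s|] /=; rewrite ?sub0r ?normrN ?normr0.
- by apply: eq_bigr => i _; rewrite ffunE /Zage; case: ifP; rewrite ?sub0r ?normrN ?normr0.
Qed.

Hypothesis mconfig : forall t, cfg_measurable (fun w => config w t).
Hypothesis dyn : forall w, dynamics A S q G W L w.
Hypothesis norm0_integrable : P.-integrable setT (fun w => (cfg_norm (config w 0))%:E).

Lemma ages_integrable t : 0 <= t ->
  (forall i, P.-integrable setT (fun w => (AoI L i w t)%:E) /\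
             P.-integrable setT (fun w => (Zage q W i w t)%:E)) /\
  P.-integrable setT (fun w => (Yage q G w t)%:E).
Proof.
move=> t0; have good_int f := good_integrable mconfig dyn norm0_integrable (f := f) t (t := t).
split=> [i|]; [split|].
- rewrite (_ : (fun w => _) = fun w => (t - clast (config w t) i)%:E).
    exact: (good_int _ (good_delivered R i) t0).
  by apply/funext => w; rewrite /clast/= ffunE.
- rewrite (_ : (fun w => _) = fun w => (if Bst (cstate (config w t)) i
      then t - cwait (config w t) i else 0)%:E).
    exact: (good_int _ (good_waiting R i) t0).
  by apply/funext => w; rewrite /cwait/= ffunE.
- rewrite (_ : (fun w => _) = fun w => (if cstate (config w t) != None
      then t - cgen (config w t) else 0)%:E).
    exact: (good_int _ (@good_served R N) t0).
  by apply/funext => w; rewrite /Yage /cstate/=; case: (q w t).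
Qed.

(** The weight [k] is 1 or the indicator of a set of states; on each path only the term of the
    current state survives. *)
Lemma mean_partition f (F : st N -> R -> cfg R N -> R) (k : st N -> R) t : 0 <= t ->
  (forall a, good (F a)) -> (forall a c, cstate c != a -> F a t c = 0) ->
  (forall c, f t c = k (cstate c) * F (cstate c) t c) ->
  \sum_s Ef (F s) t t * k s = Ef f t t.
Proof.
move=> t0 gF F0 fF.
have iF s : P.-integrable setT (fun w => (F s t (config w t))%:E).
  exact: (good_integrable mconfig dyn norm0_integrable t (gF s) t0).
transitivity (\sum_s \int[P]_w (k s * F s t (config w t))).
  by apply: eq_bigr => s _; rewrite mulrC; apply/esym/RintegralZl => //; exact: iF.
rewrite -Rintegral_sumr => [|s]; last exact: integrable_mulr.
apply: eq_Rintegral => w _; rewrite fF (bigD1 (cstate (config w t)))//= big1 ?addr0// => s sw.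
by rewrite F0 ?mulr0// eq_sym.
Qed.

Lemma meanAoI_total i t : 0 <= t -> meanAoI L P i t = (avec q L P i t *m ones R N) 0 0.
Proof.
move=> t0; rewrite (avecE q G W L P) rv_mulmx_col.
under eq_bigr => s _ do rewrite mxE.
rewrite (@mean_partition (fun u c => u - clast c i) _ (fun=> 1))// => [|a|a c ca|c].
- by apply: eq_Rintegral => w _; rewrite /AoI /clast/= ffunE.
- exact: good_delivered_age.
- by rewrite /delivered_age (negbTE ca).
- by rewrite /delivered_age eqxx mul1r.
Qed.

Lemma avec_service i t : 0 <= t ->
  (avec q L P i t *m (delta R (fun s : st N => Jst s == Some i))^T) 0 0 =
  Ef (fun u c => if Jst (cstate c) == Some i then u - clast c i else 0) t t.
Proof.
move=> t0; rewrite (avecE q G W L P) rv_mulmx_col.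
under eq_bigr => s _ do rewrite mxE rv_ofE.
apply: mean_partition => // [a|a c ca|c].
- exact: good_delivered_age.
- by rewrite /delivered_age (negbTE ca).
- by rewrite /delivered_age eqxx; case: ifP; rewrite ?mul1r ?mul0r.
Qed.

Lemma pvec_service i t : 0 <= t ->
  (pvec q P t *m (delta R (fun s : st N => Jst s == Some i))^T) 0 0 =
  Ef (fun _ c => if Jst (cstate c) == Some i then 1 else 0) t t.
Proof.
move=> t0; rewrite (pvecE P mconfig) rv_mulmx_col.
under eq_bigr => s _ do rewrite mxE rv_ofE.
apply: mean_partition => // [a|a c ca|c].
- exact: good_in_state.
- by rewrite /in_state (negbTE ca).
- by rewrite /in_state eqxx mulr1.
Qed.

End Totals.

Theorem theorem1 (R : realType) (N : nat) (T : R)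
  (lam mu : 'I_N -> R -> R)
  (d : measure_display) (Omega : measurableType d) (P : probability Omega R)
  (A S : 'I_N -> Omega -> R -> nat)
  (q : Omega -> R -> st N) (G : Omega -> R -> R) (W L : 'I_N -> Omega -> R -> R) :
  (0 < N)%N -> 0 < T ->
  (forall k, piecewise_continuous (lam k) /\ piecewise_continuous (mu k)) ->
  (forall k, periodic_on_nonneg T (lam k) /\ periodic_on_nonneg T (mu k)) ->
  (forall k t, 0 <= t -> 0 <= lam k t /\ 0 <= mu k t) ->
  (* measurability of the processes *)
  (forall k (t : R) (n : nat), measurable [set w | A k w t = n] /\
                               measurable [set w | S k w t = n]) ->
  (forall (t : R) (s : st N), measurable [set w | q w t = s]) ->
  (forall t : R, measurable_fun setT (fun w => G w t)) ->
  (forall k (t : R), measurable_fun setT (fun w => W k w t) /\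
                     measurable_fun setT (fun w => L k w t)) ->
  (* independent time-varying Poisson drivers, independent of the initial data *)
  poisson_law lam mu A S q G W L P ->
  (* sample-path dynamics of the queue *)
  (forall w, dynamics A S q G W L w) ->
  {ae P, forall w, init_consistent q G W L w} ->
  (* integrable initial ages *)
  (forall i, P.-integrable setT (fun w => (AoI L i w 0)%:E) /\
             P.-integrable setT (fun w => (Zage q W i w 0)%:E)) ->
  P.-integrable setT (fun w => (Yage q G w 0)%:E) ->
  (* conclusions *)
  (forall t : R, 0 <= t ->
     (forall i, P.-integrable setT (fun w => (AoI L i w t)%:E) /\
                P.-integrable setT (fun w => (Zage q W i w t)%:E)) /\
     P.-integrable setT (fun w => (Yage q G w t)%:E)) /\
  (forall t : R, 0 < t ->
     (forall k, {for t, continuous (lam k)} /\ {for t, continuous (mu k)}) ->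
     forall (i : 'I_N) (x : 'I_(nQ N)),
     (* (i) *)
     is_derive t 1 (fun u => avec q L P i u 0 x)
       ((pvec q P t + avec q L P i t *m Qgen lam mu t
         + (yvec q G P t - avec q L P i t) *m Mcls mu i t) 0 x) /\
     (* (ii) *)
     is_derive t 1 (fun u => yvec q G P u 0 x)
       ((hadamard (pvec q P t) (delta R (fun s : st N => Jst s != None))
         + yvec q G P t *m Qgen lam mu t
         + (\sum_(k < N) hadamard (zvec q W P k t)
                          (delta R (fun s : st N => nextc s == Some k))
            - yvec q G P t) *m Mcomp mu t) 0 x) /\
     (* (iii) *)
     is_derive t 1 (fun u => zvec q W P i u 0 x)
       ((hadamard (pvec q P t) (delta R (fun s : st N => Bst s i))
         + zvec q W P i t *m Qgen lam mu t
         - lam i t *: hadamard (zvec q W P i t) (delta R (fun s : st N => Bst s i))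
         - zvec q W P i t *m Mnext mu i t) 0 x)) /\
  (* mean AoI *)
  (forall (i : 'I_N) (t : R), 0 <= t ->
     meanAoI L P i t = (avec q L P i t *m ones R N) 0 0) /\
  (* mean peak AoI, wherever it is defined *)
  (forall (i : 'I_N) (t : R), 0 < t ->
     (forall h : R, 0 < h -> measurable (Ecomp S q i t h) /\
                             (0 < P (Ecomp S q i t h))%E) ->
     0 < (pvec q P t *m (delta R (fun s : st N => Jst s == Some i))^T) 0 0 ->
     condAoI S q L P i t @ 0^'+ -->
       (avec q L P i t *m (delta R (fun s : st N => Jst s == Some i))^T) 0 0 /
       (pvec q P t *m (delta R (fun s : st N => Jst s == Some i))^T) 0 0).
Proof.
move=> N0 T0 pc _ rates0 mAS mq mG mWL law dyn init iAZ iY.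
have rate_ge0 p t : 0 <= t -> 0 <= rate lam mu p t.
  by move=> t0; case: p => k /=; case: (rates0 k t t0).
have rate_left p t : 0 < t -> cvg (rate lam mu p @ t^'-).
  by move=> t0; case: p => k /=; have [[_ [_ l]] [_ [_ m]]] := pc k; [exact: l|exact: m].
have rate_right p t : 0 <= t -> cvg (rate lam mu p @ t^'+).
  by move=> t0; case: p => k /=; have [[_ [l _]] [_ [m _]]] := pc k; [exact: l|exact: m].
have mcnt p t n : measurable [set w | cnt A S p w t = n].
  by case: p => k /=; case: (mAS k t n).
have mcfg := measurable_config mq mG mWL.
have norm0 := initial_norm_integrable iAZ iY.
split; [|split; [|split]].
- by move=> t t0; exact: (ages_integrable mcfg dyn norm0 t0).
- move=> t t0 cont i x.
  have rate_cont p : {for t, continuous (rate lam mu p)} by case: p => k; case: (cont k).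
  (* Every coordinate is the index of a state. *)
  have [k _ kK] := state_index_bij N; rewrite -(kK x); split; [|split].
  + exact: (avec_derive rate_ge0 mcnt mcfg law dyn norm0 init t0 rate_cont).
  + exact: (yvec_derive rate_ge0 mcnt mcfg law dyn norm0 init t0 rate_cont).
  + exact: (zvec_derive rate_ge0 mcnt mcfg law dyn norm0 init t0 rate_cont).
- by move=> i t t0; exact: (meanAoI_total mcfg dyn norm0 i t0).
- move=> i t t0 HE; have t0' := ltW t0.
  rewrite (avec_service mcfg dyn norm0 i t0') (pvec_service mcfg dyn norm0 i t0').
  exact: (condAoI_cvg rate_ge0 rate_left rate_right mcnt mcfg law dyn norm0 t0 HE).
Qed.
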